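(* Let $K$ be an algebraically closed field of characteristic $0$, let $A\subset K$ be a finite set and let $\alpha>0$ be a real number with $|A\cdot A|\leq \alpha|A|$, where $A\cdot A=\{aa':a,a'\in A\}$. Then for every integer $h\geq 2$, $$|hA|\geq e^{-h^{65h}(\alpha+1)}\,|A|^h,$$ where $hA=\{a_1+\dots+a_h: a_i\in A\}$. *)

(* Defs.v *)
From HB Require Import structures.
From mathcomp Require Import all_boot all_algebra finmap.
Set Implicit Arguments. Unset Strict Implicit. Unset Printing Implicit Defensive.
Import GRing.Theory.
Local Open Scope ring_scope.
Local Open Scope fset_scope.

Definition prodset (K : closedFieldType) (A : {fset K}) : {fset K} :=
  [fset (a * b)%R | a in A, b in A].

Fixpoint sumset (K : closedFieldType) (h : nat) (A : {fset K}) : {fset K} :=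
  match h with
  | 0 => [fset (0 : K)]
  | h'.+1 => [fset (a + b)%R | a in A, b in sumset h' A]
  end.

(* Main.v *)
(** After discarding 0, a specialization of the ring generated by [A] makes [A] a subset of a
    Galois number field, without merging elements of [A] or separating equal sums or products.
    There [A] is studied through the absolute logarithmic height.

    The bound [|A A| <= alpha |A|] is used twice. A generic linear form on the group generated
    by [A] modulo torsion orders [A]; counting sums of minimal elements and atoms shows that
    half of [A] lies in a coset of a group of rank at most [2 alpha]. By the Pluennecke-Ruzsa
    inequalities [n]-fold products grow polynomially in [n], whereas ratios occurring at [q]
    dyadic scales of height would produce [2^(q/2)] distinct products; hence the heights of
    ratios meet only [O(log |A|)] dyadic scales, up to a factor depending on [alpha].

    Solutions in [A] of a linear equation are cut into cells whose points are close to each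
    other coordinatewise; a packing argument in the finite rank group bounds the number of
    cells. In a cell of large height the solutions lie on a second hyperplane, for otherwise
    cofactors of small height would express the coefficients of the equation. In a cell of small
    height the determinant of a system of solutions is a vanishing sum of terms of small height.
    Such a sum stays zero when its terms are replaced by their [p]-th powers, for a prime [p]
    exceeding their number (the new sum is a multiple of [p], too large for its height if
    nonzero), hence it splits into vanishing subsums of terms equal up to roots of unity, which
    confines the solutions to boundedly many hyperplanes. Eliminating variables, nondegenerate
    solutions fall into few lines, and an energy estimate with the Cauchy-Schwarz inequality
    bounds the sumset from below. *)

Require Import Defs.
From Stdlib Require Import Reals.
From HB Require Import structures.
From mathcomp Require Import all_boot all_order all_algebra all_fingroup all_field finmap.
From mathcomp Require Import Rstruct Rstruct_topology.
From mathcomp Require classical_sets.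
From mathcomp Require Import complex boolp reals sequences exp ring lra zify.
Set Implicit Arguments. Unset Strict Implicit. Unset Printing Implicit Defensive.
Import Order.TTheory GRing.Theory Num.Theory.
Local Open Scope ring_scope.

(** The exponent is to be linear in [alpha], and this decides where each consequence of the
    hypothesis is used. The rank stands in the exponent of the number of cells, so it has to be
    linear in [alpha]; the growth of products only gives bounds polynomial in [alpha], but these
    count scales and enter through a logarithm. That the number of scales grows with [ln |A|] is
    harmless. A nondegenerate relation in three or more variables has at most [|A|] solutions per
    line, while the energy estimate tolerates about [|A|^(3/2)]; the square of the number of lines,
    a power of [1 + ln |A|] up to constants, is absorbed by the spare factor [|A|]. Elimination
    changes the coefficients of the equations beyond control, so no step may depend on their
    heights: a solution [y] of an equation [c] is measured by the height of the point with
    coordinates [c_i y_i]. Nor is the degree of the number field controlled, whence heights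
    normalised by the degree and constants that ignore it. *)

Lemma seq_neq0 (F : fieldType) (X : seq F) x : 0 \notin X -> x \in X -> x != 0.
Proof. by move=> X0 xX; apply: contraNneq X0 => <-. Qed.

Lemma codom_neq0 (F : fieldType) (T : finType) (f : T -> F) :
  (forall i, f i != 0) -> 0 \notin codom f.
Proof. by move=> f0; apply/negP => /codomP [i /esym/eqP]; apply/negP. Qed.

(** * Specialization *)

(* Every nonzero element of [ev S] stays nonzero under some homomorphism to [Om] that factors
   through [ev S]. *)
Definition specializes (K Om : fieldType) (S : idomainType) (ev : {rmorphism S -> K}) :=
  forall D, ev D != 0 ->
    exists phi : {rmorphism S -> Om}, (forall P, ev P = 0 -> phi P = 0) /\ phi D != 0.

Definition ev_at (S : idomainType) (K : fieldType) (ev : {rmorphism S -> K}) (a : K) :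
  {rmorphism {poly S} -> K} := horner_morph (fun x => mulrC a (ev x)).

Lemma ev_atE (S : idomainType) (K : fieldType) (ev : {rmorphism S -> K}) (a : K) P :
  ev_at ev a P = (map_poly ev P).[a].
Proof. by []. Qed.

Lemma map_poly_eq0P (S : idomainType) (K : fieldType) (ev : {rmorphism S -> K}) (P : {poly S}) :
  (map_poly ev P = 0) <-> (forall i, ev P`_i = 0).
Proof.
split=> [H i|H]; first by have := coef_map ev P i; rewrite H coef0.
by apply/polyP=> i; rewrite coef_map coef0; exact: H.
Qed.

(** Since [ev] may have a kernel, degrees in [{poly S}] are not degrees over [K]. Dropping a leading
    coefficient killed by [ev] shows that a polynomial of least size has a leading coefficient that
    survives. *)
Lemma ev_at_drop_lead (S : idomainType) (K : fieldType) (ev : {rmorphism S -> K})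
    (P : {poly S}) : ev (lead_coef P) = 0 -> P != 0 ->
  exists2 P' : {poly S}, (size P' < size P)%N & map_poly ev P' = map_poly ev P.
Proof.
move=> lP P0; exists (take_poly (size P).-1 P).
  by rewrite (leq_ltn_trans (size_take_poly _ _)) // prednK // size_poly_gt0.
apply/polyP=> i; rewrite !coef_map /= coef_take_poly; case: ifP => // /negbT.
rewrite -leqNgt => le_i; case: (ltnP i (size P)) => [lt_i|le_i']; last first.
  by rewrite [P`_i]nth_default.
suff -> : i = (size P).-1 by rewrite -lead_coefE lP rmorph0.
by apply/eqP; rewrite eqn_leq le_i andbT -ltnS prednK // (leq_ltn_trans _ lt_i).
Qed.

(** With no algebraic relation to respect, [a] may be sent to any [y]. Some coefficient of [D]
    survives [phi], and [y] is taken off the roots of the resulting nonzero polynomial. *)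
Lemma specializes_transc (K Om : fieldType) (S : idomainType) (ev : {rmorphism S -> K}) (a : K) :
    (forall p : {poly Om}, p != 0 -> exists x, ~~ root p x) ->
    specializes Om ev ->
    (forall P : {poly S}, ev_at ev a P = 0 -> map_poly ev P = 0) ->
  specializes Om (ev_at ev a).
Proof.
move=> nonroot sp tr D Da.
have [i Di] : exists i, ev D`_i != 0.
  apply/not_existsP => H; case/eqP: Da; rewrite ev_atE.
  by rewrite ((map_poly_eq0P ev D).2 _) ?horner0 // => i; apply/eqP/negPn/negP/H.
have [phi [phi0 phiD]] := sp _ Di.
have [|y Hy] := nonroot (map_poly phi D).
  by apply: contraNneq phiD => /map_poly_eq0P ->.
exists (ev_at phi y); split=> [P Pa|]; last exact: Hy.
have /map_poly_eq0P H := tr _ Pa.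
by rewrite ev_atE ((map_poly_eq0P phi P).2 _) ?horner0 // => j; apply: phi0.
Qed.

Lemma ex_min_size (S : idomainType) (Q : {poly S} -> Prop) :
  (exists P, Q P) -> exists2 P, Q P & forall P', Q P' -> (size P <= size P')%N.
Proof.
move=> [P0 QP0].
have ex : exists n, `[< exists2 P, Q P & size P = n >].
  by exists (size P0); apply/asboolP; exists P0.
case: (ex_minnP ex) => n /asboolP [P QP <-] min; exists P => // P' QP'.
by apply: min; apply/asboolP; exists P'.
Qed.

Import Pdiv.Idomain.

(** [m] plays the part of a minimal polynomial of [a]. Pseudo-division by [m] only multiplies by
    powers of its leading coefficient, so any root [y] of the image of [m] is an admissible value
    for [a] once [phi] keeps that coefficient nonzero. Keeping the Bezout constant nonzero as well
    prevents [D] from vanishing at [y]. *)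
Lemma specializes_alg (K Om : fieldType) (S : idomainType) (ev : {rmorphism S -> K}) (a : K) :
    (forall p : {poly Om}, size p != 1 -> exists x, root p x) ->
    specializes Om ev ->
    (exists P : {poly S}, ev_at ev a P = 0 /\ map_poly ev P != 0) ->
  specializes Om (ev_at ev a).
Proof.
move=> hasroot sp exP D Da.
have [m [ma m0] minm] := ex_min_size exP.
have m_neq0 : m != 0 by apply: contraNneq m0 => ->; rewrite rmorph0.
have lm : ev (lead_coef m) != 0.
  apply/eqP => /ev_at_drop_lead /(_ m_neq0) [m' lt_m' Em'].
  by have := minm m'; rewrite ev_atE Em' -ev_atE leqNgt lt_m'; move/(_ (conj ma m0)).
have sm : (1 < size m)%N.
  rewrite ltnNge; apply/negP => /size1_polyC Em.
  by move: ma m0; rewrite ev_atE Em map_polyC hornerC /= => ->; rewrite eqxx.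
have small (r : {poly S}) : (size r < size m)%N -> ev_at ev a r = 0 -> map_poly ev r = 0.
  move=> lt_r ra; apply/eqP/negPn/negP => r0.
  by have := minm r (conj ra r0); rewrite leqNgt lt_r.
(* Bezout: the least-degree combination of [D] and [m] (modulo [ev]) that does not vanish
   at [a] is a constant. *)
pose Q (P : {poly S}) := ev_at ev a P != 0 /\
  exists U V Z : {poly S}, P = U * D + V * m + Z /\ map_poly ev Z = 0.
have [P [Pa [U [V [Z [EP Z0]]]]] minP] : exists2 P, Q P &
    forall P', Q P' -> (size P <= size P')%N.
  apply: ex_min_size; exists D; split => //; exists 1, 0, 0.
  by rewrite mul1r mul0r !addr0 rmorph0.
have P_neq0 : P != 0 by apply: contraNneq Pa => ->; rewrite rmorph0.
have lP : ev (lead_coef P) != 0.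
  apply/eqP => /ev_at_drop_lead /(_ P_neq0) [P' lt_P' EP'].
  suff /minP : Q P' by rewrite leqNgt lt_P'.
  split; first by rewrite ev_atE EP'.
  exists U, V, (P' - P + Z); split; first by rewrite {1}EP; ring.
  by rewrite rmorphD rmorphB /= EP' subrr Z0 addr0.
have sPm : (size P < size m)%N.
  have Em := divp_eq P m; have lt_r : (size (modp P m) < size m)%N by rewrite ltn_modp.
  apply: leq_ltn_trans lt_r; apply: minP; split.
    have /(congr1 (ev_at ev a)) := Em.
    rewrite -mul_polyC rmorphM rmorphD rmorphM /= ma mulr0 add0r => <-.
    by rewrite mulf_neq0 // ev_atE map_polyC hornerC /= rmorphXn expf_neq0.
  set c := lead_coef m ^+ scalp P m in Em.
  exists (c%:P * U), (c%:P * V - P %/ m), (c%:P * Z); split.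
    have -> : P %% m = c *: P - P %/ m * m by rewrite Em addrC addKr.
    by rewrite -mul_polyC EP; ring.
  by rewrite rmorphM /= Z0 mulr0.
have sP1 : (size P <= 1)%N.
  rewrite leqNgt; apply/negP => sP.
  have Em := divp_eq m P.
  set c := lead_coef P ^+ scalp m P in Em.
  have c0 : ev c != 0 by rewrite rmorphXn expf_neq0.
  have lt_r : (size (modp m P) < size P)%N by rewrite ltn_modp.
  have q0 : map_poly ev (m %/ P) = 0.
    apply: small.
      rewrite size_divp // ltn_subrL; rewrite -ltnS prednK ?(ltnW sP) // sP /=.
      by rewrite (ltn_trans _ sm).
    apply/eqP/negPn/negP => qa.
    suff /minP : Q (m %% P) by rewrite leqNgt lt_r.
    split.
      have /(congr1 (ev_at ev a)) := Em.
      rewrite -mul_polyC rmorphM /= ma mulr0 rmorphD rmorphM /= => /esym/eqP.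
      rewrite addrC addr_eq0 => /eqP ->.
      by rewrite oppr_eq0 mulf_neq0.
    exists (- (m %/ P) * U), (c%:P - (m %/ P) * V), (- (m %/ P) * Z); split.
      have -> : m %% P = c *: m - m %/ P * P by rewrite Em addrC addKr.
      by rewrite -mul_polyC {2}EP; ring.
    by rewrite rmorphM /= Z0 mulr0.
  have /(congr1 (fun p => (map_poly ev p)`_(size m).-1)) := Em.
  rewrite rmorphD rmorphM /= q0 mul0r add0r !coef_map /= coefZ rmorphM /= -lead_coefE.
  have -> : (m %% P)`_(size m).-1 = 0.
    rewrite nth_default // -ltnS (ltn_predK sm).
    exact: leq_trans lt_r (ltnW sPm).
  rewrite rmorph0.
  by apply/eqP; rewrite mulf_neq0.
have [phi [phi0]] : exists phi : {rmorphism S -> Om}, (forall P, ev P = 0 -> phi P = 0) /\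
    phi (lead_coef m * P`_0) != 0.
  apply: sp; rewrite rmorphM mulf_neq0 //.
  by move: Pa; rewrite ev_atE {1}(size1_polyC sP1) map_polyC hornerC.
rewrite rmorphM mulf_eq0 negb_or => /andP [phil phiP].
have [|y my] := hasroot (map_poly phi m).
  by rewrite size_map_poly_id0 // neq_ltn sm orbT.
have zero_phi (r : {poly S}) : map_poly ev r = 0 -> map_poly phi r = 0.
  by move=> /map_poly_eq0P H; apply/map_poly_eq0P => i; apply: phi0.
exists (ev_at phi y); split=> [p pa|].
  have Ep := divp_eq p m; set c := lead_coef m ^+ scalp p m in Ep.
  have c0 : phi c != 0 by rewrite rmorphXn expf_neq0.
  have r0 : map_poly ev (p %% m) = 0.
    apply: small; first by rewrite ltn_modp.
    have /(congr1 (ev_at ev a)) := Ep.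
    by rewrite -mul_polyC rmorphM rmorphD rmorphM /= pa ma !mulr0 add0r.
  have /(congr1 (ev_at phi y)) := Ep.
  rewrite -mul_polyC rmorphM rmorphD rmorphM /= !ev_atE (eqP my) mulr0 add0r.
  rewrite (zero_phi _ r0) horner0 map_polyC hornerC => /eqP.
  by rewrite mulf_eq0 (negPf c0) /= => /eqP.
apply: contraNneq phiP => Dy.
have /(congr1 (ev_at phi y)) := EP.
rewrite !rmorphD !rmorphM /= Dy mulr0 add0r !ev_atE (eqP my) mulr0 add0r.
by rewrite (zero_phi _ Z0) horner0 {1}(size1_polyC sP1) map_polyC hornerC /= => ->.
Qed.

(** The third clause keeps the image of the base ring within reach; [ext_embedding] needs it for the
    rational scalars. *)
Lemma specializes_exists (K : fieldType) (Om : closedFieldType) (S0 : idomainType)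
    (ev0 : {rmorphism S0 -> K}) (s : seq K) : specializes Om ev0 ->
  exists (S : idomainType) (ev : {rmorphism S -> K}),
    [/\ specializes Om ev, {in s, forall a, exists P, ev P = a} &
        forall c, exists P, ev P = ev0 c].
Proof.
move=> sp0; elim: s => [|a s [S [ev [sp im im0]]]].
  by exists S0, ev0; split=> // c; exists c.
exists {poly S}, (ev_at ev a); split.
- case: (pselect (exists P : {poly S}, ev_at ev a P = 0 /\ map_poly ev P != 0)) => H.
    by apply: specializes_alg => // p /closed_rootP.
  apply: specializes_transc => // [p /closed_nonrootP //|P Pa].
  by apply/eqP/negPn/negP => P0; apply: H; exists P.
- move=> b; rewrite inE => /orP [/eqP ->|/im [P <-]].
    by exists 'X; rewrite ev_atE map_polyX hornerX.
  by exists P%:P; rewrite ev_atE map_polyC hornerC.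
- by move=> c; have [P <-] := im0 c; exists P%:P; rewrite ev_atE map_polyC hornerC.
Qed.

Lemma intr_eq0_pchar0 (K : fieldType) : [pchar K] =i pred0 ->
  forall z : int, (z%:~R == 0 :> K) = (z == 0).
Proof.
move=> cK z; have /pcharf0P cK' := cK.
by case: z => n; rewrite ?NegzE ?rmorphN /= ?oppr_eq0 -pmulrn cK'.
Qed.

Lemma specializes_int (K Om : fieldType) : [pchar K] =i pred0 -> [pchar Om] =i pred0 ->
  specializes Om (intr : {rmorphism int -> K}).
Proof.
move=> cK cO D D0; exists intr; split=> [P /eqP|].
  by rewrite intr_eq0_pchar0 // => /eqP ->; rewrite rmorph0.
by move: D0; rewrite !intr_eq0_pchar0.
Qed.

(** * Heights on a Galois number field *)

Lemma lnMp (R : realType) (x y : R) : 0 < x -> 0 < y -> ln (x * y) = ln x + ln y.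
Proof. by move=> x0 y0; rewrite lnM ?posrE. Qed.

Lemma ln_homo (R : realType) (x y : R) : 0 < x -> x <= y -> ln x <= ln y.
Proof. by move=> x0 xy; rewrite ler_ln ?posrE // (lt_le_trans x0). Qed.

Lemma Aint_root (x : algC) n : (0 < n)%N -> x ^+ n \in Aint -> x \in Aint.
Proof.
move=> n0 xn; apply: (@root_monic_Aint (minCpoly (x ^+ n) \Po 'X^n)).
- by rewrite /root horner_comp hornerXn; exact: root_minCpoly.
- by rewrite monicE lead_coef_comp ?size_polyXn // (monicP (minCpoly_monic _)) lead_coefXn mul1r expr1n.
- by apply: polyOver_comp => //; rewrite rpredX // polyOverX.
Qed.

Lemma Aint_denom (x : algC) : exists2 m : int, m != 0 & m%:~R * x \in Aint.
Proof.
have [p [Ep mon_p] dv_p] := minCpolyP x.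
have [q [a a0 Eq]] := rat_poly_scale p.
exists a => //; set d := (size p).-1.
have szp : size p = d.+1 by rewrite prednK // size_poly_gt0 monic_neq0.
have x0 : (map_poly ratr p).[x] = 0 by apply/eqP; rewrite -/(root _ _) -Ep root_minCpoly.
(* Multiplying the roots of [p] by [a] multiplies the coefficient of index [i] by [a^(d - i)], which
   clears the denominators and keeps the polynomial monic. *)
pose P := \poly_(i < d.+1) (ratr p`_i * a%:~R ^+ (d - i)) : {poly algC}.
apply: (@root_monic_Aint P).
- rewrite /root horner_poly; apply/eqP.
  transitivity (a%:~R ^+ d * (map_poly ratr p : {poly algC}).[x]); last by rewrite x0 mulr0.
  rewrite horner_coef size_map_poly szp mulr_sumr; apply: eq_bigr => i _.
  have -> : a%:~R ^+ d = a%:~R ^+ (d - i) * a%:~R ^+ i :> algC by rewrite -exprD subnK // leq_ord.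
  rewrite coef_map exprMn /=; ring.
- rewrite monicE lead_coef_poly ?subnn ?mulr1 -/d //.
    by rewrite -lead_coefE (monicP mon_p) rmorph1.
  by rewrite -lead_coefE (monicP mon_p) rmorph1 oner_neq0.
- apply/polyOverP => i; rewrite coef_poly; case: ifP => [lt_i|_]; last exact: rpred0.
  case: (ltngtP i d) => [lt_id||->]; last 1 first.
  + by rewrite subnn mulr1 -lead_coefE (monicP mon_p) rmorph1 rpred1.
  + have a0' : a%:~R != 0 :> algC by rewrite intr_eq0.
    have -> : ratr p`_i = (a%:~R)^-1 * (q`_i)%:~R :> algC.
      by rewrite Eq coefZ coef_map rmorphM fmorphV /= !ratr_int.
    rewrite -(subnSK lt_id) exprS [_^-1 * _]mulrC -mulrA mulKf //.
    by rewrite rpredM ?rpredX ?rpred_int.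
  + by move=> H; move: lt_i; rewrite ltnS leqNgt H.
Qed.

Import ComplexField.Normc.

Section Height.
Import classical_sets.
Local Open Scope complex_scope.
Variables (R : realType) (L : splittingFieldType rat) (iA : {rmorphism L -> algC}) (iC : {rmorphism L -> R[i]}).

Definition galG := 'Gal({:L} / 1%AS)%g.

(** [iA] only serves to speak of integrality, through [Aint], while [iC] supplies absolute values in
    the real field [R]. As [L] is Galois over the rationals, composing [iC] with the automorphisms
    yields all archimedean absolute values. *)
Definition ell (g : gal_of {:L}) (x : L) : R := ln (normc (iC (g x))).

Lemma normc_gt0 (z : R[i]) : z != 0 -> 0 < normc z.
Proof.
move=> z0; have : 0 < `|z| by rewrite normr_gt0.
by rewrite -[ `|z|]/((normc z)%:C) ltcR.
Qed.

Lemma gal_neq0 (g : gal_of {:L}) (x : L) : x != 0 -> iC (g x) != 0.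
Proof. by rewrite !fmorph_eq0. Qed.

Lemma ellM g (x y : L) : x != 0 -> y != 0 -> ell g (x * y) = ell g x + ell g y.
Proof.
move=> x0 y0; rewrite /ell !rmorphM /= normcM lnMp //; exact/normc_gt0/gal_neq0.
Qed.

Lemma ell1 g : ell g 1 = 0.
Proof. by rewrite /ell !rmorph1 normc1 ln1. Qed.

Lemma ellX g (x : L) n : x != 0 -> ell g (x ^+ n) = n%:R * ell g x.
Proof.
move=> x0; elim: n => [|n IH]; first by rewrite expr0 ell1 mul0r.
by rewrite exprS ellM ?expf_neq0 // IH -natr1; ring.
Qed.

Lemma ellV g (x : L) : x != 0 -> ell g x^-1 = - ell g x.
Proof.
move=> x0; have xV : x^-1 != 0 by rewrite invr_eq0.
have := ellM g x0 xV; rewrite divff // ell1; lra.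
Qed.

Lemma ell_sum g (I : finType) (x : I -> L) (b : R) : \sum_i x i != 0 ->
  (forall i, x i != 0) -> (forall i, ell g (x i) <= b) ->
  ell g (\sum_i x i) <= ln (#|I|%:R : R) + b.
Proof.
move=> s0 x0 xb.
have I0 : (0 < #|I|)%N.
  rewrite lt0n; apply: contra s0 => /eqP/card0_eq I0; rewrite big1 // => i _.
  by have := I0 i.
have : ell g (\sum_i x i) <= ln (\sum_(i : I) expR b).
  rewrite /ell; apply: ln_homo; first exact/normc_gt0/gal_neq0.
  rewrite !rmorph_sum /=.
  apply: (@le_trans _ _ (\sum_i normc (iC (g (x i))))).
    elim/big_rec2: _ => [|i y1 y2 _ H]; first by rewrite normc0.
    by apply: le_trans (le_normcD _ _) _; rewrite lerD2l.
  apply: ler_sum => i _; rewrite -[leLHS]lnK ?ler_expR; last by rewrite posrE; exact/normc_gt0/gal_neq0.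
  exact: xb.
have -> : \sum_(i : I) expR b = #|I|%:R * expR b by rewrite sumr_const mulr_natl.
by rewrite lnMp ?expR_gt0 ?ltr0n // expRK.
Qed.

Lemma Aint_gal (g : gal_of {:L}) (x : L) : iA x \in Aint -> iA (g x) \in Aint.
Proof.
move=> xA; have [nu Hnu] := extend_algC_subfield_aut iA (g : {rmorphism L -> L}).
by rewrite Hnu Aint_aut.
Qed.

Lemma pchar_L : [pchar L] =i pred0.
Proof. by move=> p; rewrite pchar_lalg; exact: pchar_num. Qed.

Lemma galois_L : galois 1%AS {:L}.
Proof.
rewrite /galois subvf normalFieldf andbT /=.
by apply/separableP => x _; apply: (pcharf0_separable _ pchar_L).
Qed.

(** The norm is a nonzero rational integer, so its absolute value is at least 1. Nonnegativity of
    heights and the inequality on [p]-th powers both rest on this. *)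
Lemma sum_ell_Aint (x : L) : x != 0 -> iA x \in Aint ->
  0 <= \sum_(g in galG) ell g x.
Proof.
move=> x0 xA; set N := galNorm 1%AS {:L} x.
have N0 : N != 0 by rewrite galNorm_eq0.
have /vlineP [q EN] : N \in 1%AS by apply: mem_galNorm; [exact: galois_L|exact: memvf].
have Eq : N = ratr q by rewrite EN alg_num_field.
have NA : iA N \in Aint.
  by rewrite rmorph_prod rpred_prod // => g _; apply: Aint_gal.
have : iA N \in Num.int.
  apply: Cint_rat_Aint NA; rewrite Eq fmorph_rat; exact: Crat_rat.
rewrite Eq fmorph_rat => /intrP [z Ez].
have {}Ez : q = z%:~R.
  by apply: (fmorph_inj (ratr : {rmorphism rat -> algC})); rewrite /= Ez ratr_int.
have z0 : z != 0 by apply: contra N0 => /eqP z0; rewrite Eq Ez z0 ratr_int mulr0z.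
have -> : \sum_(g in galG) ell g x = ln (normc (iC N)).
  have [-> _] // : \sum_(g in galG) ell g x = ln (normc (iC N)) /\ iC N != 0.
  rewrite /N /galNorm /galG rmorph_prod /=.
  elim/big_rec2: _ => [|g y1 y2 _ [-> y20]].
    by rewrite normc1 ln1 oner_neq0.
  have gx0 := gal_neq0 g x0; rewrite mulf_neq0 //; split=> //.
  by rewrite normcM lnMp // normc_gt0.
rewrite Eq fmorph_rat Ez ratr_int; apply: ln_ge0.
rewrite -lecR -[(normc _)%:C]/(`|z%:~R : R[i]|) -intr_norm.
have -> : 1%:C = 1%:~R :> R[i] by [].
by rewrite ler_int -gtz0_ge1 normr_gt0.
Qed.

(* [b g] bounds the archimedean absolute values attached to [g]. The integrality of [lam x^n]
   bounds [|x|_v] by [|lam|_v^(-1/n)] at all finite places at once; by the product formula these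
   bounds contribute the mean of [ell g lam / n]. The height is the infimum of the total. *)
Definition cert (X : seq L) (b : gal_of {:L} -> R) (n : nat) (lam : L) :=
  [/\ (0 < n)%N, lam != 0, forall g x, x \in X -> ell g x <= b g &
      {in X, forall x, iA (lam * x ^+ n) \in Aint}].

Definition cert_val (b : gal_of {:L} -> R) (n : nat) (lam : L) : R :=
  (\sum_(g in galG) (b g + ell g lam / n%:R)) / #|galG|%:R.

Definition hgt (X : seq L) : R :=
  inf [set v | exists b n lam, cert X b n lam /\ v = cert_val b n lam].

Lemma card_galG_gt0 : 0 < (#|galG|%:R : R).
Proof. by rewrite ltr0n fingroup.cardG_gt0. Qed.

Lemma cert_val_ge0 X b n lam x : x \in X -> x != 0 -> cert X b n lam -> 0 <= cert_val b n lam.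
Proof.
move=> xX x0 [n0 l0 Hb Hl]; rewrite divr_ge0 ?(ltW card_galG_gt0) //.
have n0' : 0 < (n%:R : R) by rewrite ltr0n.
rewrite -(pmulr_rge0 _ n0').
have lx0 : lam * x ^+ n != 0 by rewrite mulf_neq0 ?expf_neq0.
apply: le_trans (sum_ell_Aint lx0 (Hl _ xX)) _.
rewrite mulr_sumr; apply: ler_sum => g _.
rewrite ellM ?expf_neq0 // ellX // mulrDr addrC mulrCA divff ?gt_eqF // mulr1.
by rewrite lerD2r ler_pM2l // Hb.
Qed.

Lemma hgt_le X x v : x \in X -> x != 0 ->
  (exists b n lam, cert X b n lam /\ cert_val b n lam <= v) -> hgt X <= v.
Proof.
move=> xX x0 [b [n [lam [c cv]]]]; apply: le_trans cv; apply: ge_inf.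
  by exists 0 => _ [b' [n' [l' [c' ->]]]]; exact: (cert_val_ge0 xX x0 c').
by exists b, n, lam.
Qed.

Lemma cert_exists X : 0 \notin X -> exists b n lam, cert X b n lam.
Proof.
move=> X0.
have [m m0 Hm] : exists2 m : int, m != 0 & {in X, forall x, iA (m%:~R * x) \in Aint}.
  elim: X {X0} => [|x X [m m0 Hm]]; first by exists 1.
  have [k k0 Hk] := Aint_denom (iA x).
  exists (m * k); first by rewrite mulf_neq0.
  move=> y; rewrite inE => /orP [/eqP ->|/Hm my].
    by rewrite intrM -mulrA rmorphM rmorph_int rpredM ?Aint_int // rmorphM rmorph_int.
  by rewrite intrM -mulrA mulrCA rmorphM rmorph_int rpredM ?Aint_int.
exists (fun g => \sum_(x <- X) `|ell g x|), 1%N, m%:~R; split=> //.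
- by rewrite intr_eq0_pchar0 //; exact: pchar_L.
- move=> g x xX; rewrite (big_rem x) //=; apply: le_trans (ler_norm _) _.
  by rewrite lerDl sumr_ge0.
Qed.

Lemma hgt_ge X v : 0 \notin X ->
  (forall b n lam, cert X b n lam -> v <= cert_val b n lam) -> v <= hgt X.
Proof.
move=> X0 H; apply: lb_le_inf.
  by have [b [n [lam c]]] := cert_exists X0; exists (cert_val b n lam), b, n, lam.
by move=> _ [b [n [lam [c ->]]]]; exact: H.
Qed.

Lemma hgt_ge0 X x : x \in X -> 0 \notin X -> 0 <= hgt X.
Proof.
move=> xX X0; apply: hgt_ge => // b n lam c; apply: (cert_val_ge0 xX _ c).
by apply: contraNneq X0 => <-.
Qed.

Lemma hgt_sub X Y x : x \in X -> 0 \notin Y -> {subset X <= Y} -> hgt X <= hgt Y.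
Proof.
move=> xX Y0 XY; apply: hgt_ge => // b n lam [n0 l0 Hb Hl].
apply: (@hgt_le _ x) => //; first by apply: contraNneq Y0 => <-; apply: XY.
exists b, n, lam; split=> //; split=> // [g y yX|y yX]; first exact/Hb/XY.
exact/Hl/XY.
Qed.

Lemma hgt_scale X t x : x \in X -> 0 \notin X -> t != 0 -> hgt [seq t * y | y <- X] <= hgt X.
Proof.
move=> xX X0 t0; apply: hgt_ge => // b n lam [n0 l0 Hb Hl].
have nz := seq_neq0 X0.
apply: (@hgt_le _ (t * x)); [exact: map_f|by rewrite mulf_neq0 // nz|].
exists (fun g => ell g t + b g), n, (lam * t ^- n); split.
  split=> //; first by rewrite mulf_neq0 // invr_eq0 expf_neq0.
    by move=> g _ /mapP [y yX ->]; rewrite /= (ellM _ t0 (nz _ yX)) lerD2l Hb.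
  move=> _ /mapP [y yX ->]; rewrite exprMn mulrA mulfVK ?expf_neq0 //.
  exact: Hl.
rewrite /cert_val ler_pM2r ?invr_gt0 ?card_galG_gt0 //; apply: ler_sum => g _.
rewrite ellM ?invr_eq0 ?expf_neq0 // ellV ?expf_neq0 // ellX //.
have n0' : (n%:R : R) != 0 by rewrite pnatr_eq0 -lt0n.
by rewrite mulrBl mulrAC divff // mul1r; lra.
Qed.

Lemma hgt_mul X Y x y : x \in X -> y \in Y -> 0 \notin X -> 0 \notin Y ->
  hgt [seq x * y | x <- X, y <- Y] <= hgt X + hgt Y.
Proof.
move=> xX yY X0 Y0; rewrite -lerBlDr; apply: hgt_ge => // b n lam [n0 l0 Hb Hl].
rewrite lerBlDl -lerBlDr; apply: hgt_ge => // b' n' lam' [n0' l0' Hb' Hl'].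
rewrite lerBlDl.
have nzX := seq_neq0 X0.
have nzY := seq_neq0 Y0.
apply: (@hgt_le _ (x * y)); [exact: allpairs_f|exact: mulf_neq0 (nzX _ xX) (nzY _ yY)|].
(* The integral elements are raised to the powers [n'] and [n] to give them the common exponent
   [n n'], under which certificates multiply. *)
exists (fun g => b g + b' g), (n * n')%N, (lam ^+ n' * lam' ^+ n); split.
  split; rewrite ?muln_gt0 ?n0 ?mulf_neq0 ?expf_neq0 //.
    move=> g _ /allpairsP [[u v] [/= uX vY ->]].
    by rewrite /= (ellM _ (nzX _ uX) (nzY _ vY)) lerD ?Hb ?Hb'.
  move=> _ /allpairsP [[u v] [/= uX vY ->]].
  have -> : lam ^+ n' * lam' ^+ n * (u * v) ^+ (n * n') =
    (lam * u ^+ n) ^+ n' * (lam' * v ^+ n') ^+ n.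
    by rewrite !exprMn -!exprM [(n' * n)%N]mulnC; ring.
  by rewrite rmorphM !rmorphXn rpredM ?rpredX ?Hl ?Hl'.
rewrite /cert_val -mulrDl ler_pM2r ?invr_gt0 ?card_galG_gt0 // -big_split /=.
apply: ler_sum => g _; rewrite ellM ?expf_neq0 // !ellX // natrM.
have n0r : (n%:R : R) != 0 by rewrite pnatr_eq0 -lt0n.
have n0r' : (n'%:R : R) != 0 by rewrite pnatr_eq0 -lt0n.
have -> : (n'%:R * ell g lam + n%:R * ell g lam') / (n%:R * n'%:R) =
  ell g lam / n%:R + ell g lam' / n'%:R by field; rewrite n0r n0r'.
lra.
Qed.

Lemma hgt_sum X Y (M : nat) y0 : y0 \in Y -> 0 \notin X -> 0 \notin Y ->
    {in Y, forall y, exists (I : finType) (x : I -> L),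
      [/\ (#|I| <= M)%N, forall i, x i \in X & y = \sum_i x i]} ->
  hgt Y <= ln (M%:R : R) + hgt X.
Proof.
move=> y0Y X0 Y0 H; rewrite -lerBlDl; apply: hgt_ge => // b n lam [n0 l0 Hb Hl].
rewrite lerBlDl.
have nzX := seq_neq0 X0.
have nzY := seq_neq0 Y0.
apply: (@hgt_le _ y0) => //; first exact: nzY.
exists (fun g => ln (M%:R : R) + b g), n, lam; split; last first.
  suff -> : cert_val (fun g => ln (M%:R : R) + b g) n lam = ln (M%:R : R) + cert_val b n lam by [].
  rewrite /cert_val; under eq_bigr do rewrite -addrA.
  rewrite big_split /= sumr_const -[ln _ *+ _]mulr_natl mulrDl mulrAC divff ?mul1r //.
  by rewrite gt_eqF ?card_galG_gt0.
split=> // [g y yY|y yY]; have [I [x [cI xX Ey]]] := H y yY.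
  have s0 : \sum_i x i != 0 by rewrite -Ey; exact: nzY.
  rewrite {1}Ey; apply: le_trans (ell_sum s0 (fun i => nzX _ (xX i)) (fun i => Hb g _ (xX i))) _.
  rewrite lerD2r; apply: ln_homo; last by rewrite ler_nat.
  rewrite ltr0n lt0n; apply: contra s0 => /eqP/card0_eq I0; rewrite big1 // => i _.
  by have := I0 i.
(* Integrality of [lam x^n] is not visibly additive in [x], but that of [mu x] is. The root is taken
   in [algC], so [L] need not contain it. Finite places thus contribute nothing, and the number of
   terms only costs a logarithm. *)
set mu := n.-root (iA lam).
have muX i : mu * iA (x i) \in Aint.
  by apply: (Aint_root n0); rewrite exprMn rootCK // -rmorphXn -rmorphM Hl.
have -> : iA (lam * y ^+ n) = (\sum_i mu * iA (x i)) ^+ n.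
  by rewrite -mulr_sumr exprMn rootCK // rmorphM rmorphXn Ey rmorph_sum.
by rewrite rpredX // rpred_sum.
Qed.

Lemma hgt_pow (a : L) n : a != 0 -> (0 < n)%N ->
  hgt [:: 1; a ^+ n] = n%:R * hgt [:: 1; a].
Proof.
move=> a0 n0.
have nin (b : L) : b != 0 -> 0 \notin [:: 1; b].
  by move=> b0; rewrite !inE !negb_or eq_sym oner_eq0 eq_sym b0.
have n0r : 0 < (n%:R : R) by rewrite ltr0n.
apply/eqP; rewrite eq_le; apply/andP; split.
  rewrite -ler_pdivrMl //; apply: hgt_ge; first exact: nin.
  move=> b k lam [k0 l0 Hb Hl]; rewrite ler_pdivrMl //.
  apply: (@hgt_le _ 1); [exact: mem_head|exact: oner_neq0|].
  exists (fun g => n%:R * b g), k, (lam ^+ n); split.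
    split; rewrite ?expf_neq0 //.
      move=> g x; rewrite !inE => /orP [] /eqP ->.
        by rewrite ell1 mulr_ge0 // -(ell1 g) Hb ?mem_head.
      by rewrite ellX // ler_pM2l // Hb // !inE eqxx orbT.
    move=> x; rewrite !inE => /orP [] /eqP ->.
      rewrite expr1n mulr1 rmorphXn rpredX //.
      by have := Hl 1 (mem_head _ _); rewrite expr1n mulr1.
    rewrite -exprM mulnC exprM -exprMn rmorphXn rpredX //.
    by apply: Hl; rewrite !inE eqxx orbT.
  rewrite /cert_val mulrA mulr_sumr ler_pM2r ?invr_gt0 ?card_galG_gt0 //.
  by apply: ler_sum => g _; rewrite ellX // mulrDr mulrA.
apply: hgt_ge; first by apply: nin; rewrite expf_neq0.
move=> b k lam [k0 l0 Hb Hl]; rewrite -ler_pdivlMl //.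
apply: (@hgt_le _ 1); [exact: mem_head|exact: oner_neq0|].
exists (fun g => n%:R^-1 * b g), (n * k)%N, lam; split.
  split; rewrite ?muln_gt0 ?n0 //.
    move=> g x; rewrite !inE ler_pdivlMl // => /orP [] /eqP ->.
      by rewrite ell1 mulr0 -(ell1 g) Hb ?mem_head.
    by rewrite -ellX // Hb // !inE eqxx orbT.
  move=> x; rewrite !inE => /orP [] /eqP ->.
    by rewrite expr1n; have := Hl 1 (mem_head _ _); rewrite expr1n.
  by rewrite exprM Hl // !inE eqxx orbT.
rewrite /cert_val mulrA mulr_sumr ler_pM2r ?invr_gt0 ?card_galG_gt0 //.
apply: ler_sum => g _; rewrite mulrDr natrM.
have k0r : (k%:R : R) != 0 by rewrite pnatr_eq0 -lt0n.
have n0r' : (n%:R : R) != 0 by rewrite pnatr_eq0 -lt0n.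
by have -> : ell g lam / (n%:R * k%:R) = n%:R^-1 * (ell g lam / k%:R) by field; rewrite k0r n0r'.
Qed.

Lemma Aint_exp_prime_add p (a b : algC) : prime p -> a \in Aint -> b \in Aint ->
  ((a + b) ^+ p == a ^+ p + b ^+ p %[mod p])%A.
Proof.
case: p => // p pp aA bA; rewrite exprDn big_ord_recl big_ord_recr /=.
rewrite /bump /= add1n subn0 subnn !expr0 bin0 binn mulr1 mul1r !mulr1n addrCA addrC -addrA.
rewrite eqAmodDl -[X in (_ == X %[mod _])%A]addr0 eqAmodDl eqAmod0.
apply: rpred_sum => i _; rewrite add1n.
have /dvdnP [c ->] : (p.+1 %| 'C(p.+1, i.+1))%N by rewrite prime_dvd_bin //= ltnS.
rewrite mulrnA -mulr_natr -eqAmod0; apply: eqAmodMl0.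
by rewrite rpredMn // rpredM ?rpredX.
Qed.

Lemma Aint_sum_exp_prime p (I : finType) (u : I -> algC) : prime p ->
  (forall i, u i \in Aint) -> ((\sum_i u i) ^+ p == \sum_i u i ^+ p %[mod p])%A.
Proof.
move=> pp uA.
have [//] : ((\sum_i u i) ^+ p == \sum_i u i ^+ p %[mod p])%A /\ \sum_i u i \in Aint.
elim/big_rec2: _ => [|i y1 y2 _ [IH y1A]].
  by rewrite expr0n gtn_eqF ?prime_gt0 //= eqAmod_refl.
split; last by rewrite rpredD.
apply: eqAmod_trans (Aint_exp_prime_add pp (uA i) y1A) _.
by rewrite eqAmodDl.
Qed.

(* [p] divides the sum of the [p]-th powers when the sum vanishes; a nonzero multiple of [p] is
   large in norm. *)
Lemma hgt_frob p (I : finType) (m : I -> L) X : prime p -> 0 \notin X ->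
    (forall i, m i \in X) -> \sum_i m i = 0 -> \sum_i m i ^+ p != 0 ->
  ln (p%:R : R) <= ln (#|I|%:R : R) + p%:R * hgt X.
Proof.
move=> pp X0 mX s0; set w := \sum_i _ => w0.
have p0 : 0 < (p%:R : R) by rewrite ltr0n prime_gt0.
rewrite -lerBlDl -ler_pdivrMl //; apply: hgt_ge => // b n lam [n0 l0 Hb Hl].
have n0r : 0 < (n%:R : R) by rewrite ltr0n.
have nzX := seq_neq0 X0.
have pL : (p%:R : L) != 0.
  by have /pcharf0P -> := pchar_L; rewrite -lt0n prime_gt0.
(* This is the [n]-th power of the sum of the [(mu * m i)^p] divided by [p], an algebraic integer;
   written without the root [mu] it lies in [L] and has a norm. *)
pose W := lam ^+ p * w ^+ n / p%:R ^+ n.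
have W0 : W != 0 by rewrite !mulf_neq0 ?invr_eq0 ?expf_neq0.
have WA : iA W \in Aint.
  set mu := n.-root (iA lam).
  have muX i : mu * iA (m i) \in Aint.
    by apply: (Aint_root n0); rewrite exprMn rootCK // -rmorphXn -rmorphM Hl.
  have := Aint_sum_exp_prime pp muX.
  rewrite -mulr_sumr -rmorph_sum s0 rmorph0 mulr0 expr0n gtn_eqF ?prime_gt0 //=.
  have dvdE (e z : algC) : e != 0 -> (e %| z)%A -> z / e \in Aint.
    by move=> /negPf e0; rewrite unfold_in e0.
  rewrite eqAmod_sym eqAmod0 => /dvdE; rewrite pnatr_eq0 -lt0n prime_gt0 // => /(_ isT) H.
  suff -> : iA W = ((\sum_i (mu * iA (m i)) ^+ p) / p%:R) ^+ n by rewrite rpredX.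
  under eq_bigr do rewrite exprMn -rmorphXn.
  rewrite -mulr_sumr -rmorph_sum -/w !exprMn -exprM mulnC exprM rootCK //.
  by rewrite /W !rmorphM rmorphXn fmorphV !rmorphXn rmorph_nat exprVn.
have := sum_ell_Aint W0 WA.
have -> : \sum_(g in galG) ell g W =
   \sum_(g in galG) (p%:R * ell g lam + n%:R * ell g w - n%:R * ln (p%:R : R)).
  apply: eq_bigr => g _.
  rewrite !ellM ?ellV ?mulf_neq0 ?invr_eq0 ?expf_neq0 // !ellX //.
  congr (_ - _ * _); rewrite /ell !rmorph_nat; congr ln.
  have : (normc (p%:R : R[i]))%:C = (p%:R : R)%:C.
    by rewrite -[(normc _)%:C]/(`|p%:R : R[i]|) normr_nat rmorph_nat.
  by move/(congr1 (@complex.Re R)).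
move=> H; have {H}: 0 <= \sum_(g in galG) (p%:R * ell g lam + n%:R * (ln (#|I|%:R : R) + p%:R * b g)
     - n%:R * ln (p%:R : R)).
  apply: le_trans H _; apply: ler_sum => g _.
  rewrite lerD2r lerD2l ler_pM2l //.
  apply: ell_sum => // [i|i]; first by rewrite expf_neq0 // nzX.
  by rewrite ellX ?nzX // ler_pM2l // Hb.
have -> : \sum_(g in galG) (p%:R * ell g lam + n%:R * (ln (#|I|%:R : R) + p%:R * b g)
     - n%:R * ln (p%:R : R)) = #|galG|%:R * (n%:R * p%:R * (cert_val b n lam) -
        n%:R * (ln (p%:R : R) - ln (#|I|%:R : R))).
  have D0 := card_galG_gt0.
  rewrite mulrBr /cert_val.
  have -> (x : R) : #|galG|%:R * (n%:R * p%:R * (x / #|galG|%:R)) = n%:R * p%:R * x.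
    by field; rewrite gt_eqF.
  rewrite mulr_sumr; have -> (x : R) : #|galG|%:R * x = \sum_(g in galG) x.
    by rewrite sumr_const mulr_natl.
  rewrite -sumrB; apply: eq_bigr => g _; field.
  by rewrite gt_eqF.
rewrite pmulr_rge0 ?card_galG_gt0 // -mulrA -mulrBr pmulr_rge0 // subr_ge0.
by rewrite ler_pdivrMl.
Qed.
End Height.

(* [h X] is the height of the projective point with coordinates [X], read as a set; the axioms are
   required for lists of nonzero elements only. *)
Record is_height (R : realType) (F : fieldType) (h : seq F -> R) : Prop := IsHeight {
  height_ge0 : forall X x, x \in X -> 0 \notin X -> 0 <= h X;
  height_sub : forall X Y x, x \in X -> 0 \notin Y -> {subset X <= Y} -> h X <= h Y;
  height_scale : forall X t x, x \in X -> 0 \notin X -> t != 0 ->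
    h [seq t * y | y <- X] <= h X;
  height_mul : forall X Y x y, x \in X -> y \in Y -> 0 \notin X -> 0 \notin Y ->
    h [seq x * y | x <- X, y <- Y] <= h X + h Y;
  height_sum : forall X Y (M : nat) y0, y0 \in Y -> 0 \notin X -> 0 \notin Y ->
    {in Y, forall y, exists (I : finType) (x : I -> F),
      [/\ (#|I| <= M)%N, forall i, x i \in X & y = \sum_i x i]} ->
    h Y <= ln (M%:R : R) + h X;
  height_pow : forall (a : F) n, a != 0 -> (0 < n)%N ->
    h [:: 1; a ^+ n] = n%:R * h [:: 1; a];
  height_frob : forall p (I : finType) (m : I -> F) X, prime p -> 0 \notin X ->
    (forall i, m i \in X) -> \sum_i m i = 0 -> \sum_i m i ^+ p != 0 ->
    ln (p%:R : R) <= ln (#|I|%:R : R) + p%:R * h X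
}.

Lemma hgt_is_height (R : realType) (L : splittingFieldType rat) (iA : {rmorphism L -> algC})
    (iC : {rmorphism L -> complex R}) : is_height (hgt iA iC).
Proof.
split; [exact: hgt_ge0|exact: hgt_sub|exact: hgt_scale|exact: hgt_mul|exact: hgt_sum|
  exact: hgt_pow|exact: hgt_frob].
Qed.

(** * Consequences of the height axioms *)

Section Consequences.
Variables (R : realType) (F : fieldType) (h : seq F -> R) (Hh : is_height h).

Definition hN (x : F) : R := h [:: 1; x].

Lemma notin_pair (b : F) : b != 0 -> 0 \notin [:: 1; b].
Proof. by move=> b0; rewrite !inE !negb_or eq_sym oner_eq0 eq_sym b0. Qed.

Lemma hN_ge0 x : x != 0 -> 0 <= hN x.
Proof. by move=> x0; apply: (height_ge0 Hh (mem_head 1 _)); apply: notin_pair. Qed.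

Lemma hN1 : hN 1 = 0.
Proof.
have := height_pow Hh (oner_neq0 F) (isT : (0 < 2)%N); rewrite expr1n -/(hN 1); lra.
Qed.

Lemma hNX x n : x != 0 -> hN (x ^+ n) = n%:R * hN x.
Proof.
move=> x0; case: n => [|n]; first by rewrite expr0 hN1 mul0r.
exact: height_pow.
Qed.

Lemma hNM x y : x != 0 -> y != 0 -> hN (x * y) <= hN x + hN y.
Proof.
move=> x0 y0.
have := height_mul Hh (mem_head 1 [:: x]) (mem_head 1 [:: y]) (notin_pair x0) (notin_pair y0).
apply: le_trans; apply: (height_sub Hh (mem_head 1 _)).
  by rewrite !inE !negb_or !mulr1 !mul1r !(eq_sym 0) mulf_neq0 // x0 y0 oner_eq0.
move=> z; rewrite !inE !mulr1 !mul1r => /orP [] ->; first by [].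
by rewrite !orbT.
Qed.

Lemma hNV x : x != 0 -> hN x^-1 = hN x.
Proof.
have le x' : x' != 0 -> hN x'^-1 <= hN x'.
  move=> x0; have xV : x'^-1 != 0 by rewrite invr_eq0.
  have := height_scale Hh (mem_head 1 [:: x']) (notin_pair x0) xV.
  apply: le_trans; apply: (height_sub Hh (mem_head 1 _)).
    by rewrite /= mulVf // mulr1 !inE !negb_or !(eq_sym 0) xV oner_eq0.
  by move=> z; rewrite /= mulVf // mulr1 !inE orbC.
move=> x0; apply/eqP; rewrite eq_le le //= -{1}[x]invrK le // invr_eq0 //.
Qed.

Lemma hN_torsion x n : (0 < n)%N -> x ^+ n = 1 -> hN x = 0.
Proof.
move=> n0 xn; have x0 : x != 0.
  by apply: contra_eq_neq xn => ->; rewrite expr0n gtn_eqF // eq_sym oner_neq0.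
have := hNX n x0; rewrite xn hN1 => /esym/eqP; rewrite mulf_eq0 pnatr_eq0 gtn_eqF //=.
by move/eqP.
Qed.

Lemma hN_div x y : x != 0 -> y != 0 -> hN (x / y) <= hN x + hN y.
Proof. by move=> x0 y0; rewrite -(hNV y0); apply: hNM => //; rewrite invr_eq0. Qed.

Lemma hN_le X x y : x \in X -> y \in X -> 0 \notin X -> hN (x / y) <= h X.
Proof.
move=> xX yX X0; have nz := seq_neq0 X0.
have yV : y^-1 != 0 by rewrite invr_eq0 nz.
apply: le_trans (height_scale Hh xX X0 yV); apply: (height_sub Hh (mem_head 1 _)).
  by apply/negP => /mapP [z zX /esym/eqP]; rewrite mulf_eq0 (negPf yV) (negPf (nz _ zX)).
move=> z; rewrite !inE => /orP [] /eqP ->.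
  by apply/mapP; exists y => //; rewrite mulVf ?nz.
by apply/mapP; exists x => //; rewrite mulrC.
Qed.

(** The list is contained in the product of the pairs [[:: 1; u]], whose heights add up. *)
Lemma h_one_cons U : 0 \notin U -> h (1 :: U) <= \sum_(u <- U) hN u.
Proof.
elim: U => [|u U IH] U0.
  rewrite big_nil -hN1; apply: (height_sub Hh (mem_head 1 _)); first exact: notin_pair (oner_neq0 _).
  by move=> z; rewrite !inE => ->.
move: U0; rewrite inE negb_or eq_sym => /andP [u0 U0].
rewrite big_cons; apply: le_trans (lerD (lexx _) (IH U0)).
have U10 : 0 \notin 1 :: U by rewrite inE negb_or U0 eq_sym oner_eq0.
have := height_mul Hh (mem_head 1 [:: u]) (mem_head 1 U) (notin_pair u0) U10.
apply: le_trans; apply: (height_sub Hh (mem_head 1 _)).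
  apply/negP => /allpairsP [[a b] [/= aX bX /esym/eqP]]; apply/negP.
  rewrite mulf_neq0 //; [move: aX; apply: contraTneq => ->|move: bX; apply: contraTneq => ->] => //.
  exact: notin_pair.
move=> z; rewrite inE => /orP [/eqP ->|].
  by apply/allpairsP; exists (1, 1); rewrite /= !mem_head mulr1.
rewrite inE => /orP [/eqP ->|zU].
  by apply/allpairsP; exists (u, 1); rewrite /= !inE !eqxx orbT mulr1.
by apply/allpairsP; exists (1, z); rewrite /= !inE eqxx zU orbT mul1r.
Qed.

Lemma h_le_sum_ratio (J : finType) (x : J -> F) j0 : (forall j, x j != 0) ->
  h (codom x) <= \sum_j hN (x j / x j0).
Proof.
move=> x0; pose U := [seq x j / x j0 | j <- enum J].
have U0 : 0 \notin 1 :: U.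
  rewrite inE negb_or eq_sym oner_eq0; apply/negP => /mapP [j _ /esym/eqP]; apply/negP.
  by rewrite mulf_neq0 // invr_eq0.
have -> : \sum_j hN (x j / x j0) = \sum_(u <- U) hN u.
  by rewrite big_map big_enum.
apply: le_trans (h_one_cons _); last by move: U0; rewrite inE negb_or => /andP [].
apply: le_trans (height_scale Hh (mem_head 1 U) U0 (x0 j0)).
apply: (height_sub Hh (codom_f x j0)).
  apply/negP => /mapP [z zX /esym/eqP]; apply/negP; rewrite mulf_neq0 //.
  by apply: contraNneq U0 => <-.
move=> _ /codomP [j ->]; apply/mapP; exists (x j / x j0); last by rewrite mulrC mulfVK.
by rewrite inE; apply/orP; right; apply/mapP; exists j; rewrite ?mem_enum.
Qed.

Lemma hNN1 : h [:: 1; -1] = 0.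
Proof.
by apply: (@hN_torsion (-1) 2) => //; rewrite sqrrN expr1n.
Qed.

Lemma h_prod (J : finType) (X : J -> seq F) Z z0 : z0 \in Z -> 0 \notin Z ->
    (forall j, 0 \notin X j) ->
    {in Z, forall z, exists2 f : J -> F, forall j, f j \in X j &
       z = \prod_j f j \/ z = - \prod_j f j} ->
  h Z <= \sum_j h (X j).
Proof.
move=> z0Z Z0 X0 HZ.
(* Starting from [[:: 1; -1]] makes both signs of each product available at no cost in height, as
   the signed terms of a determinant require. *)
pose P r := foldr (fun j W => [seq x * y | x <- X j, y <- W]) [:: 1; -1] r.
have memP (f : J -> F) r : (forall j, f j \in X j) ->
    \prod_(j <- r) f j \in P r /\ - \prod_(j <- r) f j \in P r.
  move=> fX; elim: r => [|j r [IH1 IH2]]; first by rewrite big_nil !inE !eqxx orbT.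
  by rewrite big_cons /= -mulrN; split; apply: allpairs_f.
have P0 r : 0 \notin P r.
  elim: r => [|j r IH] /=; first by apply: notin_pair; rewrite oppr_eq0 oner_eq0.
  apply/negP => /allpairsP [[a b] [/= aX bX /esym/eqP]]; apply/negP.
  by rewrite mulf_neq0 //; [exact: seq_neq0 (X0 j) aX|exact: seq_neq0 IH bX].
have [f0 f0X _] := HZ _ z0Z.
have hP r : h (P r) <= \sum_(j <- r) h (X j).
  elim: r => [|j r IH]; first by rewrite big_nil hNN1.
  rewrite big_cons /=; apply: le_trans (lerD (lexx _) IH).
  exact: (height_mul Hh (f0X j) (memP f0 r f0X).1 (X0 j) (P0 r)).
apply: le_trans (hP (index_enum J)); apply: (height_sub Hh z0Z) => //.
by move=> z /HZ [f fX [] ->]; have [] := memP f (index_enum J) fX.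
Qed.

(** The prime factors of [e] are put in one at a time. Since [p] is at least [|I| + 1], [ln p]
    exceeds [ln |I|] by at least [1 / (|I| + 1)]; were the new sum nonzero, [height_frob] would
    bound this gap by [e] times the height of the terms, which the last hypothesis makes smaller. *)
Lemma frob_exp (I : finType) (m : I -> F) e : (forall i, m i != 0) -> \sum_i m i = 0 ->
    (0 < e)%N -> (forall p, prime p -> (p %| e)%N -> (#|I| < p)%N) ->
    #|I|.+1%:R * e%:R * h (codom m) < 1 -> \sum_i m i ^+ e = 0.
Proof.
move=> m0 s0; have [k] := ubnP e; elim: k e => // k IH e /ltnSE le_ek e0 Hp Hsmall.
have [e1|e1] := leqP e 1.
  have -> : e = 1%N by apply/eqP; rewrite eqn_leq e1.
  by under eq_bigr do rewrite expr1.
have [i0 _|I0] := pickP I; last by rewrite big1 // => i _; have := I0 i.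
pose p := pdiv e; have pp : prime p by apply: pdiv_prime.
have /dvdnP [e' Ee] := pdiv_dvd e; rewrite -/p in Ee.
have e'0 : (0 < e')%N by move: e0; rewrite Ee muln_gt0 => /andP [].
have p1 := prime_gt1 pp.
have mm0 := codom_neq0 m0.
have h0 : 0 <= h (codom m) by apply: (height_ge0 Hh (codom_f m i0)).
have s0' : \sum_i m i ^+ e' = 0.
  apply: IH => //; first by apply: leq_trans le_ek; rewrite Ee ltn_Pmulr.
    by move=> q pq qe; apply: Hp => //; rewrite Ee dvdn_mulr.
  apply: le_lt_trans Hsmall; apply: ler_wpM2r => //; rewrite ler_wpM2l // ler_nat.
  by rewrite Ee leq_pmulr // ltnW.
pose X := codom (fun i => m i ^+ e').
have X0 : 0 \notin X by apply: codom_neq0 => i; rewrite expf_neq0.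
have hX : h X <= e'%:R * h (codom m).
  have -> : e'%:R * h (codom m) = \sum_(j < e') h (codom m).
    by rewrite sumr_const card_ord mulr_natl.
  apply: (@h_prod _ (fun=> codom m) X (m i0 ^+ e')) => //; first exact: codom_f.
  move=> _ /codomP [i ->]; exists (fun=> m i); first by move=> _; exact: codom_f.
  by left; rewrite prodr_const card_ord.
have Em i : m i ^+ e = (m i ^+ e') ^+ p by rewrite -exprM -Ee.
under eq_bigr do rewrite Em.
apply/eqP/negPn/negP => w0.
have := height_frob Hh pp X0 (fun i => codom_f _ i) s0' w0.
have ltp : (#|I| < p)%N by apply: Hp; rewrite ?pdiv_dvd.
have I0 : (0 < #|I|)%N by apply/card_gt0P; exists i0.
have I0r : 0 < (#|I|%:R : R) by rewrite ltr0n.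
have kk : (#|I|.+1%:R : R) = #|I|%:R + 1 by rewrite -natr1.
have : ln (#|I|%:R : R) + (#|I|.+1%:R)^-1 <= ln (p%:R : R).
  have pr0 : 0 < (p%:R : R) by rewrite ltr0n ltnW.
  have q0 : 0 < (#|I|%:R / p%:R : R) by rewrite divr_gt0.
  have : ln (#|I|%:R / p%:R : R) <= #|I|%:R / p%:R - 1.
    have -> : (#|I|%:R / p%:R : R) = 1 + (#|I|%:R / p%:R - 1) by lra.
    rewrite [X in _ <= X - 1]addrC addrK; apply: le_ln1Dx; lra.
  rewrite ln_div ?posrE //.
  have : (#|I|%:R / p%:R : R) <= #|I|%:R / #|I|.+1%:R.
    by rewrite ler_pM2l // lef_pV2 ?posrE // ler_nat.
  have -> : (#|I|%:R / #|I|.+1%:R : R) = 1 - (#|I|.+1%:R)^-1.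
    by rewrite kk; field; rewrite -kk pnatr_eq0.
  move: (#|I|%:R / p%:R : R) (#|I|.+1%:R^-1 : R) (ln (#|I|%:R : R)) (ln (p%:R : R)).
  by move=> a b c d; lra.
have : p%:R * h X <= e%:R * h (codom m).
  by rewrite Ee mulnC natrM -mulrA ler_wpM2l.
have : e%:R * h (codom m) < (#|I|.+1%:R)^-1.
  by rewrite -[X in _ < X]mulr1 ltr_pdivlMl ?ltr0n // mulrA.
move: (#|I|.+1%:R^-1 : R) (ln (#|I|%:R : R)) (ln (p%:R : R)) (h X) => a b c d.
move: (p%:R * d) (e%:R * _) => x y; lra.
Qed.

End Consequences.

(** The moments of index below [|I|] pair with all polynomials of size at most [|I|]; the one
    vanishing at every value of [u] except [v] isolates the group of [v]. As values may repeat, only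
    sums over groups are forced to vanish. *)
Lemma vandermonde_group (F : fieldType) (I : finType) (m u : I -> F) :
    (forall j, (j < #|I|)%N -> \sum_i m i * u i ^+ j = 0) ->
  forall v, \sum_(i | u i == v) m i = 0.
Proof.
move=> H v.
have HP (P : {poly F}) : (size P <= #|I|)%N -> \sum_i m i * P.[u i] = 0.
  move=> sP.
  have -> : \sum_i m i * P.[u i] = \sum_(j < #|I|) P`_j * \sum_i m i * u i ^+ j.
    under eq_bigr do rewrite (horner_coef_wide _ sP) mulr_sumr.
    rewrite exchange_big /=; apply: eq_bigr => j _; rewrite mulr_sumr.
    by apply: eq_bigr => i _; ring.
  by rewrite big1 // => j _; rewrite H // mulr0.
have [/existsP [i0 /eqP Ei0]|/existsPn none] := boolP [exists i, u i == v]; last first.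
  by rewrite big1 // => i iv; have := none i; rewrite iv.
pose U := rem v (undup (codom u)).
have vU : v \in undup (codom u) by rewrite mem_undup -Ei0 codom_f.
have memU x : (x \in U) = (x != v) && (x \in codom u).
  by rewrite mem_rem_uniq ?undup_uniq // inE mem_undup.
pose P := \prod_(x <- U) ('X - x%:P).
have sP : (size P <= #|I|)%N.
  rewrite size_prod_XsubC size_rem // prednK; last by case: (undup _) vU.
  by apply: leq_trans (size_undup _) _; rewrite size_codom.
have := HP P sP; rewrite (bigID (fun i => u i == v)) /= [X in _ + X]big1 ?addr0; last first.
  move=> i iv; have /rootP -> : root P (u i) by rewrite root_prod_XsubC memU iv codom_f.
  by rewrite mulr0.
have Pv : P.[v] != 0.
  by rewrite -[_ == 0]/(root P v) root_prod_XsubC memU eqxx.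
have -> : \sum_(i | u i == v) m i * P.[u i] = P.[v] * \sum_(i | u i == v) m i.
  by rewrite mulr_sumr; apply: eq_bigr => i /eqP ->; rewrite mulrC.
by move/eqP; rewrite mulf_eq0 (negPf Pv) => /eqP.
Qed.

(* The exponents [n! j + 1] with [j < n] have no prime factor up to [n]. *)
Lemma small_group (R : realType) (F : fieldType) (h : seq F -> R) (Hh : is_height h)
    (I : finType) (m : I -> F) : (forall i, m i != 0) -> \sum_i m i = 0 ->
    #|I|.+1%:R * ((#|I|)`! * #|I|).+1%:R * h (codom m) < 1 ->
  forall v, \sum_(i | m i ^+ (#|I|)`! == v) m i = 0.
Proof.
move=> m0 s0 Hsmall; apply: vandermonde_group => j lt_j.
under eq_bigr do rewrite -exprM -exprS.
have [i0 _|I0] := pickP I; last by rewrite big1 // => i _; have := I0 i.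
apply: (frob_exp Hh) => // [p pp pe|].
  rewrite ltnNge; apply/negP => le_p.
  have pf : (p %| (#|I|)`! * j)%N by rewrite dvdn_mulr // dvdn_fact // prime_gt0.
  by move: pe; rewrite -addn1 dvdn_addr // dvdn1; move: pp => /[swap] /eqP ->.
apply: le_lt_trans Hsmall; apply: ler_wpM2r.
  by apply: (height_ge0 Hh (codom_f m i0)); exact: codom_neq0.
by rewrite ler_wpM2l // ler_nat ltnS leq_mul2l ltnW ?orbT.
Qed.

(** * Packing in a group of finite rank *)

Lemma exp_growth_contra (a C : nat) : (0 < a)%N ->
  (forall j, a.+1 ^ j <= C * a ^ j)%N -> False.
Proof.
move=> a0 H.
(* Bernoulli's inequality for [(1 + 1/a)^j], cleared of denominators. *)
have lin j : (a ^ j * (a + j) <= a * a.+1 ^ j)%N.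
  elim: j => [|j IH]; first by rewrite !expn0 addn0 mul1n muln1.
  rewrite !expnS; move: (a ^ j)%N (a.+1 ^ j)%N IH => x y IH.
  apply: leq_trans (_ : a.+1 * (x * (a + j)) <= _)%N; last first.
    by rewrite [X in (_ <= X)%N]mulnCA leq_mul2l IH orbT.
  by rewrite -mulnA mulnCA [X in (_ <= X)%N]mulnCA leq_mul2l; apply/orP; right; nia.
have := leq_trans (lin (a * C).+1) (leq_mul (leqnn a) (H (a * C).+1)).
rewrite mulnCA mulnA [X in (_ <= X)%N]mulnC leq_pmul2l ?expn_gt0 ?a0 //; lia.
Qed.

Lemma inord_shift_inj (x y : int) K : (`|x| <= K)%N -> (`|y| <= K)%N ->
  (inord `|x + K%:Z| : 'I_(2 * K).+1) = inord `|y + K%:Z| -> x = y.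
Proof.
move=> xK yK /(congr1 val); rewrite /= !inordK; lia.
Qed.

(* [x] lies, up to torsion, in the group generated by [r] elements; [d] kills the torsion
   and the index. *)
Definition rank_in (F : fieldType) (r : nat) (g : 'I_r -> F) (d : nat) (x : F) :=
  exists v : 'I_r -> int, x ^+ d = \prod_i g i ^ v i.

Lemma rank_inM (F : fieldType) r (g : 'I_r -> F) d x y : (forall i, g i != 0) ->
  rank_in g d x -> rank_in g d y -> rank_in g d (x * y).
Proof.
move=> g0 [v Ev] [w Ew]; exists (fun i => v i + w i).
by rewrite exprMn Ev Ew -big_split; apply: eq_bigr => i _; rewrite expfzDr.
Qed.

Lemma rank_inV (F : fieldType) r (g : 'I_r -> F) d x : (forall i, g i != 0) ->
  rank_in g d x -> rank_in g d x^-1.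
Proof.
move=> g0 [v Ev]; exists (fun i => - v i).
rewrite exprVn Ev -prodfV; apply: eq_bigr => i _; by rewrite invr_expz.
Qed.

Section Packing.
Variables (R : realType) (F : fieldType) (h : seq F -> R) (Hh : is_height h).
Local Notation N := (hN h).

(* Words over [Z] are read as base [Q] expansions. Values of distinct words are separated, while
   the exponent vectors of words of length [j] lie in a box of volume [O(Q^(r j))]. *)
Fixpoint word_val (Q : nat) (w : seq F) : F :=
  if w is z :: w' then z * word_val Q w' ^+ Q else 1.

Fixpoint word_vec (r Q : nat) (v : F -> 'I_r -> int) (w : seq F) (i : 'I_r) : int :=
  if w is z :: w' then v z i + Q%:Z * word_vec Q v w' i else 0.

Lemma word_val_neq0 Q w : 0 \notin w -> word_val Q w != 0.
Proof.
elim: w => [|z w IH] /=; first by rewrite oner_eq0.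
by rewrite inE negb_or eq_sym => /andP [z0 /IH w0]; rewrite mulf_neq0 ?expf_neq0.
Qed.

(** If the tails differ, their ratio [V] has height above [delta] by induction, so [V^Q] has height
    above [Q delta]. The first letters can lower this by at most [2 rho], and the assumption on [Q]
    leaves more than [delta]. *)
Lemma word_sep (Z : seq F) Q (rho delta : R) : 0 \notin Z -> 0 < delta ->
    {in Z, forall z, N z <= rho} ->
    {in Z &, forall z z', z != z' -> delta < N (z / z')} ->
    2 * rho <= Q%:R * delta - delta -> (0 < Q)%N ->
  forall w w', all (mem Z) w -> all (mem Z) w' -> size w = size w' -> w != w' ->
    delta < N (word_val Q w / word_val Q w').
Proof.
move=> Z0 d0 Hrho Hsep HQ Q0.
have sub0 (w : seq F) : all (mem Z) w -> 0 \notin w.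
  by move=> /allP H; apply: contra Z0 => /H.
have nz := seq_neq0 Z0.
elim=> [|z w IH] [|z' w'] //= /andP [zZ wZ] /andP [zZ' wZ'] [sw] neq.
set V := word_val Q w / word_val Q w'.
have w0 : word_val Q w != 0 by apply/word_val_neq0/sub0.
have w0' : word_val Q w' != 0 by apply/word_val_neq0/sub0.
have V0 : V != 0 by rewrite mulf_neq0 // invr_eq0.
have -> : z * word_val Q w ^+ Q / (z' * word_val Q w' ^+ Q) = (z / z') * V ^+ Q.
  rewrite /V expr_div_n; field.
  by rewrite expf_neq0 // nz.
have zz0 : z / z' != 0 by rewrite mulf_neq0 ?invr_eq0 ?nz.
have [Ew|neq_w] := eqVneq w w'.
  rewrite /V Ew divff // expr1n mulr1; apply: Hsep => //.
  by apply: contraNneq neq => ->; rewrite Ew.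
have := IH w' wZ wZ' sw neq_w; rewrite -/V => HV.
have : N (V ^+ Q) <= N (z / z' * V ^+ Q) + N (z / z').
  have -> : V ^+ Q = (z / z' * V ^+ Q) / (z / z').
    by rewrite mulrAC divff // mul1r.
  by rewrite {2}mulrAC divff // mul1r; apply: (hN_div Hh) => //; rewrite mulf_neq0 ?expf_neq0.
rewrite (hNX Hh) //.
have : N (z / z') <= 2 * rho.
  by apply: le_trans (hN_div Hh (nz _ zZ) (nz _ zZ')) _; rewrite mulr2n mulrDl mul1r lerD ?Hrho.
have : Q%:R * delta < Q%:R * N V by rewrite ltr_pM2l // ltr0n.
lra.
Qed.

(** With more than [Q^r] points there would be at least [(Q^r + 1)^j] words of length [j], with
    distinct exponent vectors in a box of at most [(2 c + 1)^r Q^(r j)] points. The constant [c],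
    which depends on the generators, is lost as [j] grows; therefore neither [g] nor [d] enters the
    bound. *)
Lemma packing (Z : seq F) r (g : 'I_r -> F) d Q (rho delta : R) :
    0 \notin Z -> uniq Z -> (forall i, g i != 0) -> (0 < d)%N ->
    {in Z, forall z, rank_in g d z} ->
    0 < delta -> {in Z, forall z, N z <= rho} ->
    {in Z &, forall z z', z != z' -> delta < N (z / z')} ->
    2 * rho <= Q%:R * delta - delta -> (1 < Q)%N ->
  (size Z <= Q ^ r)%N.
Proof.
move=> Z0 uZ g0 d0 HZ del0 Hrho Hsep HQ Q1.
have [v Hv] : exists v : F -> 'I_r -> int, {in Z, forall z, z ^+ d = \prod_i g i ^ v z i}.
  have /choice [v Hv] : forall z, exists v : 'I_r -> int, z \in Z -> z ^+ d = \prod_i g i ^ v i.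
    move=> z; case: (boolP (z \in Z)) => [/HZ [v Ev]|_]; first by exists v.
    by exists (fun=> 0).
  by exists v => z zZ; apply: Hv.
pose c := (\sum_(z <- Z) \sum_i `|v z i|)%N.
have Hc z i : z \in Z -> (`|v z i| <= c)%N.
  move=> zZ; rewrite /c (big_rem z) //= (bigD1 i) //= -addnA leq_addr //.
have Hbound w i : all (mem Z) w -> (`|word_vec Q v w i| <= c * (Q ^ size w).-1)%N.
  elim: w => [|z w IH] //= /andP [zZ wZ]; have := IH wZ; have := Hc z i zZ.
  have Qw : (0 < Q ^ size w)%N by rewrite expn_gt0 ltnW.
  rewrite expnS; move: (word_vec _ _ _ _) (v z i) (Q ^ size w)%N Qw => V u q q0.
  by case: q q0 => // q _ /=; nia.
have Hval w : all (mem Z) w ->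
    word_val Q w ^+ d = \prod_i g i ^ word_vec Q v w i.
  elim: w => [|z w IH] /=.
    by rewrite expr1n big1.
  move=> /andP [zZ /IH Ew]; rewrite exprMn -exprM mulnC exprM Ew Hv // -prodrXl -big_split /=.
  by apply: eq_bigr => i _; rewrite expfzDr // [Q%:Z * _]mulrC -exprz_exp.
have inj w w' : all (mem Z) w -> all (mem Z) w' -> size w = size w' ->
    (forall i, word_vec Q v w i = word_vec Q v w' i) -> w = w'.
  move=> wZ wZ' sw Ev; apply/eqP/negPn/negP => neq.
  have := word_sep Z0 del0 Hrho Hsep HQ (ltnW Q1) wZ wZ' sw neq.
  have w0' : word_val Q w' != 0.
    by apply: word_val_neq0; apply: contra Z0 => ?; apply: (allP wZ').
  suff -> : N (word_val Q w / word_val Q w') = 0 by rewrite ltNge ltW.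
  apply: (hN_torsion Hh d0); rewrite expr_div_n Hval //.
  under eq_bigr do rewrite Ev.
  by rewrite -Hval // divff // expf_neq0.
rewrite leqNgt; apply/negP => lt_s.
have Qr0 : (0 < Q ^ r)%N by rewrite expn_gt0 ltnW.
apply: (exp_growth_contra (C := ((2 * c).+1 ^ r)%N) Qr0) => j.
pose C := (c * (Q ^ j).-1)%N.
apply: (@leq_trans ((2 * C).+1 ^ r)); last first.
  have -> : ((Q ^ r) ^ j = (Q ^ j) ^ r)%N by rewrite -!expnM mulnC.
  rewrite -expnMn; case: (posnP r) => [->|r0]; first by rewrite !expn0.
  rewrite leq_exp2r // /C.
  have : (0 < Q ^ j)%N by rewrite expn_gt0 ltnW.
  by case: (Q ^ j)%N => //= q _; nia.
have sT : #|{: seq_sub Z}| = size Z by rewrite card_seq_sub.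
pose f (t : j.-tuple (seq_sub Z)) : {ffun 'I_r -> 'I_(2 * C).+1} :=
  [ffun i => inord `|word_vec Q v (map val t) i + C%:Z|].
have allt (t : j.-tuple (seq_sub Z)) : all (mem Z) (map val t).
  by apply/allP => _ /mapP [x _ ->]; exact: valP.
have bt (t : j.-tuple (seq_sub Z)) i : (`|word_vec Q v (map val t) i| <= C)%N.
  by have := Hbound _ i (allt t); rewrite size_map size_tuple.
have f_inj : injective f.
  move=> t t' /ffunP Ef; apply/val_inj/(inj_map val_inj); apply: (inj _ _ (allt t) (allt t')) => [|i].
    by rewrite !size_map !size_tuple.
  by have := Ef i; rewrite !ffunE => /(inord_shift_inj (bt t i) (bt t' i)).
have := leq_card f f_inj.
rewrite card_tuple sT card_ffun !card_ord; apply: leq_trans.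
by case: (posnP j) => [->|j0]; rewrite ?expn0 ?leq_exp2r.
Qed.

(** The centres form a maximal [delta]-separated subset of [S], counted by [packing]; the key of a
    point is the index of the first centre within [delta]. *)
Lemma net (S : seq F) r (g : 'I_r -> F) d Q (rho delta : R) :
    0 \notin S -> (forall i, g i != 0) -> (0 < d)%N ->
    {in S, forall z, rank_in g d z} ->
    0 < delta -> {in S, forall z, N z <= rho} ->
    2 * rho <= Q%:R * delta - delta -> (1 < Q)%N ->
  exists key : F -> 'I_(Q ^ r).-1.+1,
    {in S &, forall u u', key u = key u' -> N (u / u') <= 2 * delta}.
Proof.
move=> S0 g0 d0 HS del0 Hrho HQ Q1.
have [Z [uZ ZS sepZ covZ]] : exists Z : seq F, [/\ uniq Z, {subset Z <= S},
    {in Z &, forall z z', z != z' -> delta < N (z / z')} &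
    {in S, forall u, has (fun z => N (u / z) <= delta) Z}].
  elim: S S0 {HS Hrho} => [|x S IH]; first by exists [::].
  rewrite inE negb_or eq_sym => /andP [x0 /[dup] S0 /IH [Z [uZ ZS sepZ covZ]]].
  case: (boolP (has (fun z => N (x / z) <= delta) Z)) => [Hx|Hx].
    exists Z; split=> // [z /ZS zS|u]; first by rewrite inE zS orbT.
    by rewrite inE => /orP [/eqP -> //|/covZ].
  have nz z : z \in Z -> z != 0 by move=> /ZS /(seq_neq0 S0).
  exists (x :: Z); split=> //=.
  - rewrite uZ andbT; apply: contra Hx => xZ; apply/hasP; exists x => //.
    by rewrite divff // (hN1 Hh) ltW.
  - by move=> z; rewrite !inE => /orP [->//|/ZS ->]; rewrite orbT.
  - move/hasPn in Hx.
    have Hx' z : z \in Z -> delta < N (x / z) by move=> /Hx; rewrite -ltNge.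
    move=> z z'; rewrite !inE => /orP [/eqP ->|zZ] /orP [/eqP ->|zZ'].
    + by rewrite eqxx.
    + by move=> _; apply: Hx'.
    + move=> _; rewrite -(hNV Hh) ?invf_div ?Hx' // mulf_neq0 ?invr_eq0 // nz //.
    + exact: sepZ.
  - move=> u; rewrite inE => /orP [/eqP ->|/covZ ->]; last by rewrite orbT.
    by rewrite divff // (hN1 Hh) ltW.
have Z0 : 0 \notin Z by apply: contra S0; apply: ZS.
have sZ : (size Z <= Q ^ r)%N.
  by apply: (packing (g := g) (d := d) (rho := rho) (delta := delta)) => // z /ZS ?; auto.
have Qr0 : (0 < Q ^ r)%N by rewrite expn_gt0 ltnW.
exists (fun u => inord (find (fun z => N (u / z) <= delta) Z)) => u u' uS uS' /(congr1 val).
have Hu := covZ _ uS; have Hu' := covZ _ uS'.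
rewrite /= !inordK ?prednK //; try by rewrite (leq_trans _ sZ) // -has_find.
move=> Ef; have := nth_find 0 Hu; have := nth_find 0 Hu'; rewrite -Ef.
set z := nth 0 Z _ => H1 H2.
have z0 : z != 0 by apply: contraNneq Z0 => <-; rewrite mem_nth // -has_find.
have u0 := seq_neq0 S0 uS.
have u0' := seq_neq0 S0 uS'.
have -> : u / u' = (u / z) / (u' / z) by field; rewrite u0' z0.
have uz0 : u / z != 0 by rewrite mulf_neq0 ?invr_eq0.
have uz0' : u' / z != 0 by rewrite mulf_neq0 ?invr_eq0.
apply: le_trans (hN_div Hh uz0 uz0') _; lra.
Qed.
End Packing.

(** * Covering the solutions by hyperplanes *)

Lemma row_free_rowsub_cast (F : fieldType) (m p n r : nat) (M : 'M[F]_(m, p)) (e : n = r)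
    (f : 'I_r -> 'I_m) :
  row_free (rowsub f M) -> row_free (rowsub (fun j => f (cast_ord e j)) M).
Proof.
case: r / e f => f; congr (is_true (row_free _)).
by apply/matrixP => a b; rewrite !mxE cast_ord_id.
Qed.

(** * Cofactors and orthogonal relations *)

Section LinearAlgebra.
Variables (F : fieldType) (n : nat).
Local Notation vec := {ffun 'I_n.+1 -> F}.

Definition dot (b y : vec) : F := \sum_i b i * y i.
Definition nonprop (b c : vec) := exists i j, b i * c j != b j * c i.

(* The cofactors along the first row only depend on the other rows, which span the orthogonal
   of [c]. *)
Lemma cofactor_prop (c : vec) (W : 'M[F]_(n, n.+1)) : row_free W ->
    (forall i, c i != 0) -> (forall j, \sum_i W j i * c i = 0) ->
  exists2 k, k != 0 & forall A : 'M[F]_n.+1, (forall j i, A (lift ord0 j) i = W j i) ->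
    forall i, cofactor A ord0 i = k * c i.
Proof.
move=> freeW c0 Wc.
have [v vW] : exists v : 'rV_n.+1, ~~ (v <= W)%MS.
  have : ~~ (1%:M <= W)%MS.
    apply/negP => /mxrankS; rewrite mxrank1 => H.
    by have := leq_trans H (rank_leq_row W); rewrite ltnn.
  by case/row_subPn => i Hi; exists (row i 1%:M).
pose A0 : 'M[F]_(1 + n) := col_mx v W.
have A0u : A0 \in unitmx.
  rewrite -row_free_unit /row_free eqn_leq rank_leq_row /=.
  have : (W < A0)%MS.
    rewrite ltmxE; apply/andP; split.
      by rewrite -[A0]/(col_mx v W) -addsmxE addsmxSr.
    apply: contra vW => H; apply: submx_trans H.
    by rewrite -[A0]/(col_mx v W) -addsmxE addsmxSl.
  by move/rank_ltmx; rewrite (eqP freeW).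
have D0 : \det A0 != 0 by move: A0u; rewrite unitmxE unitfE.
pose cc : 'cV_n.+1 := \col_i c i.
pose vc := \sum_i v 0 i * c i.
have A00 i : A0 ord0 i = v 0 i.
  by rewrite /A0 mxE; case: splitP => // j _; rewrite (ord1 j).
have A0S j i : A0 (lift ord0 j) i = W j i.
  rewrite /A0 mxE; case: splitP => [l|l]; first by rewrite (ord1 l).
  by rewrite lift0 add1n => -[] /val_inj <-.
clearbody A0.
have Acc : A0 *m cc = vc *: delta_mx ord0 ord0.
  apply/matrixP => a b; rewrite !mxE (ord1 b) eqxx andbT.
  case: (unliftP ord0 a) => [j ->|->].
    by rewrite mulr0 -[RHS](Wc j); apply: eq_bigr => i _; rewrite A0S mxE.
  by rewrite mulr1; apply: eq_bigr => i _; rewrite A00 mxE.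
have Ec i : \det A0 * c i = vc * cofactor A0 ord0 i.
  have /matrixP /(_ i 0) := congr1 (mulmx (\adj A0)) Acc.
  rewrite mulmxA mul_adj_mx mul_scalar_mx !mxE => ->.
  rewrite (bigD1 ord0) //= big1 ?addr0; first by rewrite !mxE eqxx mulr1 mulrC.
  by move=> a a0; rewrite !mxE (negPf a0) !mulr0.
have vc0 : vc != 0.
  apply: contraNneq D0 => vc0; have /eqP := Ec ord0.
  by rewrite vc0 mul0r mulf_eq0 (negPf (c0 _)) orbF.
exists (\det A0 / vc); first by rewrite mulf_neq0 ?invr_eq0.
move=> A HA i; have -> : cofactor A ord0 i = cofactor A0 ord0 i.
  rewrite /cofactor; congr (_ * \det _); apply/matrixP => a b.
  by rewrite !mxE HA A0S.
by rewrite mulrAC Ec mulrAC divff // mul1r.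
Qed.

(** The solutions are orthogonal to [c], so their matrix has rank at most [n]. If the rank is [n],
    then [n] of them determine [c] up to scaling by cofactors; if it is smaller, their orthogonal
    has dimension at least 2 and contains some [b] not proportional to [c]. *)
Lemma rank_alternative (c : vec) (Ys : seq vec) : (forall i, c i != 0) ->
    {in Ys, forall y, dot c y = 0} ->
  (exists b, nonprop b c /\ {in Ys, forall y, dot b y = 0}) \/
  (exists y : 'I_n -> vec, (forall j, y j \in Ys) /\ exists2 k, k != 0 &
    forall A : 'M[F]_n.+1, (forall j i, A (lift ord0 j) i = y j i) ->
      forall i, cofactor A ord0 i = k * c i).
Proof.
move=> c0 Yc; pose M : 'M[F]_(size Ys, n.+1) := \matrix_(j, i) (nth c Ys j) i.
have [rM|rM] := leqP n (\rank M).
  have [f Hf] : exists f : 'I_n -> 'I_(size Ys), row_free (rowsub f M).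
    have rMn : n = \rank M.
      apply/eqP; rewrite eqn_leq rM /= leqNgt; apply/negP => rM'.
      have /row_fullP [D DM] : row_full M by rewrite /row_full eqn_leq rank_leq_col.
      have Mc : M *m (\col_i c i) = 0.
        apply/matrixP => a b; rewrite !mxE -[RHS](Yc _ (mem_nth c (ltn_ord a))) /dot.
        by apply: eq_bigr => i _; rewrite !mxE mulrC.
      have /matrixP /(_ ord0 ord0) := congr1 (mulmx D) Mc.
      by rewrite mulmxA DM mul1mx mulmx0 !mxE => /eqP; apply/negP.
    exists (fun j => maxrankfun M (cast_ord rMn j)).
    exact/row_free_rowsub_cast/maxrowsub_free.
  right; exists (fun j => nth c Ys (f j)); split; first by move=> j; rewrite mem_nth.
  have [|k k0 Hk] := cofactor_prop Hf c0.
    move=> j; rewrite -[RHS](Yc _ (mem_nth c (ltn_ord (f j)))) /dot.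
    by apply: eq_bigr => i _; rewrite !mxE mulrC.
  by exists k => // A HA; apply: Hk => j i; rewrite HA !mxE.
left; pose cr : 'rV[F]_n.+1 := \row_i c i.
have [b [bM bc]] : exists b : 'rV[F]_n.+1, (b <= kermx M^T)%MS /\ ~~ (b <= cr)%MS.
  have : ~~ (kermx M^T <= cr)%MS.
    apply/negP => /mxrankS; rewrite mxrank_ker mxrank_tr => H.
    have := leq_trans H (rank_leq_row cr); lia.
  by case/row_subPn => i Hi; exists (row i (kermx M^T)); rewrite row_sub.
exists [ffun i => b 0 i]; split.
  apply/not_existsP => Hb; case/negP: bc; apply/sub_rVP; exists (b 0 ord0 / c ord0).
  apply/rowP => i; rewrite !mxE; apply/eqP; apply: contraT => Hi.
  exfalso; apply: (Hb i); exists ord0; apply: contra Hi => /eqP; rewrite !ffunE => Hi.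
  by rewrite mulrAC -Hi mulfK.
move=> y yY; have /sub_kermxP bM0 := bM.
have /matrixP /(_ 0 (Ordinal (etrans (index_mem y Ys) yY))) := bM0.
rewrite !mxE => H; rewrite -[RHS]H /dot; apply: eq_bigr => i _.
by rewrite !mxE ffunE /= nth_index.
Qed.
End LinearAlgebra.

(** * Cells of close solutions *)

Section Cover.
Variables (R : realType) (F : fieldType) (h : seq F -> R) (Hh : is_height h).
Variables (n : nat) (c : {ffun 'I_n.+1 -> F}).
Hypothesis c0 : forall i, c i != 0.
Local Notation N := (hN h).
Local Notation vec := {ffun 'I_n.+1 -> F}.

Definition covered (Ys : seq vec) (m : nat) := exists Bs : seq vec,
  [/\ (size Bs <= m)%N, forall b, b \in Bs -> nonprop b c &
      {in Ys, forall y, exists2 b, b \in Bs & dot b y = 0}].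

Lemma covered_seq (K : eqType) (P : K -> vec -> Prop) (ks : seq K) (Ys : seq vec) m :
    {in Ys, forall y, exists2 k, k \in ks & P k y} ->
    (forall k, k \in ks -> covered [seq y <- Ys | `[< P k y >]] m) ->
  covered Ys (size ks * m).
Proof.
move=> HP Hc.
suff [Bs [sB nB HB]] : exists Bs : seq vec, [/\ (size Bs <= size ks * m)%N,
    forall b, b \in Bs -> nonprop b c &
    forall k y, k \in ks -> y \in Ys -> P k y -> exists2 b, b \in Bs & dot b y = 0].
  exists Bs; split=> // y yY; have [k kk Pk] := HP _ yY; exact: HB Pk.
elim: ks {HP} Hc => [|k ks IH] Hc; first by exists [::].
have [|Bs [sB nB HB]] := IH; first by move=> k' kk; apply: Hc; rewrite inE kk orbT.
have [Bs' [sB' nB' HB']] := Hc k (mem_head _ _).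
exists (Bs' ++ Bs); split.
- by rewrite size_cat mulSn leq_add.
- by move=> b; rewrite mem_cat => /orP [/nB'|/nB].
- move=> k' y; rewrite inE => /orP [/eqP ->|kk] yY Pk.
    have [|b bB Hb] := HB' y; first by rewrite mem_filter yY andbT; apply/asboolP.
    by exists b => //; rewrite mem_cat bB.
  have [b bB Hb] := HB k' y kk yY Pk.
  by exists b => //; rewrite mem_cat bB orbT.
Qed.

Lemma covered_key (K : finType) (key : vec -> K) (Ys : seq vec) m :
    (forall k, covered [seq y <- Ys | key y == k] m) ->
  covered Ys (#|K| * m).
Proof.
move=> Hc; rewrite cardE; apply: (covered_seq (P := fun k y => key y = k)) => [y _|k _].
  by exists (key y) => //; rewrite mem_enum.
have -> : [seq y <- Ys | `[< key y = k >]] = [seq y <- Ys | key y == k] by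
  apply: eq_filter => y; apply/asboolP/eqP.
exact: Hc.
Qed.

Lemma covered_or (P : vec -> Prop) (Ys : seq vec) m m' :
    covered [seq y <- Ys | `[< P y >]] m -> covered [seq y <- Ys | ~~ `[< P y >]] m' ->
  covered Ys (m + m').
Proof.
move=> [B [sB nB HB]] [B' [sB' nB' HB']]; exists (B ++ B'); split.
- by rewrite size_cat leq_add.
- by move=> b; rewrite mem_cat => /orP [/nB|/nB'].
- move=> y yY; case: (boolP `[< P y >]) => Py.
    by have [|b bB Hb] := HB y; [rewrite mem_filter Py|exists b => //; rewrite mem_cat bB].
  have [|b bB Hb] := HB' y; first by rewrite mem_filter Py.
  by exists b => //; rewrite mem_cat bB orbT.
Qed.

Definition close (delta : R) (Z : seq vec) :=
  {in Z &, forall (y y' : vec) i, N (y i / y' i) <= delta}.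

(** A net is taken in each coordinate of [y / y0], which explains the [n + 1] factors [Q^r]. *)
Lemma cell_cover (Ys : seq vec) (y0 : vec) r (g : 'I_r -> F) d Q (rho delta : R) m :
    {in Ys, forall (y : vec) i, y i != 0} -> (forall i, y0 i != 0) ->
    (forall i, g i != 0) -> (0 < d)%N ->
    {in Ys, forall (y : vec) i, rank_in g d (y i / y0 i)} ->
    {in Ys, forall (y : vec) i, N (y i / y0 i) <= rho} -> 0 < delta ->
    2 * rho <= Q%:R * delta - delta -> (1 < Q)%N ->
    (forall Z, {subset Z <= Ys} -> close (2 * delta) Z -> covered Z m) ->
  covered Ys ((Q ^ r) ^ n.+1 * m).
Proof.
move=> Y0 y00 g0 d0 HR Hrho del0 HQ Q1 Hcell.
have Qr0 : (0 < Q ^ r)%N by rewrite expn_gt0 ltnW.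
have /choice [key Hkey] : forall i, exists key : F -> 'I_(Q ^ r).-1.+1,
    {in [seq y i / y0 i | y : vec <- Ys] &, forall u u', key u = key u' -> N (u / u') <= 2 * delta}.
  move=> i; apply: (net Hh (g := g) (d := d) (rho := rho)) => //.
  - apply/negP => /mapP [y yY /esym/eqP]; apply/negP.
    by rewrite mulf_neq0 ?invr_eq0 ?y00 // Y0.
  - by move=> _ /mapP [y yY ->]; apply: HR.
  - by move=> _ /mapP [y yY ->]; apply: Hrho.
pose K := {ffun 'I_n.+1 -> 'I_(Q ^ r).-1.+1}.
have -> : ((Q ^ r) ^ n.+1)%N = #|{: K}| by rewrite card_ffun !card_ord prednK.
apply: (covered_key (key := fun y : vec => [ffun i => key i (y i / y0 i)])) => k.
apply: Hcell => [y|y y']; first by rewrite mem_filter => /andP [].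
rewrite !mem_filter => /andP [/eqP Ek yY] /andP [/eqP Ek' yY'] i.
have -> : y i / y' i = (y i / y0 i) / (y' i / y0 i).
  by field; rewrite (Y0 _ yY') y00.
apply: Hkey; [exact: (map_f (fun y : vec => y i / y0 i))|exact: (map_f (fun y : vec => y i / y0 i))|].
by have /ffunP /(_ i) := etrans Ek (esym Ek'); rewrite !ffunE.
Qed.

Definition perm_terms (A : 'M[F]_n.+1) := codom (fun s : 'S_n.+1 => (-1) ^+ s * \prod_k A k (s k)).

Lemma perm_terms_neq0 (A : 'M[F]_n.+1) : (forall k i, A k i != 0) -> 0 \notin perm_terms A.
Proof.
move=> A0; apply: codom_neq0 => s.
by rewrite mulf_neq0 ?signr_eq0 //; apply/prodf_neq0.
Qed.

(** Up to sign each term takes one entry from every column, so the height is at most the sum of the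
    heights of the columns. These are invariant under scaling, hence controlled by ratios within a
    column: [n + 1] ratios to the first entry for each of [n + 1] columns. *)
Lemma h_perm_terms (A : 'M[F]_n.+1) (delta : R) : (forall k i, A k i != 0) ->
    (forall k k' i, N (A k i / A k' i) <= delta) ->
  h (perm_terms A) <= (n.+1 ^ 2)%N%:R * delta.
Proof.
move=> A0 Hd.
apply: (@le_trans _ _ (\sum_i h (codom (fun k => A k i)))).
  apply: (h_prod Hh (codom_f _ 1%g)); first exact: perm_terms_neq0.
    by move=> j; exact: codom_neq0.
  move=> _ /codomP [s ->]; exists (fun i => A ((s^-1)%g i) i); first by move=> j; exact: codom_f.
  have -> : \prod_j A ((s^-1)%g j) j = \prod_k A k (s k).
    by rewrite (reindex_inj (@perm_inj _ s)); apply: eq_bigr => k _; rewrite permK.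
  by rewrite -signr_odd; case: (odd _); [right; rewrite mulN1r|left; rewrite mul1r].
apply: (@le_trans _ _ (\sum_(i < n.+1) n.+1%:R * delta)).
  apply: ler_sum => i _; apply: le_trans (h_le_sum_ratio Hh ord0 _) _ => //.
  apply: (@le_trans _ _ (\sum_(k < n.+1) delta)); first by apply: ler_sum => k _.
  by rewrite sumr_const card_ord mulr_natl.
by rewrite sumr_const card_ord natrX -[_ *+ n.+1]mulr_natl mulrA expr2.
Qed.

Definition coord_ht (y : vec) : R := h (codom (fun i => c i * y i)).

(* Otherwise [c_i y_i] is, up to scaling, a cofactor times an entry, hence a sum of at most
   [(n + 1)!] terms of small height. *)
Lemma big_cell (Z : seq vec) (delta tau : R) : (0 < n)%N ->
    {in Z, forall (y : vec) i, y i != 0} -> {in Z, forall y, dot c y = 0} ->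
    close delta Z -> {in Z, forall y, tau <= coord_ht y} ->
    ln ((n.+1)`!%:R : R) + (n.+1 ^ 2)%N%:R * delta < tau ->
  covered Z 1.
Proof.
move=> n0 Z0 Zc Zclose Htau Hlt.
have [[b [nb Hb]]|[y [yZ [k k0 Hk]]]] := rank_alternative c0 Zc.
  by exists [:: b]; split=> // [b'|z zZ]; [rewrite inE => /eqP ->|exists b; rewrite ?inE ?Hb].
pose j0 : 'I_n := Ordinal n0.
(* The top row repeats [y j0]. Cofactors along it do not see it, and cofactor times entry is
   [k * c i * y j0 i]: up to scaling, the point whose height is bounded below by [tau]. *)
pose A : 'M[F]_n.+1 := \matrix_(a, i) (if unlift ord0 a is Some j then y j i else y j0 i).
have AS j i : A (lift ord0 j) i = y j i by rewrite mxE liftK.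
have A0 i : A ord0 i = y j0 i by rewrite mxE unlift_none.
have Arow a : exists2 z, z \in Z & forall i, A a i = z i.
  case: (unliftP ord0 a) => [j ->|->]; last by exists (y j0).
  by exists (y j).
have An0 a i : A a i != 0 by have [z zZ ->] := Arow a; apply: Z0.
have Aclose a a' i : N (A a i / A a' i) <= delta.
  by have [z zZ ->] := Arow a; have [z' zZ' ->] := Arow a'; apply: Zclose.
have hA := h_perm_terms An0 Aclose.
have cof := Hk A AS.
suff : coord_ht (y j0) <= ln ((n.+1)`!%:R : R) + h (perm_terms A).
  by have := Htau _ (yZ j0); lra.
have nz0 : 0 \notin codom (fun i => c i * y j0 i).
  by apply: codom_neq0 => i; rewrite mulf_neq0 // Z0.
pose Y := [seq cofactor A ord0 i * A ord0 i | i <- enum 'I_n.+1].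
have Y0 : 0 \notin Y.
  apply/negP => /mapP [i _ /esym/eqP]; apply/negP; rewrite cof !mulf_neq0 //.
apply: (@le_trans _ _ (h Y)).
  have kV : k^-1 != 0 by rewrite invr_eq0.
  have memY : cofactor A ord0 ord0 * A ord0 ord0 \in Y by apply/mapP; exists ord0; rewrite ?mem_enum.
  apply: le_trans (height_scale Hh memY Y0 kV).
  apply: (height_sub Hh (codom_f _ ord0)).
    apply/negP => /mapP [z zY /esym/eqP]; apply/negP; rewrite mulf_neq0 //.
    by apply: contraNneq Y0 => <-.
  move=> _ /codomP [i ->]; apply/mapP; exists (cofactor A ord0 i * A ord0 i).
    by apply/mapP; exists i; rewrite ?mem_enum.
  by rewrite cof A0 -mulrA mulKf.
have memY : cofactor A ord0 ord0 * A ord0 ord0 \in Y by apply/mapP; exists ord0; rewrite ?mem_enum.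
apply: (height_sum Hh memY) => //; first exact: perm_terms_neq0.
move=> _ /mapP [i _ ->].
pose S := [set s : 'S_n.+1 | s ord0 == i].
exists 'I_#|S|, (fun j => (-1) ^+ (enum_val j : 'S_n.+1) * \prod_k A k ((enum_val j : 'S_n.+1) k)).
split.
- by rewrite card_ord -(card_Sn n.+1); apply: max_card.
- by move=> j; exact: codom_f.
transitivity (\sum_(s in S) (-1) ^+ s * \prod_k A k (s k)); last by rewrite big_enum_val.
rewrite expand_cofactor mulr_suml; apply: eq_big => [s|s /eqP <-]; first by rewrite inE.
rewrite [in RHS](bigD1 ord0) //= mulrA [RHS]mulrAC -!mulrA; congr (_ * (_ * _)).
by apply: eq_bigl => a; rewrite eq_sym.
Qed.

(** The threshold of [small_group] for the [k!] terms of a determinant of size [k]. *)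
Definition small_bound (k : nat) : nat := ((k`!).+1 * ((k`!)`! * k`!).+1)%N.

(* The terms of the vanishing determinant with first row [y] group by their value up to roots of
   unity. Terms with [s ord0 = ord0] sum to a nonzero number, so some group mixes two columns, which
   gives a two-term relation between coordinates of [y]. *)
Lemma small_cell (Z : seq vec) (delta : R) : (1 < n)%N ->
    {in Z, forall (y : vec) i, y i != 0} -> {in Z, forall y, dot c y = 0} ->
    close delta Z -> (small_bound n.+1)%:R * (n.+1 ^ 2)%N%:R * delta < 1 ->
  covered Z (((n.+1)`! ^ 2) * ((n.+1)`!)`!).
Proof.
move=> n1 Z0 Zc Zclose Hlt; set q := (n.+1)`!.
have q0 : (0 < q)%N by apply: fact_gt0.
have [[b [nb Hb]]|[y0 [yZ [k k0 Hk]]]] := rank_alternative c0 Zc.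
  exists [:: b]; split=> // [|b'|z zZ].
  - by rewrite /= muln_gt0 fact_gt0 expn_gt0 q0.
  - by rewrite inE => /eqP ->.
  - by exists b; rewrite ?inE ?Hb.
pose A (y : vec) : 'M[F]_n.+1 := \matrix_(a, i) (if unlift ord0 a is Some j then y0 j i else y i).
have AS y j i : A y (lift ord0 j) i = y0 j i by rewrite mxE liftK.
have A0 y i : A y ord0 i = y i by rewrite mxE unlift_none.
have cof y := Hk (A y) (AS y).
pose P (s : 'S_n.+1) := (-1) ^+ s * \prod_(a | a != ord0) (if unlift ord0 a is Some j then y0 j (s a) else 1).
pose m y (s : 'S_n.+1) := (-1) ^+ s * \prod_a A y a (s a).
have Em y s : m y s = y (s ord0) * P s.
  rewrite /m /P (bigD1 ord0) //= A0 mulrCA; congr (_ * (_ * _)).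
  apply: eq_bigr => a a0; rewrite mxE.
  by case: (unliftP ord0 a) a0 => // ->; rewrite eqxx.
have P0 s : P s != 0.
  rewrite mulf_neq0 ?signr_eq0 //; apply/prodf_neq0 => a a0.
  by case: (unliftP ord0 a) a0 => [j _ _|->]; [exact: Z0|rewrite eqxx].
pose M := q`!.
have M0 : (0 < M)%N by apply: fact_gt0.
pose zeta (y : vec) (s t : 'S_n.+1) := y (s ord0) * P s / (y (t ord0) * P t).
have key y : y \in Z -> exists s t : 'S_n.+1, s ord0 != t ord0 /\ zeta y s t ^+ M = 1.
  move=> yZ'; apply: contrapT => none.
  have y_neq0 i : y i != 0 by apply: Z0.
  have Arow a : exists2 z, z \in Z & forall i, A y a i = z i.
    case: (unliftP ord0 a) => [j ->|->]; last by exists y.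
    by exists (y0 j).
  have An0 a i : A y a i != 0 by have [z zZ ->] := Arow a; apply: Z0.
  have Aclose a a' i : N (A y a i / A y a' i) <= delta.
    by have [z zZ ->] := Arow a; have [z' zZ' ->] := Arow a'; apply: Zclose.
  have m0 s : m y s != 0 by rewrite Em mulf_neq0.
  (* Expanded along its first row, the determinant is [k] times [dot c y]. *)
  have sum0 : \sum_s m y s = 0.
    rewrite -[LHS]/(\det (A y)) (expand_det_row _ ord0).
    rewrite -[RHS](mulr0 k) -[in RHS](Zc _ yZ') /dot mulr_sumr.
    by apply: eq_bigr => i _; rewrite cof A0; ring.
  have hm : #|{: 'S_n.+1}|.+1%:R * ((#|{: 'S_n.+1}|)`! * #|{: 'S_n.+1}|).+1%:R * h (codom (m y)) < 1.
    rewrite card_Sn -natrM; apply: le_lt_trans Hlt; rewrite -mulrA ler_wpM2l //.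
    exact: h_perm_terms.
  have grp := small_group Hh m0 sum0 hm; rewrite card_Sn -/q -/M in grp.
  (* If no group meets two columns, each group lies in one column, so the terms of every column sum
     to zero on their own. In column [ord0] that sum is a nonzero entry times a nonzero cofactor. *)
  have zero i : \sum_(s : 'S_n.+1 | s ord0 == i) m y s = 0.
    pose U := undup (codom (fun s => m y s ^+ M)).
    transitivity (\sum_(v <- U) \sum_(s : 'S_n.+1 | (s ord0 == i) && (m y s ^+ M == v)) m y s).
      under [RHS]eq_bigr do rewrite big_mkcondr /=.
      rewrite exchange_big /=; apply: eq_bigr => s _.
      rewrite (bigD1_seq (m y s ^+ M)) ?undup_uniq //=; last by rewrite mem_undup codom_f.
      by rewrite eqxx big1 ?addr0 // => v vs; rewrite eq_sym (negPf vs).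
    rewrite big1_seq // => v _.
    have [/existsP [s /andP [/eqP si /eqP sv]]|/existsPn no] :=
      boolP [exists s : 'S_n.+1, (s ord0 == i) && (m y s ^+ M == v)]; last first.
      by rewrite big1 // => s sP; have := no s; rewrite sP.
    rewrite -[RHS](grp v); apply: eq_bigl => t; case: eqP => //= ti; apply/esym/negP => /eqP tv.
    apply: none; exists s, t; rewrite si; split; first by rewrite eq_sym; apply/eqP.
    by rewrite /zeta -!Em expr_div_n sv tv divff // -sv expf_neq0.
  have := zero ord0; have := cof y ord0 => Ec.
  have -> : \sum_(s : 'S_n.+1 | s ord0 == ord0) m y s = A y ord0 ord0 * cofactor (A y) ord0 ord0.
    rewrite expand_cofactor mulr_sumr; apply: eq_bigr => s /eqP s0.
    rewrite /m (bigD1 ord0) //= s0 mulrCA; congr (_ * (_ * _)).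
    by apply: eq_bigl => a; rewrite eq_sym.
  by apply/eqP; rewrite mulf_neq0 // Ec mulf_neq0.
pose zs := undup [seq z <- [seq zeta p.1 p.2.1 p.2.2 |
    p <- [seq (y, st) | y <- Z, st <- enum {: 'S_n.+1 * 'S_n.+1}]] | z ^+ M == 1].
have szs : (size zs <= M)%N.
  apply: max_unity_roots => //; last exact: undup_uniq.
  by apply/allP => z; rewrite mem_undup mem_filter => /andP [zM _]; apply/unity_rootP/eqP.
pose bb (st : 'S_n.+1 * 'S_n.+1) (z : F) : vec :=
  [ffun i => if i == st.1 ord0 then P st.1 else if i == st.2 ord0 then - z * P st.2 else 0].
exists [seq bb st z | st <-
    [seq st : 'S_n.+1 * 'S_n.+1 <- enum {: 'S_n.+1 * 'S_n.+1} | st.1 ord0 != st.2 ord0], z <- zs].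
split.
- rewrite size_allpairs leq_mul //; rewrite size_filter.
  apply: leq_trans (count_size _ _) _.
  by rewrite -cardE card_prod card_Sn -/q mulnn.
- move=> _ /allpairsP [[[s t] z] [/= + _ ->]]; rewrite mem_filter => /andP [st _].
  (* A third column exists because [1 < n]. There [b] is zero and [c] is not, so the two are not
     proportional. *)
  have [l [ls lt]] : exists l, l != s ord0 /\ l != t ord0.
    have : ~~ ([set: 'I_n.+1] \subset [set s ord0; t ord0]).
      apply/negP => /subset_leq_card; rewrite cardsT card_ord cards2.
      by case: (_ != _) => /=; lia.
    by case/subsetPn => l _; rewrite !inE negb_or => /andP []; exists l.
  exists (s ord0), l; rewrite !ffunE /= eqxx (negPf ls) (negPf lt) mul0r.
  by rewrite mulf_neq0.
- move=> y yZ'; have [s [t [st zM]]] := key y yZ'.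
  exists (bb (s, t) (zeta y s t)).
    apply/allpairsP; exists ((s, t), zeta y s t); split=> //=.
      by rewrite mem_filter /= st mem_enum.
    rewrite mem_undup mem_filter zM eqxx /=; apply/mapP; exists (y, (s, t)) => //.
    by apply/allpairsP; exists (y, (s, t)); rewrite /= mem_enum.
  rewrite /dot (bigD1 (s ord0)) //= (bigD1 (t ord0)) /=; last by rewrite eq_sym.
  rewrite !ffunE /= !eqxx [t ord0 == _]eq_sym (negPf st) big1 ?addr0.
    by rewrite /zeta; field; rewrite Z0 // P0.
  by move=> i /andP [i_s i_t]; rewrite ffunE /= (negPf i_s) (negPf i_t) mul0r.
Qed.
End Cover.

Lemma ln_fact_le (R : realType) k : ln (k`!%:R : R) <= (k ^ 2)%N%:R.
Proof.
have [->|k0] := posnP k; first by rewrite fact0 ln1.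
have k0r : 0 < (k%:R : R) by rewrite ltr0n.
apply: (@le_trans _ _ (ln (k%:R ^+ k : R))).
  apply: ln_homo; first by rewrite ltr0n fact_gt0.
  rewrite -natrX ler_nat; elim: k {k0 k0r} => // k IH.
  rewrite factS expnS leq_mul2l /=; apply: leq_trans IH _.
  by case: k => // k; rewrite leq_exp2r.
rewrite lnXn // -[_ *+ k]mulr_natl natrX expr2 ler_pM2l //; exact/ltW/ln_sublinear.
Qed.

Lemma ex_min_seq (R : realDomainType) (T : eqType) (f : T -> R) (s : seq T) x0 : x0 \in s ->
  exists2 x, x \in s & {in s, forall y, f x <= f y}.
Proof.
elim: s x0 => [|x s IH] x0 // _; case: s IH => [|x1 s] IH.
  by exists x; [exact: mem_head|move=> y; rewrite inE => /eqP ->].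
have [z zs Hz] := IH x1 (mem_head _ _).
have [le|lt] := leP (f x) (f z).
  exists x; first exact: mem_head.
  by move=> y; rewrite inE => /orP [/eqP -> //|/Hz]; apply: le_trans.
exists z; first by rewrite inE zs orbT.
by move=> y; rewrite inE => /orP [/eqP ->|/Hz //]; apply: ltW.
Qed.

(** The bases are chosen to give [2 rho = (Q - 1) delta] exactly in the three uses of [cell_cover]
    below. With [K = k^2], cells of bounded height have [rho = 8 K] and
    [delta = 1 / (4 small_bound K)]; for the others [rho / delta] is [32 K]. The summands of
    [cover_bound] belong to bounded height, height comparable to the minimum, and the [m] scales. *)
Definition Qbig k := (64 * k ^ 2).+1.
Definition Qsmall k := (64 * small_bound k * k ^ 4).+1.
Definition cover_bound k r m :=
  ((Qsmall k ^ r) ^ k * ((k`! ^ 2) * (k`!)`!) + ((Qbig k ^ r) ^ k * 1 + m * ((Qbig k ^ r) ^ k * 1)))%N.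

Section HyperplaneCover.
Variables (R : realType) (F : fieldType) (h : seq F -> R) (Hh : is_height h).
Variables (n : nat) (c : {ffun 'I_n.+1 -> F}).
Hypothesis c0 : forall i, c i != 0.
Local Notation N := (hN h).
Local Notation vec := {ffun 'I_n.+1 -> F}.
Local Notation H := (coord_ht h c).

Lemma coord_nz (y : vec) : (forall i, y i != 0) -> 0 \notin codom (fun i => c i * y i).
Proof. by move=> y0; apply: codom_neq0 => i; rewrite mulf_neq0. Qed.

(** Both first coordinates being 1, the coefficients cancel in the quotient of
    [(c i * y i) / (c ord0 * y ord0)] by its analogue for [z]; no bound on [c] is involved. *)
Lemma ratio_le (y z : vec) : (forall i, y i != 0) -> (forall i, z i != 0) ->
  y ord0 = 1 -> z ord0 = 1 -> forall i, N (y i / z i) <= H y + H z.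
Proof.
move=> y0 z0 y1 z1 i.
have -> : y i / z i = (c i * y i / (c ord0 * y ord0)) / (c i * z i / (c ord0 * z ord0)).
  by rewrite y1 z1; field; rewrite !c0 z0.
have nz (x : vec) : (forall i, x i != 0) -> c i * x i / (c ord0 * x ord0) != 0.
  by move=> x0; rewrite mulf_neq0 ?invr_eq0 ?mulf_neq0.
apply: le_trans (hN_div Hh (nz _ y0) (nz _ z0)) _.
by apply: lerD; apply: (hN_le Hh) (coord_nz _) => //; exact: codom_f.
Qed.

Lemma coord_ht_le (y z : vec) : (forall i, y i != 0) -> (forall i, z i != 0) ->
  y ord0 = 1 -> z ord0 = 1 -> H y <= H z + \sum_i N (y i / z i).
Proof.
move=> y0 z0 y1 z1.
have yz0 i : y i / z i != 0 by rewrite mulf_neq0 ?invr_eq0.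
have := h_le_sum_ratio Hh ord0 yz0; rewrite y1 z1 divr1 => hr.
have {}hr : h (codom (fun i => y i / z i)) <= \sum_i N (y i / z i).
  by apply: le_trans hr _; apply: ler_sum => i _; rewrite divr1.
apply: (le_trans _ (lerD (lexx (H z)) hr)).
have U0 : 0 \notin codom (fun i => y i / z i).
  exact: codom_neq0.
have := height_mul Hh (codom_f _ ord0) (codom_f _ ord0) (coord_nz z0) U0.
apply: le_trans; apply: (height_sub Hh (codom_f _ ord0)).
  apply/negP => /allpairsP [[a b] [/= aX bX /esym/eqP]]; apply/negP.
  by rewrite mulf_neq0 //; [exact: seq_neq0 (coord_nz z0) aX|exact: seq_neq0 U0 bX].
move=> _ /codomP [i ->]; apply/allpairsP; exists (c i * z i, y i / z i); split.
- exact: (codom_f (fun i => c i * z i)).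
- exact: (codom_f (fun i => y i / z i)).
- by rewrite -mulrA [z i * _]mulrC mulfVK.
Qed.

(* With [z] of minimal height, the points are treated according to their height: bounded,
   comparable to that of [z], or larger, in which case the ratios to [z] single out a scale in
   [J]. *)
Lemma hyperplane_cover (Ys : seq vec) r (g : 'I_r -> F) d (J : seq nat) : (1 < n)%N ->
    {in Ys, forall (y : vec) i, y i != 0} -> {in Ys, forall y : vec, y ord0 = 1} ->
    {in Ys, forall y, dot c y = 0} -> (forall i, g i != 0) -> (0 < d)%N ->
    {in Ys &, forall (y z : vec) i, rank_in g d (y i / z i)} ->
    {in Ys &, forall (y z : vec) i, 1 <= N (y i / z i) ->
       exists2 j, j \in J & 2 ^+ j <= N (y i / z i) < 2 ^+ j.+1} ->
  covered c Ys (cover_bound n.+1 r (size J)).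
Proof.
move=> n1 Y0 Y1 Yc g0 d0 HR HJ.
case: Ys Y0 Y1 Yc HR HJ => [|y1 Ys'] ; first by move=> _ _ _ _ _; exists [::].
set Ys := y1 :: Ys' => Y0 Y1 Yc HR HJ.
have [z zY zmin] := ex_min_seq H (mem_head y1 Ys' : y1 \in Ys).
set k := n.+1; pose K : R := (k ^ 2)%N%:R.
have K1 : 1 <= K by rewrite /K ler1n expn_gt0.
have K0 : 0 < K by lra.
have lnK : ln (k`!%:R : R) <= K := ln_fact_le R k.
have n0 : (0 < n)%N := ltnW n1.
have Nle y i : y \in Ys -> N (y i / z i) <= 2 * H y.
  move=> yY; have := ratio_le (Y0 _ yY) (Y0 _ zY) (Y1 _ yY) (Y1 _ zY) i.
  by have := zmin _ yY; lra.
have z0 i : z i != 0 by apply: Y0.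
have sub (P : vec -> bool) (Z : seq vec) : {subset Z <= [seq y <- Ys | P y]} ->
    {in Z, forall y, y \in Ys /\ P y}.
  by move=> ZS y /ZS; rewrite mem_filter => /andP [].
apply: (covered_or (P := fun y => H y < 4 * K)).
  pose sb : R := (small_bound k)%:R.
  have sb1 : 1 <= sb by rewrite /sb ler1n muln_gt0.
  have sb0 : 0 < sb by lra.
  apply: (cell_cover Hh (y0 := z) (g := g) (d := d) (rho := 8 * K)
    (delta := (4 * sb * K)^-1)) => //.
  - by move=> y; rewrite mem_filter => /andP [_ /Y0].
  - by move=> y; rewrite mem_filter => /andP [_ yY] i; apply: HR.
  - move=> y; rewrite mem_filter => /andP [/asboolP yK yY] i.
    by have := Nle y i yY; lra.
  - by rewrite invr_gt0 !mulr_gt0.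
  - have -> : (Qsmall k)%:R = 64 * sb * K ^+ 2 + 1 :> R.
      by rewrite /Qsmall -natr1 (natrM _ (64 * small_bound k)) (natrM _ 64) /K -natrX -expnM.
    rewrite [(_ + 1) * _]mulrDl mul1r addrK.
    have -> : 64 * sb * K ^+ 2 * (4 * sb * K)^-1 = 16 * K by field; rewrite !gt_eqF.
    lra.
  - move=> Z ZS0 Zclose; have ZS := sub _ _ ZS0; apply: (small_cell Hh c0 n1 _ _ Zclose).
    + by move=> y /ZS [/Y0].
    + by move=> y /ZS [/Yc].
    rewrite -/k -/K -/sb.
    have -> : sb * K * (2 * (4 * sb * K)^-1) = 2^-1 by field; rewrite !gt_eqF.
    lra.
have Qb : (Qbig k)%:R = 64 * K + 1 :> R by rewrite /Qbig -natr1 (natrM _ 64).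
have Qb1 : (1 < Qbig k)%N by rewrite /Qbig ltnS muln_gt0 expn_gt0.
have sub2 (P Q : vec -> bool) (Z : seq vec) :
    {subset Z <= [seq y <- [seq y <- Ys | Q y] | P y]} ->
    {in Z, forall y, [/\ y \in Ys, Q y & P y]}.
  by move=> ZS y /ZS; rewrite !mem_filter => /and3P [].
have HKP y : ~~ `[< H y < 4 * K >] -> 4 * K <= H y by move/asboolP/negP; rewrite -leNgt.
apply: (covered_or (P := fun y => H y < 2 * H z)).
  (* If [H z <= 2 K] no point is left, since its height would be both below [4 K] and at least
     [4 K]. Otherwise [H z] is large enough to absorb the logarithm of the factorial, at most
     [K]. *)
  have [le_z|lt_z] := leP (H z) (2 * K).
    exists [::]; split=> // y; rewrite !mem_filter => /and3P [/asboolP yz /HKP yK _].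
    lra.
  have Hz0 : 0 < H z by lra.
  apply: (cell_cover Hh (y0 := z) (g := g) (d := d) (rho := 4 * H z)
    (delta := H z / (8 * K))) => //.
  - by move=> y; rewrite !mem_filter => /and3P [_ _ /Y0].
  - by move=> y; rewrite !mem_filter => /and3P [_ _ yY] i; apply: HR.
  - move=> y; rewrite !mem_filter => /and3P [/asboolP yz _ yY] i.
    by have := Nle y i yY; lra.
  - by rewrite divr_gt0 ?mulr_gt0.
  - rewrite Qb [(_ + 1) * _]mulrDl mul1r addrK.
    have -> : 64 * K * (H z / (8 * K)) = 8 * H z by field; rewrite gt_eqF.
    lra.
  - move=> Z ZS0 Zclose; have ZS := sub2 _ _ _ ZS0; apply: (big_cell Hh c0 n0 _ _ Zclose (tau := H z)).
    + by move=> y /ZS [/Y0].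
    + by move=> y /ZS [/Yc].
    + by move=> y /ZS [/zmin].
    rewrite -/k -/K; have -> : K * (2 * (H z / (8 * K))) = H z / 4 by field; rewrite gt_eqF.
    lra.
have HzP y : ~~ `[< H y < 2 * H z >] -> 2 * H z <= H y by move/asboolP/negP; rewrite -leNgt.
apply: (covered_seq (P := fun j y => (forall i, N (y i / z i) <= 2 * 2 ^+ j) /\ 2 ^+ j <= 2 * H y)).
  move=> y; rewrite !mem_filter => /and3P [/HzP yz /HKP yK yY].
  have [i _ Hi] := ex_min_seq (fun i => - N (y i / z i)) (mem_enum 'I_n.+1 ord0).
  have {}Hi i' : N (y i' / z i') <= N (y i / z i).
    by have := Hi i' (mem_enum _ _); lra.
  (* As [H y] is at least [2 H z] and [4 K], the heights of the [n + 1] ratios add up to at least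
     [2 K = 2 (n + 1)^2], so the largest of them exceeds 1. *)
  have Ny1 : 1 <= N (y i / z i).
    have := coord_ht_le (Y0 _ yY) (Y0 _ zY) (Y1 _ yY) (Y1 _ zY).
    have : \sum_i N (y i / z i) <= \sum_(i' < n.+1) N (y i / z i) by apply: ler_sum => i' _.
    rewrite sumr_const card_ord -[_ *+ n.+1]mulr_natl => A B.
    have C : 2 * K <= n.+1%:R * N (y i / z i) by lra.
    have k0 : 0 < (n.+1%:R : R) by rewrite ltr0n.
    have k1 : 1 <= (n.+1%:R : R) by rewrite ler1n.
    have : n.+1%:R * (n.+1%:R) <= n.+1%:R * N (y i / z i).
      by apply: le_trans C; rewrite /K natrX expr2 -/k; nra.
    by rewrite ler_pM2l //; lra.
  have [j jJ /andP [lej ltj]] := HJ y z yY zY i Ny1.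
  exists j => //; split=> [i'|]; last by have := Nle y i yY; lra.
  by have := Hi i'; rewrite -exprS; lra.
move=> j jJ; have p0 : 0 < 2 ^+ j :> R by rewrite exprn_gt0.
apply: (cell_cover Hh (y0 := z) (g := g) (d := d) (rho := 2 * 2 ^+ j)
    (delta := 2 ^+ j / (16 * K))) => //.
- by move=> y; rewrite !mem_filter => /and4P [_ _ _ /Y0].
- by move=> y; rewrite !mem_filter => /and4P [_ _ _ yY] i; apply: HR.
- by move=> y; rewrite !mem_filter => /and4P [/asboolP [yj _] _ _ yY] i.
- by rewrite divr_gt0 ?mulr_gt0.
- rewrite Qb [(_ + 1) * _]mulrDl mul1r addrK.
  have -> : 64 * K * (2 ^+ j / (16 * K)) = 4 * 2 ^+ j by field; rewrite gt_eqF.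
  lra.
move=> Z ZS Zclose.
have {}ZS y : y \in Z -> [/\ y \in Ys, 4 * K <= H y & 2 ^+ j <= 2 * H y].
  by move=> /ZS; rewrite !mem_filter => /and4P [/asboolP [_ ?] _ /HKP ? ?].
(* [tau] is the mean of the lower bounds [4 K] and [2^j / 2] for [H y]: one half beats the
   factorial, the other the diameter of the cell. *)
apply: (big_cell Hh c0 n0 _ _ Zclose (tau := 2 * K + 2 ^+ j / 4)).
+ by move=> y /ZS [/Y0].
+ by move=> y /ZS [/Yc].
+ by move=> y /ZS [_]; lra.
rewrite -/k -/K; have -> : K * (2 * (2 ^+ j / (16 * K))) = 2 ^+ j / 8 by field; rewrite gt_eqF.
lra.
Qed.
End HyperplaneCover.

(** * Counting solutions *)

Definition nondeg (F : fieldType) (I : finType) (J : {set I}) (c y : {ffun I -> F}) :=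
  forall J' : {set I}, J' \subset J -> J' != set0 -> J' != J -> \sum_(i in J') c i * y i != 0.

Definition proj_covered (F : fieldType) (I : finType) (A : pred F) (J : {set I})
    (c : {ffun I -> F}) (m : nat) := exists Zs : seq {ffun I -> F},
  (size Zs <= m)%N /\ forall y : {ffun I -> F}, (forall i, i \in J -> y i \in A) ->
    \sum_(i in J) c i * y i = 0 -> nondeg J c y ->
    exists2 z, z \in Zs & exists t, forall i, i \in J -> y i = t * z i.

Section Count.
Variables (R : realType) (F : fieldType) (h : seq F -> R) (Hh : is_height h).
Variables (A : seq F) (r : nat) (g : 'I_r -> F) (d : nat) (S : seq nat).
Hypothesis A0 : 0 \notin A.
Hypothesis g0 : forall i, g i != 0.
Hypothesis d0 : (0 < d)%N.
Hypothesis Arank : {in A &, forall a b, rank_in g d (a / b)}.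
Hypothesis Ascale : forall a b a' b', a \in A -> b \in A -> a' \in A -> b' \in A ->
  1 <= hN h ((a / b) / (a' / b')) ->
  exists2 j, j \in S & 2 ^+ j <= hN h ((a / b) / (a' / b')) < 2 ^+ j.+1.
Variable k : nat.
Local Notation I := 'I_k.
Local Notation vec := {ffun I -> F}.

Lemma A_neq0 a : a \in A -> a != 0.
Proof. exact: seq_neq0. Qed.

Definition all_vec (T : finType) : seq {ffun T -> F} :=
  [seq [ffun i => val (f i)] | f : {ffun T -> seq_sub A}].

Lemma all_vecP (T : finType) (y : {ffun T -> F}) :
  reflect (forall i, y i \in A) (y \in all_vec T).
Proof.
apply: (iffP mapP) => [[f _ ->] i|H]; first by rewrite ffunE; exact: valP.
exists [ffun i => SeqSub (H i)]; first by rewrite mem_enum.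
by apply/ffunP => i; rewrite !ffunE.
Qed.

(** Points are normalised by their first coordinate, so coordinates are quotients of elements of
    [A], and comparing two points produces the quotients of quotients of [Ascale]. *)
Lemma set_hyperplanes (J : {set I}) (c : vec) : (2 < #|J|)%N ->
    (forall i, i \in J -> c i != 0) ->
  exists Bs : seq vec, [/\ (size Bs <= cover_bound #|J| r (size S))%N,
    forall b, b \in Bs -> exists i1 i2, [/\ i1 \in J, i2 \in J & b i1 * c i2 != b i2 * c i1] &
    forall y : vec, (forall i, i \in J -> y i \in A) -> \sum_(i in J) c i * y i = 0 ->
      exists2 b, b \in Bs & \sum_(i in J) b i * y i = 0].
Proof.
move=> J2 cJ; case En : #|J| J2 => [|n] // n1.
pose e (i : 'I_n.+1) : I := enum_val (cast_ord (esym En) i).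
have eJ i : e i \in J by apply: enum_valP.
have e_inj : injective e by move=> i j /enum_val_inj /cast_ord_inj.
have sume (f : I -> F) : \sum_(i in J) f i = \sum_i f (e i).
  rewrite big_enum_val (reindex (cast_ord (esym En))) //.
  by exists (cast_ord En) => i _; rewrite ?cast_ordK ?cast_ordKV.
pose ce : {ffun 'I_n.+1 -> F} := [ffun i => c (e i)].
have ce0 i : ce i != 0 by rewrite ffunE cJ.
pose Ys : seq {ffun 'I_n.+1 -> F} := [seq [ffun i => y i / y ord0] | y : {ffun 'I_n.+1 -> F} <-
  [seq y <- all_vec 'I_n.+1 | dot ce y == 0]].
have YsP (y : {ffun 'I_n.+1 -> F}) : y \in Ys ->
    exists2 x : {ffun 'I_n.+1 -> F}, (forall i, x i \in A) /\ dot ce x = 0 & forall i, y i = x i / x ord0.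
  move=> /mapP [x + ->]; rewrite mem_filter => /andP [/eqP xc /all_vecP xA].
  by exists x => // i; rewrite ffunE.
have [Bs [sB nB HB]] : covered ce Ys (cover_bound n.+1 r (size S)).
  apply: (hyperplane_cover Hh ce0 (g := g) (d := d)) => //.
  - by move=> y /YsP [x [xA _] Ey] i; rewrite Ey mulf_neq0 ?invr_eq0 ?A_neq0.
  - by move=> y /YsP [x [xA _] Ey]; rewrite Ey divff ?A_neq0.
  - move=> y /YsP [x [xA xc] Ey]; rewrite /dot.
    under eq_bigr do rewrite Ey mulrA.
    by rewrite -mulr_suml -[\sum_i _]/(dot ce x) xc mul0r.
  - move=> y z /YsP [x [xA _] Ey] /YsP [x' [xA' _] Ez] i; rewrite Ey Ez.
    by apply: (rank_inM g0); [|apply: (rank_inV g0)]; apply: Arank.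
  - move=> y z /YsP [x [xA _] Ey] /YsP [x' [xA' _] Ez] i; rewrite Ey Ez.
    exact: Ascale.
exists [seq [ffun i => \sum_(j | e j == i) b j] | b : {ffun 'I_n.+1 -> F} <- Bs].
have be (b : {ffun 'I_n.+1 -> F}) i : \sum_(j | e j == e i) b j = b i.
  by rewrite (eq_bigl (pred1 i)) ?big_pred1_eq // => j; rewrite /= (inj_eq e_inj).
split; first by rewrite size_map.
  move=> _ /mapP [b bB ->]; have [i [j Hij]] := nB _ bB.
  by exists (e i), (e j); rewrite !eJ !ffunE !be; split=> //; move: Hij; rewrite !ffunE.
move=> y yA yc; pose ye : {ffun 'I_n.+1 -> F} := [ffun i => y (e i)].
have yeA i : ye i \in A by rewrite ffunE yA.
have yec : dot ce ye = 0.
  by rewrite -yc sume /dot; apply: eq_bigr => i _; rewrite !ffunE.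
have [|b bB Hb] := HB [ffun i => ye i / ye ord0].
  apply/mapP; exists ye => //; rewrite mem_filter yec eqxx /=; exact/all_vecP.
exists [ffun i => \sum_(j | e j == i) b j]; first exact: map_f.
rewrite sume; transitivity (dot b [ffun i => ye i / ye ord0] * ye ord0); last by rewrite Hb mul0r.
rewrite /dot mulr_suml; apply: eq_bigr => i _; rewrite !ffunE be mulrA mulfVK //.
exact/A_neq0/yA/eJ.
Qed.

(** A solution [y] also satisfies one of the relations [cb b], whose support is smaller than [J]. A
    minimal vanishing subsum of it is nondegenerate, and induction determines [y] up to scaling on
    its support [J1]. Contracting [J1] to one index leaves a nondegenerate equation in fewer
    variables, and the two lines are glued along that index. The recursion [F s = E * F (s - 1)^2]
    produces the exponent [2^s - 1]. *)
Lemma proj_count (E : nat) : (2 ^ k * \max_(s < k.+1) cover_bound s r (size S) <= E)%N -> (0 < E)%N ->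
  forall (J : {set I}) (c : vec), (forall i, i \in J -> c i != 0) ->
    proj_covered (mem A) J c (if #|J| <= 2 then 1 else E ^ (2 ^ #|J|).-1)%N.
Proof.
move=> HE E0 J; have [s] := ubnP #|J|; elim: s J => // s IH J /ltnSE le_s c cJ.
have Fpos x : (0 < E ^ x)%N by rewrite expn_gt0 E0.
have [J0|J0] := eqVneq J set0.
  by rewrite J0 cards0; exists [:: 0]; split=> // y _ _ _; exists 0; [rewrite inE|exists 0 => i; rewrite inE].
case: (leqP #|J| 2) => [le2|J3].
  have /set0Pn [i iJ] := J0.
  have [J1|/set0Pn [j]] := eqVneq (J :\ i) set0.
    exists [::]; split=> // y yA yc _; exfalso; move/eqP: yc; apply/negP.
    rewrite (big_setD1 i) //= J1 big_set0 addr0 mulf_neq0 ?cJ // A_neq0 //; exact: yA.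
  rewrite !inE => /andP [ji jJ].
  have EJ : J = [set i; j].
    apply/esym/eqP; rewrite eqEcard cards2 eq_sym ji le2 andbT.
    by apply/subsetP => x; rewrite !inE => /orP [/eqP ->|/eqP ->].
  exists [:: [ffun l => if l == i then 1 else - c i / c j]]; split=> // y yA yc _.
  exists [ffun l => if l == i then 1 else - c i / c j]; first exact: mem_head.
  exists (y i) => l; rewrite EJ !inE ffunE => /orP [/eqP ->|/eqP ->]; first by rewrite eqxx mulr1.
  rewrite (negPf ji); move: yc; rewrite EJ (big_setD1 i) ?inE ?eqxx //= (_ : _ :\ i = [set j]).
    rewrite big_set1 => /eqP; rewrite addrC addr_eq0 => /eqP H.
    by rewrite mulrA mulrN [y i * _]mulrC -H mulrAC divff ?mul1r ?cJ.
  by apply/setP => x; rewrite !inE; case: (x =P i) => [->|] //=; rewrite eq_sym (negPf ji).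
have [Bs [sB nB HB]] := set_hyperplanes J3 cJ.
have Jk : (#|J| <= k)%N by rewrite -[k in (_ <= k)%N](card_ord k) max_card.
set Fm := (E ^ (2 ^ #|J|.-1).-1)%N.
have mono x : (x < #|J|)%N -> ((if x <= 2 then 1 else E ^ (2 ^ x).-1) <= Fm)%N.
  move=> lt_x; case: ifP => _; first exact: Fpos.
  rewrite leq_pexp2l //.
  have : (2 ^ x <= 2 ^ #|J|.-1)%N by rewrite leq_pexp2l // -ltnS prednK // (leq_trans _ J3).
  by move: (2 ^ x)%N (2 ^ _)%N => a b; lia.
(* Eliminating one variable between [c] and [b]. *)
have /choice [cb Hcb] : forall b : vec, exists cb : vec, b \in Bs ->
    (exists i1 i2, [/\ i1 \in J, i2 \in J, cb i1 = 0 & cb i2 != 0]) /\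
    forall y : vec, \sum_(i in J) c i * y i = 0 -> \sum_(i in J) b i * y i = 0 ->
      \sum_(i in J) cb i * y i = 0.
  move=> b; case: (boolP (b \in Bs)) => [/nB [i1 [i2 [i1J i2J H12]]]|_]; last by exists 0.
  exists [ffun i => c i1 * b i - b i1 * c i] => _; split.
    exists i1, i2; rewrite !ffunE; split=> //; first by rewrite mulrC subrr.
    by rewrite subr_eq0 mulrC eq_sym.
  move=> y yc yb; under eq_bigr do rewrite ffunE mulrBl -!mulrA.
  by rewrite sumrB -!mulr_sumr yc yb !mulr0 subrr.
pose good (b : vec) (J1 : {set I}) := [/\ b \in Bs, J1 \subset J, J1 != J, J1 != set0 &
  forall i, i \in J1 -> cb b i != 0].
have /choice [Z1 HZ1] : forall p : vec * {set I}, exists Zs : seq vec, (size Zs <= Fm)%N /\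
    (good p.1 p.2 -> forall y : vec, (forall i, i \in p.2 -> y i \in A) ->
      \sum_(i in p.2) cb p.1 i * y i = 0 -> nondeg p.2 (cb p.1) y ->
      exists2 z, z \in Zs & exists t, forall i, i \in p.2 -> y i = t * z i).
  move=> [b J1] /=; case: (pselect (good b J1)) => [Hg|nHg]; last by exists [::].
  have [bB sJ1 J1J _ cb0] := Hg.
  have lt1 : (#|J1| < #|J|)%N by apply: proper_card; rewrite properEneq J1J.
  have [Zs [sZ HZ]] := IH J1 (leq_trans lt1 le_s) (cb b) cb0.
  by exists Zs; split; [apply: leq_trans sZ (mono _ lt1)|move=> _].
pose pt (J1 : {set I}) : option I := [pick j in J1].
(* Once [y] is [t z] on [J1], the block [\sum_(l in J1) c l * y l] is a multiple of [y j]. It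
   becomes one variable of index [j], whose coefficient in [c'] is nonzero because [y] is
   nondegenerate. *)
pose K (J1 : {set I}) j := j |: (J :\: J1).
pose c' (J1 : {set I}) j (z : vec) : vec :=
  [ffun i => if i == j then (\sum_(l in J1) c l * z l) / z j else c i].
pose good2 (J1 : {set I}) j (z : vec) := [/\ j \in J1, J1 \subset J, (1 < #|J1|)%N &
  forall i, i \in K J1 j -> c' J1 j z i != 0].
have /choice [Z2 HZ2] : forall p : {set I} * I * vec, exists Zs : seq vec, (size Zs <= Fm)%N /\
    (good2 p.1.1 p.1.2 p.2 -> forall y : vec, (forall i, i \in K p.1.1 p.1.2 -> y i \in A) ->
      \sum_(i in K p.1.1 p.1.2) c' p.1.1 p.1.2 p.2 i * y i = 0 ->
      nondeg (K p.1.1 p.1.2) (c' p.1.1 p.1.2 p.2) y ->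
      exists2 z, z \in Zs & exists t, forall i, i \in K p.1.1 p.1.2 -> y i = t * z i).
  move=> [[J1 j] z] /=; case: (pselect (good2 J1 j z)) => [Hg|nHg]; last by exists [::].
  have [jJ1 sJ1 J1gt cz0] := Hg.
  have lt1 : (#|K J1 j| < #|J|)%N.
    rewrite cardsU1 !inE jJ1 /= -(cardsID J1 J) (setIidPr sJ1) ltn_add2r //.
  have [Zs [sZ HZ]] := IH (K J1 j) (leq_trans lt1 le_s) (c' J1 j z) cz0.
  by exists Zs; split; [apply: leq_trans sZ (mono _ lt1)|move=> _].
pose combine (J1 : {set I}) (j : I) (z w : vec) : vec :=
  [ffun i => if i \in J1 then z i * w j / z j else w i].
pose lst (b : vec) (J1 : {set I}) : seq vec := if pt J1 is Some j then
  [seq combine J1 j p.1 p.2 | p <- flatten [seq [seq (z, w) | w <- Z2 (J1, j, z)] | z <- Z1 (b, J1)]]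
  else [::].
exists (flatten [seq lst p.1 p.2 | p <- [seq (b, J1) | b <- Bs, J1 <- enum {: {set I}}]]).
split.
  have flat (T1 T2 : Type) (f : T1 -> seq T2) (s1 : seq T1) m :
      (forall x, (size (f x) <= m)%N) -> (size (flatten [seq f x | x <- s1]) <= size s1 * m)%N.
    move=> Hf; elim: s1 => //= x s1 IH1; rewrite size_cat mulSn leq_add //.
  have slst b J1 : (size (lst b J1) <= Fm * Fm)%N.
    rewrite /lst; case: (pt J1) => // j; rewrite size_map.
    apply: leq_trans (_ : size (Z1 (b, J1)) * Fm <= _)%N; last by rewrite leq_mul2r (HZ1 _).1 orbT.
    by apply: flat => z; rewrite size_map; exact: (HZ2 _).1.
  apply: leq_trans (flat _ _ (fun p => lst p.1 p.2) _ _ (fun p => slst p.1 p.2)) _.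
  rewrite size_allpairs -cardE -cardsT -powersetT card_powerset cardsT card_ord.
  (* The choice of a hyperplane and of one of at most [2^k] subsets [J1] accounts for the factor
     [E]; the two lines account for [Fm * Fm]. *)
  have leE : (size Bs * 2 ^ k <= E)%N.
    apply: leq_trans HE; rewrite mulnC leq_mul2l; apply/orP; right.
    apply: leq_trans sB _; have Jk' : (#|J| < k.+1)%N by [].
    exact: (leq_bigmax (F := fun s : 'I_k.+1 => cover_bound s r (size S)) (Ordinal Jk')).
  apply: leq_trans (leq_mul leE (leqnn _)) _.
  rewrite /Fm -expnD -expnS leq_pexp2l //.
  have : (0 < 2 ^ #|J|.-1)%N by rewrite expn_gt0.
  have -> : (2 ^ #|J| = 2 * 2 ^ #|J|.-1)%N by rewrite -expnS prednK // (leq_trans _ J3).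
  by move: (2 ^ _)%N => a; lia.
move=> y yA yc ynd.
have y0 i : i \in J -> y i != 0 by move=> /yA /A_neq0.
have [b bB Hb] := HB y yA yc.
have [[i1 [i2 [i1J i2J cb1 cb2]]] Hcb0] := Hcb b bB.
have {}Hcb0 := Hcb0 y yc Hb.
pose JJ := [set i in J | cb b i != 0].
have J0s : \sum_(i in JJ) cb b i * y i = 0.
  rewrite -[RHS]Hcb0 [RHS](bigID (fun i => cb b i != 0)) /= [X in _ = _ + X]big1 ?addr0.
    by apply: eq_bigl => i; rewrite inE.
  by move=> i /andP [_ /negPn /eqP ->]; rewrite mul0r.
have [J1 /minsetP [/and3P [sJ10 J1n /eqP J1s] J1min]] :
  exists J1, minset (fun J1 : {set I} => [&& J1 \subset JJ, J1 != set0 & \sum_(i in J1) cb b i * y i == 0]) J1.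
  have [|J1 HJ1 _] := @minset_exists _ (fun J1 : {set I} => [&& J1 \subset JJ, J1 != set0 & \sum_(i in J1) cb b i * y i == 0]) JJ.
    by rewrite subxx J0s eqxx andbT; apply/set0Pn; exists i2; rewrite inE i2J.
  by exists J1.
have sJ1 : J1 \subset J by apply: subset_trans sJ10 _; apply/subsetP => i; rewrite inE => /andP [].
have cbJ1 i : i \in J1 -> cb b i != 0 by move/(subsetP sJ10); rewrite inE => /andP [].
have J1J : J1 != J.
  by apply: contraTneq i1J => <-; apply/negP => /cbJ1; rewrite cb1 eqxx.
(* A single term cannot vanish. With at least two indices in [J1], the contracted set is strictly
   smaller than [J]. *)
have J1gt : (1 < #|J1|)%N.
  rewrite ltn_neqAle card_gt0 J1n andbT eq_sym; apply/negP => /cards1P [x Ex].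
  move/eqP: J1s; apply/negP; rewrite Ex big_set1 mulf_neq0 //; first by apply: cbJ1; rewrite Ex inE.
  by apply: y0; apply: (subsetP sJ1); rewrite Ex inE.
have [j jJ1 Ej] : exists2 j, j \in J1 & pt J1 = Some j.
  rewrite /pt; case: pickP => [j jJ1|no]; first by exists j.
  by case/set0Pn: J1n => x; rewrite no.
have [z zZ [t Ht]] : exists2 z, z \in Z1 (b, J1) & exists t, forall i, i \in J1 -> y i = t * z i.
  apply: (HZ1 (b, J1)).2 => //=; first by move=> i /(subsetP sJ1) /yA.
  move=> J' sJ' J'n J'J; apply/negP => J's; case/negP: J'J; apply/eqP.
  by apply: J1min => //; rewrite J's J'n (subset_trans sJ' sJ10).
have yj0 : y j != 0 by apply: y0; apply: (subsetP sJ1).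
have zj0 : z j != 0 by apply: contraNneq yj0 => zj; rewrite (Ht j jJ1) zj mulr0.
have t0 : t != 0 by apply: contraNneq yj0 => tj; rewrite (Ht j jJ1) tj mul0r.
have Ec'j : c' J1 j z j * y j = \sum_(i in J1) c i * y i.
  rewrite ffunE eqxx (Ht j jJ1) [t * _]mulrC mulrA mulfVK // mulr_suml.
  by apply: eq_bigr => l lJ1; rewrite (Ht l lJ1); ring.
have jK i : i \in J :\: J1 -> i != j.
  by rewrite inE => /andP [iJ1 _]; apply: contraNneq iJ1 => ->.
have Ec' i : i \in J :\: J1 -> c' J1 j z i = c i by move=> /jK ij; rewrite ffunE (negPf ij).
have J1sum0 : \sum_(i in J1) c i * y i != 0 by apply: ynd.
have jnK : j \notin J :\: J1 by rewrite inE jJ1.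
have c'0 i : i \in K J1 j -> c' J1 j z i != 0.
  rewrite in_setU1 => /orP [/eqP ->|iK].
    by apply: contraNneq J1sum0 => H; rewrite -Ec'j H mul0r.
  by rewrite Ec' //; apply: cJ; move: iK; rewrite inE => /andP [].
have [w wZ [t' Ht']] : exists2 w, w \in Z2 (J1, j, z) & exists t, forall i, i \in K J1 j -> y i = t * w i.
  apply: (HZ2 (J1, j, z)).2 => //=.
  - move=> i; rewrite in_setU1 => /orP [/eqP ->|]; first by apply: yA; apply: (subsetP sJ1).
    by rewrite inE => /andP [_ /yA].
  - rewrite big_setU1 //= Ec'j -[RHS]yc [RHS](big_setID J1) /= (setIidPr sJ1); congr (_ + _).
    by apply: eq_bigr => i iK; rewrite Ec'.
  - move=> J' sJ' J'n J'K.
    have sumD (T : {set I}) : T \subset J :\: J1 -> \sum_(i in T) c' J1 j z i * y i = \sum_(i in T) c i * y i.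
      by move=> sT; apply: eq_bigr => i /(subsetP sT) iK; rewrite Ec'.
    (* A subsum of the contracted equation through [j] is a subsum of the original one that contains
       all of [J1]. *)
    have [jJ'|jJ'] := boolP (j \in J').
      have sT : J' :\ j \subset J :\: J1.
        apply/subsetP => i; rewrite !inE => /andP [ij /(subsetP sJ')].
        by rewrite in_setU1 (negPf ij) inE.
      have -> : \sum_(i in J') c' J1 j z i * y i = \sum_(i in J1 :|: J' :\ j) c i * y i.
        rewrite (big_setD1 j) //= Ec'j sumD // [RHS](big_setID J1) /=; congr (_ + _).
          by apply: eq_bigl => i; rewrite !inE; case: (i \in J1); rewrite ?andbF.
        apply: eq_bigl => i; have [iT|] := boolP (i \in J' :\ j); last first.
          by rewrite !inE => /negPf ->; case: (i \in J1).
        by have := subsetP sT i iT; rewrite [in X in X -> _]in_setD => /andP [iJ1 _];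
          rewrite in_setD in_setU iT iJ1 orbT.
      apply: ynd.
      + by rewrite subUset sJ1 (subset_trans sT) // subsetDl.
      + by apply/set0Pn; exists j; rewrite inE jJ1.
      + apply: contra J'K => /eqP EJ; rewrite eqEsubset sJ' /=; apply/subsetP => i.
        rewrite in_setU1 => /orP [/eqP -> //|iK].
        have : i \in J1 :|: J' :\ j by rewrite EJ; move: iK; rewrite inE => /andP [].
        by move: iK; rewrite !inE => /andP [/negPf -> _] /andP [].
    have sT : J' \subset J :\: J1.
      apply/subsetP => i iJ'; have := subsetP sJ' _ iJ'; rewrite in_setU1 => /orP [/eqP ij|//].
      by rewrite -ij iJ' in jJ'.
    rewrite sumD //; apply: ynd => //; first by rewrite (subset_trans sT) // subsetDl.
    apply: contraTneq jJ1 => EJ; apply/negP => jJ1.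
    by have := subsetP sT j; rewrite EJ (subsetP sJ1) // (negPf jnK) => /(_ isT).
exists (combine J1 j z w).
  apply/flattenP; exists (lst b J1).
    apply/mapP; exists (b, J1) => //; apply/allpairsP; exists (b, J1); split=> //=.
    by rewrite mem_enum.
  rewrite /lst Ej; apply/mapP; exists (z, w) => //; apply/flattenP.
  by exists [seq (z, w) | w <- Z2 (J1, j, z)]; apply: map_f.
exists t' => i iJ; rewrite ffunE; have [iJ1|iJ1] := boolP (i \in J1); last first.
  by apply: Ht'; rewrite in_setU1 inE iJ1 iJ orbT.
rewrite (Ht i iJ1) mulrA mulrCA -(Ht' j) ?in_setU1 ?eqxx // (Ht j jJ1).
by rewrite [z i * _]mulrC mulrAC -[t * z j / z j]mulrA divff // mulr1.
Qed.
End Count.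

(** * Additive energy *)

Lemma cauchy_schwarz_nat (T : finType) (f : T -> nat) :
  ((\sum_v f v) ^ 2 <= #|T| * \sum_v f v ^ 2)%N.
Proof.
rewrite -(leq_pmul2l (isT : (0 < 2)%N)).
have -> : (2 * (\sum_v f v) ^ 2 = \sum_u \sum_v 2 * (f u * f v))%N.
  rewrite expnS expn1 big_distrl big_distrr /=; apply: eq_bigr => u _.
  by rewrite -big_distrr /= -big_distrr.
have -> : (2 * (#|T| * \sum_v f v ^ 2) = \sum_u \sum_v (f u ^ 2 + f v ^ 2))%N.
  transitivity (\sum_u (#|T| * f u ^ 2 + \sum_v f v ^ 2))%N; last first.
    by apply: eq_bigr => u _; rewrite big_split /= sum_nat_const.
  by rewrite big_split /= -big_distrr /= sum_nat_const mul2n addnn.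
apply: leq_sum => u _; apply: leq_sum => v _; exact: nat_Cauchy.
Qed.

Lemma sum_sq_bound (T : finType) (P : pred T) (f : T -> nat) M :
  (forall x, P x -> (f x ^ 2 <= M)%N) -> ((\sum_(x | P x) f x) ^ 2 <= #|T| ^ 2 * M)%N.
Proof.
move=> H; case: (pickP P) => [x0 Px0|no]; last by rewrite big_pred0.
pose m := (\max_(x | P x) f x)%N.
have [x Px Ex] : exists2 x, P x & m = f x.
  have P0 : (0 < #|P|)%N by apply/card_gt0P; exists x0.
  by have [x Px Ex] := eq_bigmax_cond f P0; exists x.
apply: (@leq_trans ((#|T| * m) ^ 2)); last by rewrite expnMn leq_mul2l Ex H // orbT.
rewrite leq_exp2r //; apply: (@leq_trans (\sum_(x | P x) m)).
  by apply: leq_sum => y Py; rewrite /m (bigD1 y) //= leq_maxl.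
by rewrite sum_nat_const leq_mul2r max_card orbT.
Qed.

Section Energy.
Variables (F : fieldType) (A : seq F) (k : nat) (c : {ffun 'I_k -> F}).
Hypothesis uA : uniq A.
Hypothesis A0 : 0 \notin A.
Hypothesis c0 : forall i, c i != 0.
Local Notation I := 'I_k.
Local Notation T := (seq_sub A).
Variables (t0 : T) (Fb W : nat).
Hypothesis HF : forall J : {set I},
  proj_covered (mem A) J c (if #|J| <= 2 then 1 else Fb)%N.
Hypothesis HW : (Fb ^ 2 <= W * size A)%N.
Hypothesis W0 : (0 < W)%N.

(** Coordinates outside [J] are frozen at [t0], so that solutions for all [J] are counted within one
    finite type. *)
Definition solutions (J : {set I}) : {set {ffun I -> T}} :=
  [set f : {ffun I -> T} | [forall i in ~: J, f i == t0] && (\sum_(i in J) c i * val (f i) == 0)].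

Definition nd_solutions (J : {set I}) : {set {ffun I -> T}} :=
  [set f in solutions J | [forall J' : {set I}, [&& J' \subset J, J' != set0 & J' != J] ==>
     (\sum_(i in J') c i * val (f i) != 0)]].

Definition restrict (J : {set I}) (f : {ffun I -> T}) : {ffun I -> T} :=
  [ffun i => if i \in J then f i else t0].

Lemma size_A_gt0 : (0 < size A)%N.
Proof. by case: t0 => x; case: (A). Qed.

Lemma card_T : #|{: T}| = size A.
Proof. by rewrite card_seq_sub. Qed.

Lemma val_neq0 (t : T) : val t != 0.
Proof. by apply: contraNneq A0 => <-; exact: valP. Qed.

(** On a given line a solution is determined by its coordinate of index [j]. *)
Lemma nd_solutions_proj (J : {set I}) m : J != set0 -> proj_covered (mem A) J c m ->
  (#|nd_solutions J| <= m * size A)%N.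
Proof.
case/set0Pn => j jJ [Zs [sZ HZ]].
pose Zt := [seq (z, t) | z <- Zs, t <- enum {: T}].
pose key (f : {ffun I -> T}) := [ffun i => val (f i)] : {ffun I -> F}.
pose build (p : {ffun I -> F} * T) : {ffun I -> F} :=
  [ffun i => if i \in J then val p.2 / p.1 j * p.1 i else val t0].
have key_inj : injective key.
  by move=> f f' /ffunP E; apply/ffunP => i; apply: val_inj; have := E i; rewrite !ffunE.
rewrite cardE -(size_map key).
apply: (@leq_trans (size (map build Zt))).
  apply: uniq_leq_size; first by rewrite map_inj_uniq ?enum_uniq.
  move=> _ /mapP [f + ->]; rewrite mem_enum inE => /andP [].
  rewrite inE => /andP [/forallP fJ /eqP fs] /forallP fnd.
  have [i _||J' sJ' J'n J'J|z zZ [t Ht]] := HZ (key f).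
  - by rewrite ffunE; exact: valP.
  - by rewrite -[RHS]fs; apply: eq_bigr => i _; rewrite ffunE.
  - have := fnd J'; rewrite sJ' J'n J'J /= => H; apply: contra H => /eqP H.
    by apply/eqP; rewrite -[RHS]H; apply: eq_bigr => i _; rewrite ffunE.
  apply/mapP; exists (z, f j); first by apply/allpairsP; exists (z, f j); rewrite /= mem_enum.
  have Ej := Ht j jJ; rewrite ffunE in Ej.
  have zj : z j != 0 by apply: contraNneq (val_neq0 (f j)) => zj; rewrite Ej zj mulr0.
  apply/ffunP => i; rewrite !ffunE; case: ifP => iJ.
    by have := Ht i iJ; rewrite ffunE => ->; rewrite Ej mulfK.
  by have := fJ i; rewrite inE iJ /= => /eqP ->.
by rewrite size_map size_allpairs -cardE card_T leq_mul2r sZ orbT.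
Qed.

(** Squaring avoids the half-integral exponent [|J| / 2]. One variable has no solution, two
    variables give a single line, and from three variables on [HW] trades [Fb^2] for [W] and one of
    the spare factors [|A|]. *)
Lemma nd_solutions_sq (J : {set I}) : J != set0 -> (#|nd_solutions J| ^ 2 <= (W * size A) ^ #|J|)%N.
Proof.
move=> J0; have a0 := size_A_gt0.
have := nd_solutions_proj J0 (HF J); case: (leqP #|J| 2) => [le2|gt2] H.
  have [J1|J2] := leqP #|J| 1.
    have /cards1P [j Ej] : #|J| == 1%N by rewrite eqn_leq J1 card_gt0.
    suff -> : nd_solutions J = set0 by rewrite cards0.
    apply/setP => f; rewrite !inE; apply/negP => /andP [/andP [_ /eqP]].
    by rewrite Ej big_set1 => /eqP; rewrite mulf_eq0 (negPf (c0 _)) (negPf (val_neq0 _)).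
  have -> : #|J| = 2%N by apply/eqP; rewrite eqn_leq le2.
  by rewrite leq_exp2r //; apply: leq_trans H _; rewrite leq_mul2r W0 orbT.
apply: (@leq_trans ((W * size A) ^ 3)); last by rewrite leq_pexp2l // muln_gt0 W0.
apply: (@leq_trans ((Fb * size A) ^ 2)); first by rewrite leq_exp2r.
rewrite expnMn; apply: leq_trans (leq_mul HW (leqnn _)) _.
rewrite [((W * _) ^ 3)%N]expnS leq_mul2l; apply/orP; right; rewrite leq_exp2r //.
by rewrite leq_pmull.
Qed.

Lemma restrict_split (J : {set I}) f : f \in solutions J -> J != set0 ->
  exists J' : {set I}, [/\ J' \subset J, J' != set0, restrict J' f \in nd_solutions J' &
    restrict (J :\: J') f \in solutions (J :\: J')].
Proof.
rewrite inE => /andP [/forallP fJ /eqP fs] J0.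
pose P (J' : {set I}) := [&& J' \subset J, J' != set0 & \sum_(i in J') c i * val (f i) == 0].
have [|J1 /minsetP [/and3P [sJ1 J1n /eqP J1s] J1min] _] := @minset_exists _ P J.
  by rewrite /P subxx J0 fs eqxx.
have restrE (K K' : {set I}) : K' \subset K ->
    \sum_(i in K') c i * val (restrict K f i) = \sum_(i in K') c i * val (f i).
  by move=> sK; apply: eq_bigr => i iK; rewrite ffunE (subsetP sK).
have restr0 (K : {set I}) : [forall i in ~: K, restrict K f i == t0].
  by apply/forallP => i; apply/implyP; rewrite inE ffunE => /negPf ->.
exists J1; split=> //.
  rewrite !inE restr0 /= restrE // J1s eqxx /=; apply/forallP => J'; apply/implyP => /and3P [sJ' J'n J'J].
  rewrite restrE //; apply: contra J'J => J's; apply/eqP; apply: J1min => //.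
  by rewrite /P J's J'n (subset_trans sJ').
rewrite inE restr0 /= restrE //; apply/eqP.
by move: fs; rewrite (big_setID J1) /= (setIidPr sJ1) J1s add0r.
Qed.

(** A solution splits off a minimal vanishing subsum, which is nondegenerate; what remains is a
    solution on fewer indices. Each step chooses among at most [2^k] supports, whence [4^k] after
    squaring. *)
Lemma solutions_sq (J : {set I}) : (#|solutions J| ^ 2 <= (4 ^ k * (W * size A)) ^ #|J|)%N.
Proof.
have [s] := ubnP #|J|; elim: s J => // s IH J /ltnSE le_s.
have a0 := size_A_gt0.
have [->|J0] := eqVneq J set0.
  rewrite cards0 expn0; suff : (#|solutions set0| <= 1)%N by case: #|_| => [|[]].
  apply/card_le1_eqP => f f'; rewrite !inE => /andP [/forallP fJ _] /andP [/forallP fJ' _].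
  apply/ffunP => i; have := fJ i; have := fJ' i.
  by rewrite !inE /= => /eqP -> /eqP ->.
pose P (J' : {set I}) := (J' \subset J) && (J' != set0).
have le1 : (#|solutions J| <= \sum_(J' | P J') #|nd_solutions J'| * #|solutions (J :\: J')|)%N.
  pose g (x : {set I} * ({ffun I -> T} * {ffun I -> T})) : {ffun I -> T} :=
    [ffun i => if i \in x.1 then x.2.1 i else x.2.2 i].
  pose X := [set x : {set I} * ({ffun I -> T} * {ffun I -> T}) |
    [&& P x.1, x.2.1 \in nd_solutions x.1 & x.2.2 \in solutions (J :\: x.1)]].
  apply: (@leq_trans #|X|).
    apply: leq_trans (leq_imset_card g X); apply: subset_leq_card; apply/subsetP => f fS.
    have [J' [sJ' J'n H1 H2]] := restrict_split fS J0.
    apply/imsetP; exists (J', (restrict J' f, restrict (J :\: J') f)); first by rewrite inE /P /= sJ' J'n H1.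
    apply/ffunP => i; rewrite !ffunE /=; case: (boolP (i \in J')) => // iJ'.
    rewrite in_setD iJ' /=; case: ifP => // iJ.
    by move: fS; rewrite inE => /andP [/forallP /(_ i)]; rewrite inE iJ /= => /eqP.
  rewrite -sum1dep_card (eq_bigr (fun x => 1%N)) //.
  rewrite -(pair_big_dep P (fun J' y => (y.1 \in nd_solutions J') && (y.2 \in solutions (J :\: J')))
    (fun _ _ => 1%N)) /=.
  apply: leq_sum => J' _; rewrite sum1dep_card -cardsX.
  by apply: eq_leq; apply: eq_card => y; rewrite !inE.
apply: (@leq_trans ((\sum_(J' | P J') #|nd_solutions J'| * #|solutions (J :\: J')|) ^ 2)).
  by rewrite leq_exp2r.
apply: leq_trans (sum_sq_bound (M := ((4 ^ k) ^ #|J|.-1 * (W * size A) ^ #|J|)%N) _) _.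
  move=> J' /andP [sJ' J'n]; rewrite expnMn.
  have cJ : #|J| = (#|J'| + #|J :\: J'|)%N by rewrite -(cardsID J' J) (setIidPr sJ').
  have J'0 : (0 < #|J'|)%N by rewrite card_gt0.
  apply: leq_trans (leq_mul (nd_solutions_sq J'n) (IH (J :\: J') _)) _.
    by apply: leq_trans le_s; rewrite cJ -add1n leq_add2r.
  rewrite [((4 ^ k * _) ^ _)%N]expnMn mulnCA cJ [((W * size A) ^ (_ + _))%N]expnD.
  rewrite leq_mul2r; apply/orP; right; rewrite leq_pexp2l ?expn_gt0 //.
  by move: J'0; case: #|J'| => // x _; rewrite addSn /= leq_addl.
rewrite -cardsT -powersetT card_powerset cardsT card_ord.
have -> : ((2 ^ k) ^ 2 = 4 ^ k)%N by rewrite -expnM mulnC expnM.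
by rewrite mulnA -expnS prednK ?card_gt0 // -expnMn.
Qed.
End Energy.

Section SumsetCount.
Variables (R : realType) (F : fieldType) (h : seq F -> R) (Hh : is_height h).
Variables (A : seq F) (r : nat) (g : 'I_r -> F) (d : nat) (S : seq nat).
Hypothesis uA : uniq A.
Hypothesis A0 : 0 \notin A.
Hypothesis g0 : forall i, g i != 0.
Hypothesis d0 : (0 < d)%N.
Hypothesis Arank : {in A &, forall a b, rank_in g d (a / b)}.
Hypothesis Ascale : forall a b a' b', a \in A -> b \in A -> a' \in A -> b' \in A ->
  1 <= hN h ((a / b) / (a' / b')) ->
  exists2 j, j \in S & 2 ^+ j <= hN h ((a / b) / (a' / b')) < 2 ^+ j.+1.

(** Pairs of [m]-tuples with equal sums are the solutions of an equation in [m + m] variables with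
    coefficients 1 and -1. Their number is at most [(16^m W |A|)^m], and Cauchy-Schwarz compares it
    with [|A|^(2 m) / |V|]. *)
Lemma sumset_count (m E W : nat) (V : seq F) : (0 < size A)%N ->
    (2 ^ (m + m) * \max_(s < (m + m).+1) cover_bound s r (size S) <= E)%N -> (0 < E)%N ->
    ((E ^ 2 ^ (m + m)) ^ 2 <= W * size A)%N -> (0 < W)%N -> uniq V ->
    (forall f : {ffun 'I_m -> seq_sub A}, \sum_i val (f i) \in V) ->
  (size A ^ m <= size V * (16 ^ m * W) ^ m)%N.
Proof.
move=> a0 HE E0 HW W0 uV HV.
have t0 : seq_sub A by case: A a0 => // x s _; exists x; exact: mem_head.
pose T : finType := seq_sub A;
pose c : {ffun 'I_(m + m) -> F} := [ffun i : 'I_(m + m) => if (i < m)%N then 1 else -1].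
have c0 i : c i != 0 by rewrite ffunE; case: ifP; rewrite ?oppr_eq0 oner_eq0.
have HF (J : {set 'I_(m + m)}) : proj_covered (mem A) J c (if #|J| <= 2 then 1 else E ^ 2 ^ (m + m))%N.
  have [Zs [sZ HZ]] := proj_count Hh A0 g0 d0 Arank Ascale HE E0 (J := J) (fun i _ => c0 i).
  exists Zs; split=> //; apply: leq_trans sZ _; case: ifP => // _; rewrite leq_pexp2l //.
  apply: leq_trans (leq_pred _) _; rewrite leq_pexp2l //.
  by rewrite -[X in (_ <= X)%N](card_ord (m + m)) max_card.
have := solutions_sq uA A0 c0 t0 HF HW W0 setT; rewrite cardsT card_ord.
set Sol := solutions _ _ _ => HSol.
pose sg (f : {ffun 'I_m -> T}) : F := \sum_i val (f i).
pose rep (v : seq_sub V) := #|[set f : {ffun 'I_m -> T} | sg f == val v]|.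
have sum_rep : (\sum_v rep v = size A ^ m)%N.
  transitivity #|{: {ffun 'I_m -> T}}|; last by rewrite card_ffun card_ord /T (card_T uA).
  rewrite -sum1_card.
  rewrite (partition_big (fun f => SeqSub (HV f)) xpredT) //=.
  apply: eq_bigr => v _; rewrite sum1_card /rep; apply: eq_card => f.
  by rewrite !inE.
have sum_sq : (\sum_v rep v ^ 2 <= #|Sol|)%N.
  pose glue (p : {ffun 'I_m -> T} * {ffun 'I_m -> T}) : {ffun 'I_(m + m) -> T} :=
    [ffun i => match split i with inl j => p.1 j | inr j => p.2 j end].
  have glue_inj : injective glue.
    move=> [f1 f2] [f1' f2'] /ffunP E1; congr pair; apply/ffunP => i.
      by have := E1 (lshift m i); rewrite !ffunE (unsplitK (inl i : 'I_m + 'I_m)).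
    by have := E1 (rshift m i); rewrite !ffunE (unsplitK (inr i : 'I_m + 'I_m)).
  pose X := [set p : {ffun 'I_m -> T} * {ffun 'I_m -> T} | sg p.1 == sg p.2].
  apply: (@leq_trans #|X|).
    rewrite -sum1dep_card (partition_big (fun p => SeqSub (HV p.1)) xpredT) //=.
    apply: leq_sum => v _; rewrite sum1dep_card /rep -mulnn -cardsX.
    apply: subset_leq_card; apply/subsetP => -[f1 f2]; rewrite !inE /= => /andP [/eqP E1 /eqP E2].
    by rewrite E1 E2 eqxx -val_eqE /= -[\sum_i _]/(sg f1) E1 eqxx.
  rewrite -(card_imset _ glue_inj); apply: subset_leq_card; apply/subsetP => _ /imsetP [[f1 f2] + ->].
  rewrite inE /= => /eqP Ef; rewrite inE; apply/andP; split.
    by apply/forallP => i; rewrite !inE.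
  under eq_bigl do rewrite inE.
  rewrite big_split_ord /= ; apply/eqP.
  transitivity (sg f1 - sg f2); last by rewrite Ef subrr.
  rewrite /sg -sumrN; congr (_ + _); apply: eq_bigr => i _; rewrite !ffunE.
    by rewrite (unsplitK (inl i : 'I_m + 'I_m)) /= ltn_ord mul1r.
  by rewrite (unsplitK (inr i : 'I_m + 'I_m)) /= ltnNge leq_addr /= mulN1r.
have CS := cauchy_schwarz_nat rep; rewrite sum_rep card_seq_sub // in CS.
have SolLe : (#|Sol| <= (4 ^ (m + m) * (W * size A)) ^ m)%N.
  move: HSol; set X := (4 ^ _ * _)%N.
  have -> : (X ^ (m + m) = (X ^ m) ^ 2)%N by rewrite -expnM muln2 addnn.
  by rewrite leq_exp2r.
have := leq_trans CS (leq_mul (leqnn (size V)) (leq_trans sum_sq SolLe)).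
have -> : (4 ^ (m + m) = 16 ^ m)%N by rewrite addnn -mul2n expnM.
rewrite [(16 ^ m * (W * _))%N]mulnA [((16 ^ m * W * size A) ^ m)%N]expnMn mulnA expnS expn1.
by rewrite leq_pmul2r // expn_gt0 a0.
Qed.
End SumsetCount.

(** * Growth of products *)

Section Products.
Local Open Scope fset_scope.
Variable F : fieldType.
Implicit Types A B C X Y Z U V W : {fset F}.

Definition pmul A B : {fset F} := [fset (a * b)%R | a in A, b in B].
Definition pinv A : {fset F} := [fset (a^-1)%R | a in A].

Lemma pmulP A B x : reflect (exists a b, [/\ a \in A, b \in B & x = a * b]) (x \in pmul A B).
Proof.
apply: (iffP (imfset2P _ _ _ _ _)) => [[a aA [b bB ->]]|[a [b [aA bB ->]]]]; first by exists a, b.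
by exists a => //; exists b.
Qed.

Lemma mem_pmul A B a b : a \in A -> b \in B -> a * b \in pmul A B.
Proof. by move=> aA bB; apply/pmulP; exists a, b. Qed.

Lemma mem_neq0 A x : 0 \notin A -> x \in A -> x != 0.
Proof. exact: seq_neq0. Qed.

Lemma mem_pinv A x : (x \in pinv A) = (x^-1 \in A).
Proof.
apply/imfsetP/idP => [[a aA ->]|xA]; first by rewrite invrK.
by exists x^-1; rewrite ?invrK.
Qed.

Lemma pmulC A B : pmul A B = pmul B A.
Proof. by apply/fsetP => x; apply/pmulP/pmulP => -[a [b [? ? ->]]]; exists b, a; rewrite mulrC. Qed.

Lemma pmulA A B C : pmul A (pmul B C) = pmul (pmul A B) C.
Proof.
apply/fsetP => x; apply/pmulP/pmulP.
  by move=> [a [_ [aA /pmulP [b [c [bB cC ->]]] ->]]]; exists (a * b), c; rewrite mem_pmul ?mulrA.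
by move=> [_ [c [/pmulP [a [b [aA bB ->]]] cC ->]]]; exists a, (b * c); rewrite mem_pmul ?mulrA.
Qed.

Lemma pmulS A B A' B' : A `<=` A' -> B `<=` B' -> pmul A B `<=` pmul A' B'.
Proof.
move=> /fsubsetP sA /fsubsetP sB; apply/fsubsetP => x /pmulP [a [b [aA bB ->]]].
by rewrite mem_pmul ?sA ?sB.
Qed.

Lemma pmul_neq0 A B : 0 \notin A -> 0 \notin B -> 0 \notin pmul A B.
Proof.
move=> A0 B0; apply/negP => /pmulP [a [b [aA bB /esym/eqP]]]; apply/negP; rewrite mulf_neq0 //.
  exact: mem_neq0 A0 aA.
exact: mem_neq0 B0 bB.
Qed.

Lemma pinv_neq0 A : 0 \notin A -> 0 \notin pinv A.
Proof. by rewrite mem_pinv invr0. Qed.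

Lemma card_pmul1 c A : c != 0 -> #|` pmul [fset c] A| = #|` A|.
Proof.
move=> c0; have -> : pmul [fset c] A = [fset c * a | a in A].
  apply/fsetP => x; apply/pmulP/imfsetP => /=.
    by move=> [c' [a [/fset1P -> aA ->]]]; exists a.
  by move=> [a aA ->]; exists c, a; rewrite inE eqxx.
by rewrite card_imfset //; apply: mulfI.
Qed.

Lemma pmulUl A B C : pmul (A `|` B) C = pmul A C `|` pmul B C.
Proof.
apply/fsetP => x; rewrite in_fsetU; apply/pmulP/orP.
  move=> [a [c [/fsetUP [aA|aB] cC ->]]]; [left|right]; exact: mem_pmul.
by move=> [] /pmulP [a [c [aA cC ->]]]; exists a, c; rewrite in_fsetU aA ?orbT.
Qed.

(* Petridis: for [X] minimising the growth under multiplication by [B], that growth is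
   inherited by every [X C]. *)
Lemma petridis X B (C : seq F) : 0 \notin X -> 0 \notin B -> 0 \notin C ->
    (forall Z, Z `<=` X -> (#|` pmul X B| * #|` Z| <= #|` pmul Z B| * #|` X|)%N) ->
  (#|` pmul (pmul X B) [fset c in C]| * #|` X| <= #|` pmul X B| * #|` pmul X [fset c in C]|)%N.
Proof.
move=> X0 B0 + Hmin; elim: C => [|c C IH] C0.
  have E0 Y : pmul Y [fset c in [::]] = fset0.
    by apply/fsetP => x; rewrite inE; apply/pmulP => -[a [b [_]]]; rewrite !inE.
  by rewrite !E0 cardfs0.
move: C0; rewrite inE negb_or eq_sym => /andP [c0 /IH {}IH].
have EC Y : pmul Y [fset x in c :: C] = pmul [fset c] Y `|` pmul Y [fset x in C].
  rewrite [pmul [fset c] Y]pmulC !(pmulC Y) -pmulUl; congr pmul.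
  by apply/fsetP => x; rewrite !inE.
set XBC := pmul (pmul X B) [fset x in C] in IH; set XC := pmul X [fset x in C] in IH.
(* These [x] bring nothing new with [c B]. Discarding [c Z B] bounds the growth of [X B C] from
   above, and [c (X \ Z)], being disjoint from [X C], bounds that of [X C] from below; minimality
   applied to [Z] compares the two. *)
pose Z := [fset x in X | pmul [fset c] (pmul [fset x] B) `<=` XBC].
have sZ : Z `<=` X by apply/fsubsetP => x; rewrite !inE => /andP [].
have H1 : (#|` pmul (pmul X B) [fset x in c :: C]| + #|` pmul Z B| <= #|` XBC| + #|` pmul X B|)%N.
  rewrite EC -/XBC.
  have sZB : pmul [fset c] (pmul Z B) `<=` XBC.
    apply/fsubsetP => _ /pmulP [c' [_ [/fset1P -> /pmulP [z [b [zZ bB ->]]] ->]]].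
    move: zZ; rewrite !inE => /andP [_ /fsubsetP]; apply.
    by rewrite mem_pmul ?mem_pmul ?inE.
  have E : pmul [fset c] (pmul X B) `|` XBC =
      pmul [fset c] (pmul X B `\` pmul Z B) `|` XBC.
    apply/eqP; rewrite eqEfsubset; apply/andP; split; last first.
      by apply: fsetSU; apply: pmulS => //; apply: fsubsetDl.
    rewrite fsubUset fsubsetUr andbT; apply/fsubsetP => _ /pmulP [c' [x [/fset1P -> xXB ->]]].
    rewrite in_fsetU; have [xZB|xZB] := boolP (x \in pmul Z B).
      by rewrite (fsubsetP sZB) ?orbT // mem_pmul ?inE.
    by rewrite mem_pmul ?inE // xZB xXB.
  rewrite E; apply: leq_trans (leq_add (leq_card_fsetU _ _) (leqnn _)) _.
  rewrite card_pmul1 // cardfsDS; last exact: pmulS sZ (fsubset_refl B).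
  have := fsubset_leq_card (pmulS sZ (fsubset_refl B)); lia.
have H2 : (#|` XC| + #|` X| <= #|` pmul X [fset x in c :: C]| + #|` Z|)%N.
  rewrite EC -/XC.
  have dis : [disjoint pmul [fset c] (X `\` Z) & XC]%fset.
    apply/fdisjointP => _ /pmulP [c' [x [/fset1P -> xXZ ->]]].
    move: xXZ; rewrite in_fsetD => /andP [xZ xX]; apply: contra xZ => cx.
    rewrite !inE xX /=; apply/fsubsetP => _ /pmulP [c'' [_ [/fset1P -> /pmulP [x' [b [/fset1P -> bB ->]]] ->]]].
    move/pmulP: cx => [x'' [d [xX' dC E]]]; rewrite mulrA E.
    by rewrite -mulrA [d * b]mulrC mulrA; apply: mem_pmul => //; apply: mem_pmul.
  have : (#|` pmul [fset c] (X `\` Z) `|` XC| <= #|` pmul [fset c] X `|` XC|)%N.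
    by apply: fsubset_leq_card; apply: fsetSU; apply: pmulS => //; apply: fsubsetDl.
  have [_ E2] := leq_card_fsetU (pmul [fset c] (X `\` Z)) XC.
  rewrite dis in E2; rewrite (eqP E2).
  rewrite card_pmul1 // cardfsDS //; have := fsubset_leq_card sZ; lia.
have H3 := Hmin Z sZ.
rewrite -(leq_add2r (#|` pmul Z B| * #|` X|)) -mulnDl.
apply: leq_trans (leq_mul H1 (leqnn _)) _; rewrite mulnDl.
apply: leq_trans (leq_add IH (leqnn _)) _; rewrite -mulnDr.
apply: leq_trans (leq_mul (leqnn _) H2) _; rewrite mulnDr.
by rewrite leq_add2l.
Qed.

(** With a representation [d = u / v] fixed for each [d], the map sending [(d, w)] to [(u w, v w)]
    is injective, since the ratio of the two values recovers [d]. *)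
Lemma ruzsa_triangle U V W : 0 \notin U -> 0 \notin V -> 0 \notin W ->
  (#|` pmul U (pinv V)| * #|` W| <= #|` pmul U W| * #|` pmul V W|)%N.
Proof.
move=> U0 V0 W0.
have /choice [u Hu] : forall d, exists u, d \in pmul U (pinv V) -> u \in U /\ u / d \in V.
  move=> d; case: (boolP (d \in pmul U (pinv V))) => [/pmulP [u [v [uU vV ->]]]|_]; last by exists 0.
  exists u => _; split=> //; rewrite mem_pinv in vV.
  have v0 : v != 0 by have := mem_neq0 V0 vV; rewrite invr_eq0.
  by rewrite invfM mulrA divff ?(mem_neq0 U0 uU) // mul1r.
pose f (p : F * F) := (u p.1 * p.2, u p.1 / p.1 * p.2).
pose D := [seq (d, w) | d <- pmul U (pinv V), w <- W].
have uD : uniq D by rewrite allpairs_uniq ?fset_uniq // => -[a b] [a' b'].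
have -> : (#|` pmul U (pinv V)| * #|` W| = size (map f D))%N by rewrite size_map size_allpairs.
have -> : (#|` pmul U W| * #|` pmul V W| = size [seq (x, y) | x <- pmul U W, y <- pmul V W])%N.
  by rewrite size_allpairs.
have UV0 : 0 \notin pmul U (pinv V) by rewrite pmul_neq0 // pinv_neq0.
apply: uniq_leq_size.
  rewrite map_inj_in_uniq // => -[d w] [d' w'] /allpairsP [[a b] [/= aD bW [-> ->]]].
  move=> /allpairsP [[a' b'] [/= aD' bW' [-> ->]]] [E1 E2].
  have [uU uV] := Hu a aD; have [uU' uV'] := Hu a' aD'.
  have Ea : a = a'.
    have := congr2 (fun x y => x / y) E1 E2 => /=.
    have H (x y z : F) : x != 0 -> y != 0 -> z != 0 -> x * y / (x / z * y) = z.
      by move=> x0 y0 z0; field; rewrite ?x0 ?y0 ?z0.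
    by rewrite !H // ?(mem_neq0 U0 uU) ?(mem_neq0 U0 uU') ?(mem_neq0 W0 bW)
      ?(mem_neq0 W0 bW') ?(mem_neq0 UV0 aD) ?(mem_neq0 UV0 aD').
  by rewrite -Ea in E1 *; move/(mulfI (mem_neq0 U0 uU)): E1 => ->.
move=> _ /mapP [[d w] /allpairsP [[a b] [/= aD bW [-> ->]]] ->].
have [uU uV] := Hu a aD.
by apply/allpairsP; exists (u a * b, u a / a * b); rewrite /= !mem_pmul.
Qed.

(** [Y] is built greedily with disjoint translates [y X]; when [c X] meets some [y X], the element
    [c] lies in [y X / X]. *)
Lemma ruzsa_covering C X : 0 \notin C -> 0 \notin X -> X != fset0 ->
  exists Y : {fset F}, [/\ Y `<=` C, (#|` Y| * #|` X| <= #|` pmul C X|)%N &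
    C `<=` pmul Y (pmul X (pinv X))].
Proof.
move=> C0 X0 /fset0Pn [x0 x0X].
suff H (s : seq F) : {subset s <= C} -> exists Y : {fset F},
    [/\ Y `<=` C, (#|` Y| * #|` X| <= #|` pmul Y X|)%N & {subset s <= pmul Y (pmul X (pinv X))}].
  have [Y [YC HY HC]] := H C (fun x xC => xC); exists Y; split=> //; last exact/fsubsetP.
  by apply: leq_trans HY _; apply: fsubset_leq_card; apply: pmulS.
elim: s => [|c s IH] sC.
  by exists fset0; split; rewrite ?fsub0set ?cardfs0.
have [x xs|Y [YC HY HC]] := IH; first by apply: sC; rewrite inE xs orbT.
have cC : c \in C by apply: sC; exact: mem_head.
have [cov|ncov] := boolP (c \in pmul Y (pmul X (pinv X))).
  by exists Y; split=> // x; rewrite inE => /orP [/eqP -> //|/HC].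
have sub : pmul Y (pmul X (pinv X)) `<=` pmul (c |` Y) (pmul X (pinv X)).
  by apply: pmulS => //; apply: fsubsetUr.
exists (c |` Y); split.
- by rewrite fsubUset YC andbT fsub1set.
- have cY : c \notin Y.
    apply: contra ncov => cY; rewrite -[c]mulr1 mem_pmul // -(divff (mem_neq0 X0 x0X)) mem_pmul //.
    by rewrite mem_pinv invrK.
  have dis : [disjoint pmul [fset c] X & pmul Y X].
    apply/fdisjointP => _ /pmulP [c' [x [/fset1P -> xX ->]]]; apply: contra ncov.
    move=> /pmulP [y [x' [yY xX' E]]].
    have -> : c = y * (x' / x) by rewrite mulrA -E mulfK // (mem_neq0 X0 xX).
    by rewrite !mem_pmul // mem_pinv invrK.
  rewrite cardfsU1 cY mulnDl mul1n pmulUl.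
  have [_ E2] := leq_card_fsetU (pmul [fset c] X) (pmul Y X).
  rewrite dis in E2; rewrite (eqP E2) card_pmul1 ?(mem_neq0 C0 cC) //.
  by rewrite leq_add2l.
- move=> x; rewrite inE => /orP [/eqP ->|/HC]; last exact: (fsubsetP sub).
  have one : 1 \in pmul X (pinv X).
    by rewrite -(divff (mem_neq0 X0 x0X)) mem_pmul // mem_pinv invrK.
  by have := mem_pmul (fset1U1 c Y) one; rewrite mulr1.
Qed.

(** Let [X] minimise [|X A| / |X|] and [D = X / X]. Covering puts [A D] inside [Y D]; the triangle
    inequality reduces [A D X] to [A X X X] and [X X], of sizes at most [alpha^3 |X|] and
    [alpha |X|], so [|Y| <= alpha^4]. A product of [n] elements of [A] is then a monomial in [Y]
    times an element of [D], and the exponents range over at most [n + 1] values. *)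
Lemma quotient_growth (R : realType) A (alpha : R) : 0 \notin A -> A != fset0 ->
    #|` pmul A A|%:R <= alpha * #|` A|%:R ->
  exists y : nat, y%:R <= alpha ^+ 4 /\
    forall n (V : seq F), uniq V ->
    (forall x, x \in V -> exists s t : seq F, [/\ {subset s <= A}, {subset t <= A},
       (size s <= n)%N, (size t <= n)%N & x = (\prod_(a <- s) a) / \prod_(a <- t) a]) ->
    (size V <= n.+1 ^ (2 * y) * #|` A| ^ 2)%N.
Proof.
move=> A0 An HA.
have ca (X : {fset F}) : X != fset0 -> 0 < (#|` X|%:R : R) by move=> X0; rewrite ltr0n cardfs_gt0.
have memA : A \in [seq X <- fpowerset A | X != fset0] by rewrite mem_filter An fpowersetE fsubset_refl.
have [X] := ex_min_seq (fun X : {fset F} => #|` pmul X A|%:R / #|` X|%:R : R) memA.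
rewrite mem_filter fpowersetE => /andP [Xn sX] Xmin.
have X0 : 0 \notin X by apply: contra A0; apply: (fsubsetP sX).
have Hmin Z : Z `<=` X -> (#|` pmul X A| * #|` Z| <= #|` pmul Z A| * #|` X|)%N.
  move=> sZ; have [->|Zn] := eqVneq Z fset0; first by rewrite cardfs0 muln0.
  have := Xmin Z; rewrite mem_filter Zn fpowersetE (fsubset_trans sZ sX) => /(_ isT).
  rewrite ler_pdivrMr ?ca // mulrAC ler_pdivlMr ?ca // -!natrM ler_nat.
  by [].
have alpha0 : 0 <= alpha.
  by have := le_trans (ler0n _ _) HA; rewrite pmulr_lge0 // ca.
have XA : #|` pmul X A|%:R <= alpha * #|` X|%:R.
  have := Xmin A; rewrite mem_filter An fpowersetE fsubset_refl => /(_ isT) H.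
  rewrite -ler_pdivrMr ?ca //; apply: le_trans H _.
  by rewrite ler_pdivrMr ?ca.
have pet C : 0 \notin C -> #|` pmul (pmul X A) C|%:R <= alpha * #|` pmul X C|%:R.
  move=> C0; have EC (Y : {fset F}) : Y =i C -> Y = C by move=> ?; apply/fsetP.
  have := petridis X0 A0 C0 Hmin; rewrite [Imfset.imfset _ _ _]EC => [H|x]; last by rewrite !inE.
  rewrite -(ler_pM2r (ca X Xn)); apply: (@le_trans _ _ (#|` pmul X A|%:R * #|` pmul X C|%:R)).
    by rewrite -!natrM ler_nat.
  by rewrite mulrAC ler_wpM2r.
have X2 : #|` pmul X X|%:R <= alpha * #|` X|%:R.
  by apply: le_trans XA; rewrite ler_nat fsubset_leq_card // pmulS.
have AA0 := pmul_neq0 A0 A0.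
have X4 : #|` pmul (pmul A (pmul X X)) X|%:R <= alpha ^+ 3 * #|` X|%:R.
  apply: (@le_trans _ _ (#|` pmul (pmul X A) (pmul A A)|%:R)).
    rewrite ler_nat fsubset_leq_card // [pmul (pmul X A) _]pmulC.
    by rewrite -[pmul (pmul A _) X]pmulA [pmul (pmul X X) X]pmulC -[pmul (pmul A A) _]pmulA;
      apply: pmulS => //; rewrite pmulC [pmul X A]pmulC pmulA; apply: pmulS => //; apply: pmulS.
  apply: le_trans (pet _ AA0) _; rewrite exprS -mulrA ler_wpM2l // pmulA.
  by apply: le_trans (pet _ A0) _; rewrite exprS -mulrA ler_wpM2l.
pose D := pmul X (pinv X).
have D0 : 0 \notin D by rewrite pmul_neq0 // pinv_neq0.
have XX0 := pmul_neq0 X0 X0.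
have Dinv x : x \in D -> x^-1 \in D.
  move=> /pmulP [a [b [aX bX ->]]]; rewrite invfM mulrC.
  by apply: mem_pmul; [rewrite -mem_pinv | rewrite mem_pinv invrK].
have [Y [YC HY cov]] := ruzsa_covering (pmul_neq0 A0 D0) X0 Xn.
have Y0 : 0 \notin Y by apply: contra (pmul_neq0 A0 D0); apply: (fsubsetP YC).
exists #|` Y|; split.
  rewrite -(ler_pM2r (ca X Xn)).
  apply: (@le_trans _ _ (#|` pmul (pmul A D) X|%:R)); first by rewrite -natrM ler_nat.
  rewrite -(ler_pM2r (ca X Xn)) -natrM.
  apply: (@le_trans _ _ (#|` pmul (pmul A (pmul X X)) X|%:R * #|` pmul X X|%:R)).
    rewrite -natrM ler_nat.
    have := ruzsa_triangle (pmul_neq0 A0 XX0) X0 X0.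
    suff -> : pmul (pmul A (pmul X X)) (pinv X) = pmul (pmul A D) X by [].
    by rewrite /D -!pmulA; congr (pmul A); congr (pmul X); rewrite pmulC.
  apply: (@le_trans _ _ ((alpha ^+ 3 * #|` X|%:R) * (alpha * #|` X|%:R))).
    by apply: ler_pM.
  by rewrite (_ : alpha ^+ 3 * #|` X|%:R * (alpha * #|` X|%:R) = alpha ^+ 4 * #|` X|%:R * #|` X|%:R) //; ring.
move=> n V uV HV.
have [x0 x0X] := fset0Pn _ Xn.
have D1 : 1 \in D by rewrite /D -(divff (mem_neq0 X0 x0X)) mem_pmul // mem_pinv invrK.
have prodY (s : seq F) : {subset s <= A} -> forall x, x \in D -> exists e : Y -> nat,
    (forall y, (e y <= size s)%N) /\
    exists2 x', x' \in D & (\prod_(a <- s) a) * x = (\prod_y val y ^+ e y) * x'.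
  elim: s => [|a s IH] sA x xD.
    exists (fun=> 0%N); split=> //; exists x => //; by rewrite big_nil big1.
  have [b bs|e [He [x' xD' E]]] := IH _ x xD; first by apply: sA; rewrite inE bs orbT.
  have aA : a \in A by apply: sA; exact: mem_head.
  have /(fsubsetP cov) /pmulP [y [x'' [yY xD'' E2]]] := mem_pmul aA xD'.
  pose y1 : Y := [` yY].
  exists (fun z => (e z + (z == y1))%N); split.
    by move=> z; rewrite /= -addn1 leq_add // leq_b1.
  exists x'' => //; rewrite big_cons -mulrA E mulrCA E2 mulrA; congr (_ * _).
  rewrite (bigD1 y1) //= [in RHS](bigD1 y1) //= eqxx addn1 exprSr -!mulrA; congr (_ * _).
  rewrite mulrC; congr (_ * _); apply: eq_bigr => z /negPf ->; by rewrite addn0.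
pose cand := [seq (\prod_y val y ^+ (p.1 y : nat)) / (\prod_y val y ^+ (p.2.1 y : nat)) * (val p.2.2.1 * val p.2.2.2)
  | p : {ffun Y -> 'I_n.+1} * ({ffun Y -> 'I_n.+1} * (X * pinv X))].
apply: (@leq_trans (size cand)).
  apply: uniq_leq_size => // v vV; have [s [t [sA tA sn tn ->]]] := HV _ vV.
  have [e [He [x xD Ex]]] := prodY s sA 1 D1.
  (* The second product is rewritten starting from [x^-1], so the [x] left by the first one cancels
     in the quotient. A single element of [D] remains, hence only [|A|^2]. *)
  have [f [Hf [z zD Ez]]] := prodY t tA x^-1 (Dinv _ xD).
  have x0' := mem_neq0 D0 xD; have z0 := mem_neq0 D0 zD.
  rewrite mulr1 in Ex.
  have -> : \prod_(a <- t) a = (\prod_y val y ^+ f y) * z * x.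
    by rewrite -Ez mulfVK.
  have /pmulP [a [b [aX bX Ezv]]] := Dinv _ zD.
  apply/mapP; exists ([ffun y => inord (e y)], ([ffun y => inord (f y)], ([` aX], [` bX]))).
    by rewrite mem_enum.
  rewrite /= -Ezv Ex.
  have -> : \prod_y val y ^+ (([ffun y : Y => inord (e y)] : {ffun Y -> 'I_n.+1}) y : nat) = \prod_y val y ^+ e y.
    by apply: eq_bigr => y _; rewrite ffunE inordK // ltnS (leq_trans (He y)).
  have -> : \prod_y val y ^+ (([ffun y : Y => inord (f y)] : {ffun Y -> 'I_n.+1}) y : nat) = \prod_y val y ^+ f y.
    by apply: eq_bigr => y _; rewrite ffunE inordK // ltnS (leq_trans (Hf y)).
  have : \prod_y val y ^+ f y != 0.
    by apply/prodf_neq0 => y _; rewrite expf_neq0 // (mem_neq0 Y0 (valP y)).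
  move: (\prod_y _ ^+ f y) (\prod_y _ ^+ e y) => p q p0.
  by field; rewrite x0' z0 p0.
rewrite size_map -cardE !card_prod !card_ffun card_ord -!cardfE mulnA -expnD addnn -mul2n.
rewrite leq_mul2l; apply/orP; right; rewrite -mulnn; apply: leq_mul.
  exact: fsubset_leq_card.
by rewrite /pinv card_imfset; [apply: fsubset_leq_card | apply: invr_inj].
Qed.
End Products.

(** * Dyadic scales of the heights of ratios *)

Lemma dyadic (R : realType) (x : R) : 1 <= x -> exists j, 2 ^+ j <= x < 2 ^+ j.+1.
Proof.
move=> x1; have E : exists n, x < 2 ^+ n.
  exists (Num.Def.archi_bound x); have x0 : 0 <= x by lra.
  by apply: (lt_le_trans (archi_boundP x0)); rewrite -natrX ler_nat ltnW // ltn_expl.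
case: (ex_minnP E) => -[|j] Hj Hmin; first by move: Hj; rewrite expr0; lra.
exists j; rewrite Hj andbT leNgt; apply/negP => /Hmin; by rewrite ltnn.
Qed.

Section Scales.
Variables (R : realType) (F : fieldType) (h : seq F -> R) (Hh : is_height h).
Local Notation N := (hN h).

Fixpoint subprods (us : seq F) : seq F :=
  if us is u :: us' then subprods us' ++ [seq u * x | x <- subprods us'] else [:: 1].

Lemma size_subprods us : size (subprods us) = (2 ^ size us)%N.
Proof. by elim: us => //= u us IH; rewrite size_cat size_map IH expnS mul2n addnn. Qed.

Lemma subprods_neq0 us : 0 \notin us -> 0 \notin subprods us.
Proof.
elim: us => [|u us IH] /=; first by rewrite inE eq_sym oner_eq0.
rewrite inE negb_or eq_sym => /andP [u0 /IH {}IH]; rewrite mem_cat negb_or IH.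
apply/mapP => -[x xs /esym/eqP]; rewrite mulf_eq0 (negPf u0) => /eqP E.
by rewrite -E xs in IH.
Qed.

Lemma subprods_ratio us : 0 \notin us ->
  {in subprods us &, forall x y, N (x / y) <= \sum_(u <- us) N u}.
Proof.
elim: us => [|u us IH] /= us0 x y.
  by rewrite !inE => /eqP -> /eqP ->; rewrite divr1 big_nil hN1.
move: us0; rewrite inE negb_or eq_sym big_cons => /andP [u0 us0].
have nz z : z \in subprods us -> z != 0.
  by apply: contraTneq => ->; exact: subprods_neq0.
have Nu := hN_ge0 Hh u0.
rewrite !mem_cat => /orP [xs|/mapP [x' xs ->]] /orP [ys|/mapP [y' ys ->]].
- by have := IH us0 x y xs ys; lra.
- have x0 := nz _ xs; have y0 := nz _ ys.
  rewrite invfM mulrCA; apply: le_trans (hNM Hh _ _) _; rewrite ?mulf_neq0 ?invr_eq0 //.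
  by rewrite (hNV Hh u0) lerD2l IH.
- have x0 := nz _ xs; have y0 := nz _ ys.
  rewrite -mulrA; apply: le_trans (hNM Hh _ _) _; rewrite ?mulf_neq0 ?invr_eq0 //.
  by rewrite lerD2l IH.
- by rewrite invfM mulrACA divff // mul1r; have := IH us0 x' y' xs ys; lra.
Qed.

(** A geometric series of ratio 1/4. The factor 3 closes the induction: a first scale [j <= k - 2]
    contributes less than [3 * 2^(j + 1)], the rest at most [2^(j + 1)], together at most
    [2^(k + 1)]. *)
Lemma sum_scales (u : nat -> F) js k : path (fun i j => j.+2 <= i)%N k js ->
    {in js, forall j, 2 ^+ j <= N (u j) < 2 ^+ j.+1} ->
  3 * \sum_(v <- map u js) N v <= 2 ^+ k.+1.
Proof.
elim: js k => [|j js IH] k /=; first by rewrite big_nil mulr0 exprn_ge0.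
move=> /andP [jk /IH {}IH] H; rewrite big_cons.
have [|_ H1] := andP (H j _); first exact: mem_head.
have {}IH := IH (fun i ijs => H i (@mem_behead _ (j :: js) i ijs)).
have : (2 : R) ^+ j.+3 <= 2 ^+ k.+1 by rewrite ler_eXn2l // ltr1n.
rewrite !exprS in H1 IH *; lra.
Qed.

(* The scales decrease by a factor of at least 4, so each element dominates the product of all the
   later ones. *)
Lemma subprods_uniq (u : nat -> F) js k : path (fun i j => j.+2 <= i)%N k js ->
    {in js, forall j, 2 ^+ j <= N (u j) < 2 ^+ j.+1} -> 0 \notin map u js ->
  uniq (subprods (map u js)).
Proof.
elim: js k => [|j js IH] k //= /andP [_ pj] H.
rewrite inE negb_or eq_sym => /andP [u0 js0].
have Hjs : {in js, forall j, 2 ^+ j <= N (u j) < 2 ^+ j.+1}.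
  by move=> i ijs; apply: H; exact: (@mem_behead _ (j :: js)).
have Ujs := IH _ pj Hjs js0.
rewrite cat_uniq Ujs map_inj_uniq ?Ujs ?andbT /=; last exact: mulfI.
apply/hasPn => _ /mapP [x xs ->]; apply/negP => ys.
have x0 : x != 0 by apply: contraTneq xs => ->; exact: subprods_neq0.
have := subprods_ratio js0 ys xs; rewrite mulfK //.
have := sum_scales pj Hjs; have /andP [+ _] := H j (mem_head _ _).
have : 0 < (2 : R) ^+ j by rewrite exprn_gt0.
rewrite exprS; lra.
Qed.

Local Open Scope fset_scope.

(** One ratio of ratios is chosen for each occurring scale. It has two factors in [A] above and two
    below, so subproducts of [q] of them are quotients of products of at most [2 q] elements. *)
Lemma scales_exist (A : {fset F}) (alpha : R) : 0 \notin A -> A != fset0 ->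
    #|` pmul A A|%:R <= alpha * #|` A|%:R ->
  exists (S : seq nat) (q y : nat), [/\ (size S <= 2 * q)%N, y%:R <= alpha ^+ 4,
    (2 ^ q <= (2 * q).+1 ^ (2 * y) * #|` A| ^ 2)%N &
    forall a b a' b', a \in A -> b \in A -> a' \in A -> b' \in A ->
      1 <= N ((a / b) / (a' / b')) ->
      exists2 j, j \in S & 2 ^+ j <= N ((a / b) / (a' / b')) < 2 ^+ j.+1].
Proof.
move=> A0 An HA.
have rearr (x y z w p q : F) : x * y * (z * w) * (p * q) = x * (w * p) * (y * (z * q)) by ring.
have [y [Hy grow]] := quotient_growth A0 An HA.
pose U := [seq (p.1.1 / p.1.2) / (p.2.1 / p.2.2) |
  p <- [seq (p, p') | p <- [seq (a, b) | a <- A, b <- A], p' <- [seq (a, b) | a <- A, b <- A]]].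
have UP x : x \in U -> exists a b a' b', [/\ a \in A, b \in A, a' \in A & b' \in A] /\
    x = (a / b) / (a' / b').
  case/mapP => _ /allpairsP [[_ _] [/allpairsP [[a b] /= [aA bA ->]]
    /allpairsP [[a' b'] /= [aA' bA' ->]] ->] ->].
  by exists a, b, a', b'.
have memU a b a' b' : a \in A -> b \in A -> a' \in A -> b' \in A -> (a / b) / (a' / b') \in U.
  move=> aA bA aA' bA'; apply/mapP; exists ((a, b), (a', b')) => //.
  by apply/allpairsP; exists ((a, b), (a', b')); split=> //; apply/allpairsP;
    [exists (a, b) | exists (a', b')].
have U0 x : x \in U -> x != 0.
  case/UP => a [b [a' [b' [[aA bA aA' bA'] ->]]]].
  by rewrite !(mulf_neq0, invr_eq0) // (mem_neq0 A0).
pose M := Num.Def.archi_bound (\sum_(x <- U) N x).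
have sum0 : 0 <= \sum_(x <- U) N x by rewrite big_seq sumr_ge0 // => x /U0; exact: hN_ge0.
have UM x j : x \in U -> 2 ^+ j <= N x -> (j < M)%N.
  move=> xU Hj; rewrite -(ltr_nat R); apply: lt_trans (archi_boundP sum0).
  apply: (@lt_le_trans _ _ (2 ^+ j)); first by rewrite -natrX ltr_nat ltn_expl.
  apply: le_trans Hj _; rewrite (big_rem x) //= lerDl big_seq sumr_ge0 // => z /mem_rem /U0.
  exact: hN_ge0.
pose P j := has (fun x => 2 ^+ j <= N x < 2 ^+ j.+1) U.
have /choice [w Hw] : forall j, exists x, P j -> x \in U /\ 2 ^+ j <= N x < 2 ^+ j.+1.
  move=> j; case: (boolP (P j)) => [/hasP [x xU Hx]|_]; last by exists 0.
  by exists x.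
(* Within one parity class distinct scales differ by at least 2, as [subprods_uniq] requires; [rev]
   lists them in decreasing order. The larger class has size [q], and both together at most
   [2 q]. *)
pose I (b : bool) := [seq i <- rev (iota 0 M) | P (i.*2 + b)%N].
have sI b : (2 ^ size (I b) <= (2 * size (I b)).+1 ^ (2 * y) * #|` A| ^ 2)%N.
  pose js := [seq (i.*2 + b)%N | i <- I b].
  have [k pj] : exists k, path (fun i j => j.+2 <= i)%N k js.
    have : sorted (fun i j => j.+2 <= i)%N js.
      rewrite sorted_map; apply: (@sub_sorted _ (fun i j => j < i)%N); first by move=> i j /=; lia.
      apply: sorted_filter; first by move=> i j l ? ?; lia.
      by rewrite rev_sorted; exact: iota_ltn_sorted.
    case: js => [|j js] H; first by exists 0%N.
    by exists j.+2; rewrite /= leqnn.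
  have Hjs : {in js, forall j, w j \in U /\ 2 ^+ j <= N (w j) < 2 ^+ j.+1}.
    by move=> _ /mapP [i + ->]; rewrite mem_filter => /andP [/Hw].
  have size_js : size js = size (I b) by rewrite size_map.
  have w0 : 0 \notin map w js.
    by apply/mapP => -[j /Hjs [/U0 /eqP + _] E]; apply; rewrite E.
  rewrite -size_js -[X in (2 ^ X)%N](size_map w) -size_subprods; apply: grow.
    by apply: subprods_uniq pj _ w0 => j /Hjs [].
  have wU v : v \in map w js -> v \in U by case/mapP => j /Hjs [? _] ->.
  elim: js wU {Hjs pj size_js w0} => [|j js IH] wU v /=.
    by rewrite inE => /eqP ->; exists [::], [::]; rewrite !big_nil divr1; split.
  have {}IH := IH (fun v vs => wU v (@mem_behead _ (w j :: _) v vs)).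
  rewrite mem_cat => /orP [/IH [s [t [sA tA ss st ->]]]|/mapP [v' /IH [s [t [sA tA ss st ->]]] ->]].
    by exists s, t; split=> //; rewrite mulnS addSn ltnW // ltnS ltnW // ltnS.
  have [a [b' [a' [b'' [[aA bA aA' bA'] ->]]]]] := UP _ (wU _ (mem_head _ _)).
  exists [:: a, b'' & s], [:: b', a' & t]; split.
  - by move=> z; rewrite !inE => /or3P [/eqP ->|/eqP ->|/sA].
  - by move=> z; rewrite !inE => /or3P [/eqP ->|/eqP ->|/tA].
  - by rewrite /= mulnS !addSn add0n !ltnS.
  - by rewrite /= mulnS !addSn add0n !ltnS.
  - rewrite !big_cons !invfM invrK.
    exact: rearr.
exists ([seq (i.*2 + true)%N | i <- I true] ++ [seq (i.*2 + false)%N | i <- I false]).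
exists (maxn (size (I true)) (size (I false))), y; split=> //.
- rewrite size_cat !size_map; lia.
- by rewrite /maxn; case: ifP.
move=> a b a' b' aA bA aA' bA' /dyadic [j Hj]; exists j => //.
have xU := memU a b a' b' aA bA aA' bA'.
have jM : (j < M)%N by apply: UM xU _; case/andP: Hj.
have Pj : P j by apply/hasP; exists ((a / b) / (a' / b')).
have E c : odd j = c -> (j./2 \in I c) /\ j = (j./2.*2 + c)%N.
  move=> <-; rewrite addnC odd_double_half mem_filter mem_rev mem_iota add0n addnC odd_double_half Pj.
  by rewrite (leq_ltn_trans _ jM) // -divn2 leq_div.
rewrite mem_cat; case oj: (odd j); have [jI Ej] := E _ oj; apply/orP; [left|right];
  by rewrite Ej; apply/mapP; exists j./2.
Qed.
End Scales.

(** * A large subset of small rank *)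

Section Torsion.
Variable F : fieldType.

Definition torsion (x : F) := exists2 n, (0 < n)%N & x ^+ n = 1.

Lemma torsion1 : torsion 1. Proof. by exists 1%N; rewrite ?expr1n. Qed.

Lemma torsion_neq0 x : torsion x -> x != 0.
Proof.
by case=> n n0; apply: contra_eq_neq => ->; rewrite expr0n gtn_eqF // eq_sym oner_neq0.
Qed.

Lemma torsionM x y : torsion x -> torsion y -> torsion (x * y).
Proof.
move=> [m m0 xm] [n n0 yn]; exists (m * n)%N; first by rewrite muln_gt0 m0.
by rewrite exprMn exprM xm expr1n mulnC exprM yn expr1n mulr1.
Qed.

Lemma torsionV x : torsion x -> torsion x^-1.
Proof. by move=> [m m0 xm]; exists m => //; rewrite exprVn xm invr1. Qed.

Lemma torsionX x n : torsion x -> torsion (x ^+ n).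
Proof. by move=> [m m0 xm]; exists m => //; rewrite exprAC xm expr1n. Qed.

Lemma torsionXz x (n : int) : torsion x -> torsion (x ^ n).
Proof. by case: n => n tx; [|apply: torsionV]; apply: torsionX. Qed.

Lemma torsion_root x n : (0 < n)%N -> torsion (x ^+ n) -> torsion x.
Proof. by move=> n0 [m m0 xm]; exists (n * m)%N; rewrite ?muln_gt0 ?n0 // exprM. Qed.

Lemma torsion_mulr x y : torsion y -> torsion (x * y) <-> torsion x.
Proof.
move=> ty; split=> [H|H]; last exact: torsionM.
by rewrite -[x](mulfK (torsion_neq0 ty)); apply: torsionM => //; apply: torsionV.
Qed.

Definition monom (a : nat -> F) n (e : nat -> int) := \prod_(i < n) a i ^ e i.
Definition weight (w : nat -> rat) n (e : nat -> int) : rat := \sum_(i < n) w i * (e i)%:~R.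

Lemma monom_lin a n (p q : int) e f : (forall i, a i != 0) ->
  monom a n (fun i => p * e i + q * f i) = monom a n e ^ p * monom a n f ^ q.
Proof.
move=> a0; rewrite /monom; elim: n => [|n IH]; first by rewrite !big_ord0 !exp1rz mulr1.
rewrite !big_ord_recr /= IH expfzDr // ![p * _]mulrC ![q * _]mulrC !expfzMl !exprz_exp; ring.
Qed.

Lemma weight_lin w n (p q : int) e f :
  weight w n (fun i => p * e i + q * f i) = p%:~R * weight w n e + q%:~R * weight w n f.
Proof.
rewrite /weight !mulr_sumr -big_split; apply: eq_bigr => i _.
rewrite /= intrD !intrM; ring.
Qed.

(* A multiplicative group generated by finitely many elements embeds modulo torsion into a
   rational vector space, on which a generic linear form separates any finite set from 0. *)
Lemma generic_weight (a : nat -> F) n M (E : nat -> nat -> int) : (forall i, a i != 0) ->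
  exists w, (forall e, torsion (monom a n e) -> weight w n e = 0) /\
    forall k, (k < M)%N -> weight w n (E k) = 0 -> torsion (monom a n (E k)).
Proof.
move=> a0; elim: n E => [|n IH] E.
  exists (fun=> 0); split=> [e _|k _ _]; first by rewrite /weight big_ord0.
  by rewrite /monom big_ord0; exact: torsion1.
have monomS e : monom a n.+1 e = monom a n e * a n ^ e n by rewrite /monom big_ord_recr.
pose ext (w : nat -> rat) T i : rat := if (i < n)%N then w i else T.
have weightS w T e : weight (ext w T) n.+1 e = weight w n e + T * (e n)%:~R.
  rewrite /weight big_ord_recr /= /ext ltnn; congr (_ + _).
  by apply: eq_bigr => i _; rewrite ltn_ord.
have [[m [f [m0 tf]]]|free] := pselect (exists m f, (0 < m)%N /\ torsion (a n ^+ m * monom a n f)).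
  (* Modulo torsion the relation trades [a n ^ m] for the earlier generators, and [red e] encodes
     the [m]-th power of the monomial without [a n]. *)
  pose red (e : nat -> int) i := m%:Z * e i + (- e n) * f i.
  have tor_red e : torsion (monom a n.+1 e) <-> torsion (monom a n (red e)).
    have -> : monom a n (red e) = monom a n.+1 e ^+ m * (a n ^+ m * monom a n f) ^ (- e n).
      rewrite monom_lin // monomS exprMn expfzMl !exprnP !exprz_exp.
      have -> : a n ^ (m%:Z * - e n) = (a n ^ (e n * m%:Z))^-1.
        by rewrite invr_expz mulrN mulrC.
      have : a n ^ (e n * m%:Z) != 0 by rewrite expfz_neq0.
      move: (a n ^ _) (_ ^ m%:Z) (_ ^ (- e n)) => x y z x0; by field.
    split=> [H|].
      by apply: torsionM; [apply: torsionX | apply: torsionXz].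
    by move/(torsion_mulr _ (torsionXz _ tf)) => /(torsion_root m0).
  have [w [w1 w2]] := IH (fun k => red (E k)).
  have wE e : m%:R * weight (ext w (- weight w n f / m%:R)) n.+1 e = weight w n (red e).
    rewrite weight_lin weightS intrN.
    have : m%:R != 0 :> rat by rewrite pnatr_eq0 -lt0n.
    by move=> mn; field.
  have mn0 : m%:R != 0 :> rat by rewrite pnatr_eq0 -lt0n.
  exists (ext w (- weight w n f / m%:R)); split=> [e /tor_red /w1|k kM w0].
    by rewrite -wE => /eqP; rewrite mulf_eq0 (negPf mn0) => /eqP.
  by apply/tor_red/w2 => //; rewrite -wE w0 mulr0.
have [w [w1 w2]] := IH E.
(* Here torsion monomials have exponent 0 at [a n], so its weight is free. Beyond all weights of the
   [E k], it cannot be cancelled when multiplied by a nonzero last exponent. *)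
pose T := 1 + \sum_(k < M) `|weight w n (E k)|.
exists (ext w T); split=> [e|k kM]; rewrite monomS weightS.
  move=> te; have e0 : e n = 0.
    apply/eqP; apply: contra_notT free => en.
    case: (e n) en te => [[|m]|m] // _ te.
      by exists m.+1, e; split=> //; rewrite mulrC.
    exists m.+1, (fun i => - 1 * e i + 0 * e i); split=> //.
    rewrite monom_lin // expr0z mulr1; have := torsionV te.
    by rewrite invfM invrK mulrC.
  by move: te; rewrite e0 expr0z mulr1 mulr0 addr0 => /w1.
have HT : `|weight w n (E k)| < T.
  rewrite /T (bigD1 (Ordinal kM)) //= addrA.
  have : 0 <= \sum_(i < M | i != Ordinal kM) `|weight w n (E i)| by apply: sumr_ge0.
  lra.
have [-> |en] := eqVneq (E k n) 0; first by rewrite mulr0 addr0 expr0z mulr1 => /w2; apply.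
move=> /eqP; rewrite addr_eq0 => /eqP Ew; move: HT; rewrite Ew normrN normrM.
have T0 : 0 <= T by rewrite addr_ge0 // sumr_ge0.
rewrite (ger0_norm T0) ltNge => /negP; case.
by rewrite ler_peMr // -intr_norm -[1]/(1%:~R) ler_int -gtz0_ge1 normr_gt0.
Qed.
End Torsion.

Section Rank.
Variable F : fieldType.

(** A generic weight for the exponent vectors of all [x y / (z t)] turns multiplicative relations
    modulo torsion into additive relations between rationals, which are ordered. *)
Lemma torsion_order (A : seq F) : 0 \notin A -> exists phi : F -> rat,
  forall x y z t, x \in A -> y \in A -> z \in A -> t \in A ->
    phi x + phi y = phi z + phi t <-> torsion (x * y / (z * t)).
Proof.
move=> A0; pose n := size A; pose a i := nth 1 A i.
have a0 i : a i != 0.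
  rewrite /a; have [iA|iA] := ltnP i n; last by rewrite nth_default // oner_neq0.
  by apply: contraNneq A0 => <-; exact: mem_nth.
pose e (i : nat) (j : nat) : int := (i == j)%:Z.
pose ee (p : 'I_n * 'I_n * ('I_n * 'I_n)) (j : nat) :=
  1 * (1 * e p.1.1 j + 1 * e p.1.2 j) + (- 1) * (1 * e p.2.1 j + 1 * e p.2.2 j).
pose s := enum {: 'I_n * 'I_n * ('I_n * 'I_n)}.
have monom_e (i : 'I_n) : monom a n (e i) = a i.
  rewrite /monom (bigD1 i) //= /e eqxx big1 ?mulr1 // => j ji.
  by rewrite eq_sym val_eqE (negPf ji).
have weight_e w (i : 'I_n) : weight w n (e i) = w i.
  rewrite /weight (bigD1 i) //= /e eqxx mulr1 big1 ?addr0 // => j ji.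
  by rewrite eq_sym val_eqE (negPf ji) mulr0.
have monom_ee p : monom a n (ee p) = a p.1.1 * a p.1.2 / (a p.2.1 * a p.2.2).
  by rewrite !monom_lin // !monom_e !expr1z exprN1.
have weight_ee w p : weight w n (ee p) = w p.1.1 + w p.1.2 - (w p.2.1 + w p.2.2).
  by rewrite !weight_lin !weight_e !mul1r intrN mulN1r.
have [n0|n0] := posnP n.
  by exists (fun=> 0) => x y z t; rewrite (size0nil n0).
pose i0 := Ordinal n0.
have [w [w1 w2]] := generic_weight n (size s) (fun k => ee (nth (i0, i0, (i0, i0)) s k)) a0.
exists (fun x => w (index x A)) => x y z t xA yA zA tA.
pose ix u (uA : u \in A) : 'I_n := Ordinal (etrans (index_mem u A) uA).
pose p := (ix x xA, ix y yA, (ix z zA, ix t tA)).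
have -> : x * y / (z * t) = monom a n (ee p) by rewrite monom_ee /= /a !nth_index.
split=> [H|/w1]; last by rewrite weight_ee => /eqP; rewrite subr_eq0 => /eqP.
have ps : p \in s by rewrite mem_enum.
have := w2 (index p s); rewrite index_mem nth_index //; apply=> //.
by rewrite weight_ee /= H subrr.
Qed.

Definition rank_tor r (g : 'I_r -> F) x := exists2 d, (0 < d)%N & rank_in g d x.

Lemma rank_in_dvd r (g : 'I_r -> F) d k x : rank_in g d x -> rank_in g (d * k) x.
Proof.
move=> [v Ev]; exists (fun i => v i * k%:Z); rewrite exprM Ev -prodrXl.
by apply: eq_bigr => i _; rewrite exprnP exprz_exp.
Qed.

Lemma rank_tor_torsion r (g : 'I_r -> F) x : torsion x -> rank_tor g x.
Proof.
by move=> [d d0 xd]; exists d => //; exists (fun=> 0); rewrite xd big1.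
Qed.

Lemma rank_torM r (g : 'I_r -> F) x y : (forall i, g i != 0) ->
  rank_tor g x -> rank_tor g y -> rank_tor g (x * y).
Proof.
move=> g0 [d d0 xd] [k k0 yk]; exists (d * k)%N; first by rewrite muln_gt0 d0.
by apply: rank_inM => //; [|rewrite mulnC]; apply: rank_in_dvd.
Qed.

Lemma rank_tor_gen r (g : 'I_r -> F) i : rank_tor g (g i).
Proof.
exists 1%N => //; exists (fun j => (j == i)%:Z); rewrite (bigD1 i) //= eqxx big1 ?mulr1 //.
by move=> j /negPf ->.
Qed.

Lemma rank_tor_common r (g : 'I_r -> F) (s : seq F) : {in s, forall x, rank_tor g x} ->
  exists2 d, (0 < d)%N & {in s, forall x, rank_in g d x}.
Proof.
elim: s => [|x s IH] H; first by exists 1%N.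
have [d d0 Hd] := IH (fun y ys => H y (@mem_behead _ (x :: s) y ys)).
have [k k0 xk] := H x (mem_head _ _).
exists (d * k)%N; first by rewrite muln_gt0 d0.
move=> y; rewrite inE => /orP [/eqP ->|/Hd]; last exact: rank_in_dvd.
by rewrite mulnC; apply: rank_in_dvd.
Qed.

Definition rank_le (S : seq F) r := exists (g : 'I_r -> F) d,
  [/\ forall i, g i != 0, (0 < d)%N & {in S &, forall x y, rank_in g d (x / y)}].

Lemma rank_le_gen (S bs : seq F) a r : (size bs <= r)%N -> 0 \notin bs -> a != 0 ->
    (forall r (g : 'I_r -> F), (forall i, g i != 0) -> {in bs, forall b, rank_tor g (b / a)} ->
     {in S, forall x, rank_tor g (x / a)}) ->
  rank_le S r.
Proof.
move=> sr b0 a0 H; pose g (i : 'I_r) := nth a bs i / a.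
(* The default [a] in [nth] pads the family with ones up to length [r]. *)
have g0 i : g i != 0.
  rewrite mulf_neq0 ?invr_eq0 //; have [ib|ib] := ltnP i (size bs); last by rewrite nth_default.
  by apply: contraNneq b0 => <-; exact: mem_nth.
have [d d0 Hd] : exists2 d, (0 < d)%N & {in [seq x / a | x <- S], forall x, rank_in g d x}.
  apply: rank_tor_common => _ /mapP [x xS ->]; apply: H xS => // b bb.
  have ib : (index b bs < r)%N by rewrite (leq_trans _ sr) // index_mem.
  by have := rank_tor_gen g (Ordinal ib); rewrite /g /= nth_index.
exists g, d; split=> // x y xS yS.
have -> : x / y = (x / a) * (y / a)^-1.
  by rewrite invfM invrK mulrACA mulVf // mulr1.
apply: rank_inM => //; last apply: rank_inV => //; apply: Hd; exact: map_f.
Qed.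

Local Open Scope fset_scope.
Local Open Scope ring_scope.

(* Remove the minimal fibre [Fa] of [phi]. Modulo torsion the quotients by its elements are
   generated by the atoms, the classes that are not sums of two others; the products of [Fa] with
   [Fa] and with each atom are distinct and avoid [S' S']. *)
Lemma rank_step (S : {fset F}) (phi : F -> rat) r : 0 \notin S -> S != fset0 ->
    (forall x y z t, x \in S -> y \in S -> z \in S -> t \in S ->
      phi x + phi y = phi z + phi t <-> torsion (x * y / (z * t))) ->
    ~ rank_le S r ->
  exists S' : {fset F}, [/\ S' `<=` S, (#|` S'| < #|` S|)%N &
    (#|` pmul S' S'| + r.+2 * (#|` S| - #|` S'|) <= #|` pmul S S|)%N].
Proof.
move=> S0 /fset0Pn [x0 x0S] Hphi nrank.
have nz := mem_neq0 S0.
have [a aS amin] : exists2 a, a \in S & {in S, forall y, phi a <= phi y}.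
  exact: (ex_min_seq phi x0S).
pose S' := [fset x in S | phi x != phi a].
pose Fa := [fset x in S | phi x == phi a].
have S'P x : x \in S' -> x \in S /\ phi a < phi x.
  by rewrite !inE /= => /andP [xS ne]; split=> //; rewrite lt_neqAle eq_sym ne amin.
have sS' : S' `<=` S by apply/fsubsetP => x /S'P [].
have cS : #|` S| = (#|` S'| + #|` Fa|)%N.
  have -> : Fa = S `\` S' by apply/fsetP => x; rewrite !inE /=; case: (x \in S) => //=; rewrite andbT negbK.
  by rewrite cardfsDS // subnKC // fsubset_leq_card.
have aF : a \in Fa by rewrite !inE /= aS eqxx.
pose atom b := all (fun x => all (fun y => phi b + phi a != phi x + phi y) S') S'.
pose vals := undup [seq phi b | b <- S' & atom b].
have /choice [rep Hrep] : forall v, exists b, v \in vals -> [/\ b \in S', atom b & phi b = v].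
  move=> v; case: (boolP (v \in vals)) => [|_]; last by exists 0.
  by rewrite mem_undup => /mapP [b]; rewrite mem_filter => /andP [ab bS] ->; exists b.
pose bs := [seq rep v | v <- vals].
have bsP b : b \in bs -> b \in S' /\ atom b.
  by case/mapP => v /Hrep [? ? _] ->.
have bs0 : 0 \notin bs by apply/negP => /bsP [/S'P [/nz /eqP]].
have phi_bs : [seq phi b | b <- bs] = vals.
  by rewrite -map_comp -[RHS]map_id; apply/eq_in_map => v /Hrep [].
have size_bs : (r < size bs)%N.
  rewrite ltnNge; apply/negP => sr; apply: nrank; apply: rank_le_gen sr bs0 (nz _ aS) _.
  move=> r' g g0 Hg.
  pose below x := [fset z in S | phi z < phi x].
  (* Induction on the number of elements below [x]. If [x] is not an atom, then up to torsion [x a]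
     is [y z] with [y] and [z] in [S']; both lie below [x], because [phi] exceeds [phi a] on
     [S']. *)
  suff H n x : x \in S -> (#|` below x| < n)%N -> rank_tor g (x / a).
    by move=> x xS; apply: H xS (ltnSn _).
  elim: n x => // n IH x xS sx.
  have smaller y : y \in S -> phi y < phi x -> (#|` below y| < n)%N.
    move=> yS yx; rewrite ltnS in sx; apply: leq_trans sx.
    apply: fproper_ltn_card; rewrite fproperE; apply/andP; split.
      by apply/fsubsetP => z; rewrite !inE /= => /andP [-> /lt_trans]; apply.
    by apply/fsubsetPn; exists y; rewrite !inE /= yS ?yx // ltxx.
  have [Exa|nxa] := eqVneq (phi x) (phi a).
    apply: rank_tor_torsion; have := (Hphi x a a a xS aS aS aS).1.
    by rewrite Exa -mulf_div divff ?nz // mulr1; apply.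
  have xS' : x \in S' by rewrite !inE /= xS.
  have [ax|] := boolP (atom x).
    have xv : phi x \in vals by rewrite mem_undup map_f // mem_filter ax.
    have [bS' _ Eb] := Hrep _ xv; have [bS _] := S'P _ bS'.
    have -> : x / a = (rep (phi x) / a) * (x * a / (rep (phi x) * a)).
      have := nz _ aS; have := nz _ bS; move=> *; by field; apply/andP.
    apply: rank_torM => //; first by apply: Hg; apply: map_f.
    by apply: rank_tor_torsion; apply/Hphi => //; rewrite Eb.
  move=> /allPn [y yS' /allPn [z zS']]; rewrite negbK => /eqP E.
  have [yS ya] := S'P _ yS'; have [zS za] := S'P _ zS'.
  have -> : x / a = (y / a) * (z / a) * (x * a / (y * z)).
    have := nz _ aS; have := nz _ yS; have := nz _ zS; move=> z0 y0 a0; by field; rewrite z0 y0 a0.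
  apply: rank_torM => //; last by apply: rank_tor_torsion; apply/Hphi.
  by apply: rank_torM => //; apply: IH => //; apply: smaller => //; move: E ya za; lra.
exists S'; split=> //.
  by rewrite cS -addn1 leq_add2l cardfs_gt0; apply/fset0Pn; exists a.
rewrite cS addKn.
have phi_inj : {in a :: bs &, injective phi}.
  have u : uniq (map phi (a :: bs)).
    rewrite /= phi_bs undup_uniq andbT mem_undup; apply/mapP => -[b].
    by rewrite mem_filter => /andP [_ /S'P [_]] + E; rewrite E ltxx.
  move=> x y xs ys E; apply/eqP; rewrite -(nth_index 0 xs) -(nth_index 0 ys).
  by rewrite nth_uniq ?index_mem ?(map_uniq u) // -(nth_uniq 0 _ _ u) ?size_map ?index_mem //
    !(nth_map 0) ?index_mem // !nth_index // E.
have abS b : b \in a :: bs -> b \in S by rewrite inE => /orP [/eqP -> //|/bsP [/S'P []]].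
have FaP x : x \in Fa -> x \in S /\ phi x = phi a by rewrite !inE /= => /andP [? /eqP].
have phiM x y z t : x \in S -> y \in S -> z \in S -> t \in S -> x * y = z * t ->
    phi x + phi y = phi z + phi t.
  move=> xS yS zS tS E; apply/(Hphi _ _ _ _ xS yS zS tS); rewrite E divff; first exact: torsion1.
  by rewrite mulf_neq0 ?nz.
have [cs Ecs] : {cs | cs = a :: bs} by exists (a :: bs).
pose T : seq F := enum_fset (pmul S' S') ++ [seq b * x | b <- cs, x <- enum_fset Fa].
have sT : size T = (#|` pmul S' S'| + (size bs).+1 * #|` Fa|)%N.
  by rewrite size_cat size_allpairs Ecs.
have uT : uniq T.
  rewrite -Ecs in phi_inj abS; rewrite cat_uniq fset_uniq /=; apply/andP; split.
    apply/hasPn => _ /allpairsP [[b x] [/= bs' xF ->]]; apply/negP => /pmulP [y [z [yS' zS' E]]].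
    have [xS xa] := FaP _ xF; have [yS ya] := S'P _ yS'; have [zS za] := S'P _ zS'.
    have := phiM _ _ _ _ (abS _ bs') xS yS zS E; rewrite xa.
    move: bs'; rewrite Ecs inE => /orP [/eqP ->|/bsP [_ /allP /(_ _ yS') /allP /(_ _ zS') /eqP] //].
    by move: ya za; lra.
  have ub : uniq cs.
    apply: (@map_uniq _ _ phi); rewrite Ecs /= phi_bs undup_uniq andbT mem_undup; apply/mapP => -[b].
    by rewrite mem_filter => /andP [_ /S'P [_]] + E; rewrite E ltxx.
  rewrite (@allpairs_uniq _ _ _ _ _ _ ub (fset_uniq _)) // => -[b x] [b' x'].
  move=> /allpairsP [[c y] [/= cb yF [-> ->]]] /allpairsP [[c' y'] [/= cb' yF' [-> ->]]] E.
  have [yS ya] := FaP _ yF; have [yS' ya'] := FaP _ yF'.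
  have := phiM _ _ _ _ (abS _ cb) yS (abS _ cb') yS' E; rewrite ya ya' => /addIr /phi_inj Ec.
  move: E; rewrite Ec // => /mulfI -> //; exact/nz/abS.
(* At least [r + 1] classes of atoms and the class of [a] itself provide [r + 2] translates of
   [Fa]. *)
apply: (@leq_trans (size T)); first by rewrite sT leq_add2l leq_mul2r ltnS size_bs orbT.
apply: uniq_leq_size => // x; rewrite mem_cat => /orP [/pmulP [y [z [/S'P [yS _] /S'P [zS _] ->]]]|].
  exact: mem_pmul.
by rewrite Ecs in abS *; case/allpairsP => -[b y] [/= /abS bS /FaP [yS _] ->]; exact: mem_pmul.
Qed.

(** Otherwise [rank_step] removes elements until at most half of [A] is left, each at the cost of
    [r + 2] products. This forces [(r + 2) |A| <= 2 |A A|], against the choice of [r] as the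
    integral part of [2 alpha]. *)
Lemma small_rank (R : realType) (A : {fset F}) (alpha : R) : 0 \notin A -> A != fset0 ->
    #|` pmul A A|%:R <= alpha * #|` A|%:R ->
  exists (A' : {fset F}) r, [/\ A' `<=` A, (#|` A| <= 2 * #|` A'|)%N,
    r%:R <= 2 * alpha & rank_le A' r].
Proof.
move=> A0 An HA; have [phi Hphi] := @torsion_order (enum_fset A) A0.
have cA : 0 < (#|` A|%:R : R) by rewrite ltr0n cardfs_gt0.
have alpha0 : 0 <= 2 * alpha.
  by rewrite mulr_ge0 //; have := le_trans (ler0n _ _) HA; rewrite pmulr_lge0.
pose r := Num.truncn (2 * alpha).
have /andP [r1 r2] : r%:R <= 2 * alpha < r.+1%:R by apply: truncn_itv.
have [[A' [sA' cA' rk]]|none] :=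
  pselect (exists A' : {fset F}, [/\ A' `<=` A, (#|` A| <= 2 * #|` A'|)%N & rank_le A' r]).
  by exists A', r.
exfalso.
have grow n (S : {fset F}) : (#|` S| < n)%N -> S `<=` A ->
    (2 * r.+2 * #|` S| <= 2 * #|` pmul S S| + r.+2 * #|` A|)%N.
  elim: n S => // n IH S Sn sS.
  have [big|small] := leqP #|` A| (2 * #|` S|); last first.
    apply: (@leq_trans (r.+2 * #|` A|)%N); last exact: leq_addl.
    by rewrite -mulnA mulnCA leq_mul2l /= ltnW.
  have S0 : 0 \notin S by apply: contra A0; apply: (fsubsetP sS).
  have Sn0 : S != fset0.
    by apply: contraTneq big => ->; rewrite cardfs0 muln0 leqn0 cardfs_eq0.
  have HS : ~ rank_le S r by move=> rk; apply: none; exists S.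
  have [|S' [sS' cS' H]] := @rank_step S phi r S0 Sn0 _ HS.
    by move=> x y z t xS yS zS tS; apply: Hphi; apply: (fsubsetP sS).
  have := IH S' (leq_trans cS' Sn) (fsubset_trans sS' sS).
  move: H cS'; move: #|` S| #|` S'| #|` A| #|` pmul S S| #|` pmul S' S'| => s s' c m m'.
  move=> H1 H2 H3; nia.
have := grow _ A (ltnSn _) (fsubset_refl _).
move: (r.+2) (ltnW (ltnSn r.+1) : r.+1 <= r.+2)%N => k rk H.
have {}H : (k * #|` A| <= 2 * #|` pmul A A|)%N.
  by rewrite -(leq_add2r (k * #|` A|)) (leq_trans _ H) // addnn -mul2n mulnA.
rewrite -(ler_nat R) (natrM _ k) (natrM _ 2) in H.
have : k%:R * #|` A|%:R <= 2 * alpha * #|` A|%:R by rewrite -mulrA (le_trans H) // ler_pM2l.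
by rewrite ler_pM2r // leNgt (lt_le_trans r2) // ler_nat.
Qed.
End Rank.

(** * The bound in a field with a height *)

Lemma small_bound_homo s k : (s <= k)%N -> (small_bound s <= small_bound k)%N.
Proof.
move=> sk; have le := leq_fact sk; rewrite /small_bound.
by apply: leq_mul => //; rewrite ltnS leq_mul // leq_fact.
Qed.

Lemma Qsmall_homo s k : (s <= k)%N -> (Qsmall s <= Qsmall k)%N.
Proof.
move=> sk; rewrite /Qsmall ltnS leq_mul ?leq_exp2r // leq_mul //; exact: small_bound_homo.
Qed.

Lemma Qbig_Qsmall k : (Qbig k <= Qsmall k)%N.
Proof.
rewrite /Qbig /Qsmall ltnS; case: k => // k.
by rewrite -mulnA leq_mul // -[X in (X <= _)%N]mul1n leq_mul ?leq_pexp2l // muln_gt0.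
Qed.

Lemma fact_Qsmall k : (0 < k)%N -> ((k`! ^ 2) * (k`!)`! <= Qsmall k)%N.
Proof.
move=> k0; rewrite /Qsmall /small_bound; apply: leqW.
apply: (@leq_trans (64 * ((k`!).+1 * ((k`!)`! * k`!).+1) * 1)); last first.
  by rewrite leq_mul // expn_gt0 k0.
rewrite muln1; apply: (@leq_trans (1 * (k`! * ((k`!)`! * k`!)))%N); last by rewrite leq_mul // leq_mul.
by rewrite mul1n -mulnn; apply/eq_leq; ring.
Qed.

(** The two fixed ranges of height and the [p] scales make the factor [p + 2]; the extra power of
    [Qsmall k] covers the hyperplanes within a cell of small height. *)
Lemma cover_bound_le s k r p : (s <= k)%N -> (0 < k)%N ->
  (cover_bound s r p <= p.+2 * Qsmall k ^ (r * k).+1)%N.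
Proof.
move=> sk k0; have Q0 : (0 < Qsmall k)%N by [].
have H Q : (Q <= Qsmall k)%N -> ((Q ^ r) ^ s <= Qsmall k ^ (r * k))%N.
  move=> HQ; rewrite -expnM; apply: (@leq_trans (Qsmall k ^ (r * s))).
    by case: (r * s)%N => // n; rewrite leq_exp2r.
  by rewrite leq_pexp2l // leq_mul2l sk orbT.
have H1 := H _ (Qsmall_homo sk); have H2 := H _ (leq_trans (Qbig_Qsmall s) (Qsmall_homo sk)).
have H3 : ((s`! ^ 2) * (s`!)`! <= Qsmall k)%N.
  apply: leq_trans (fact_Qsmall k0); apply: leq_mul; first by rewrite leq_exp2r // leq_fact.
  by rewrite !leq_fact.
rewrite /cover_bound !muln1 -[p.+2]/(1 + (1 + p))%N mulnDl mul1n.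
have H4 : (Qsmall k ^ (r * k) <= Qsmall k ^ (r * k).+1)%N by rewrite leq_pexp2l.
apply: leq_add; first by rewrite [X in (_ <= X)%N]expnSr leq_mul.
by rewrite -{1}[X in (X + _)%N]mul1n -mulnDl leq_mul // (leq_trans H2).
Qed.

(** * Numerical estimates *)

Section Estimates.
Variable R : realType.

Lemma ln_nat_le n : ln (n%:R : R) <= n%:R.
Proof.
have [->|n0] := posnP n; first by rewrite ln0.
by apply/ltW/ln_sublinear; rewrite ltr0n.
Qed.

(** Everything is compared with powers of [t = m^m]. For [k = 2 m] one has [k! <= t^4], and the
    dominant factor [(k!)!] has logarithm at most [(k!)^2 <= t^8]; the ninth power leaves room for
    the rest. *)
Lemma ln_Qsmall m : (1 < m)%N -> ln ((Qsmall (m + m))%:R : R) <= ((m ^ m) ^ 9)%:R.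
Proof.
move=> m1; set t := (m ^ m)%N.
have t4 : (4 <= t)%N.
  by rewrite -[4%N]/(2 ^ 2)%N; apply: (@leq_trans (m ^ 2)); rewrite ?leq_exp2r ?leq_pexp2l // ltnW.
have tm : (m <= t)%N by rewrite -{1}[m]expn1 leq_pexp2l // ltnW.
set k := (m + m)%N; have k0 : (0 < k)%N by rewrite addn_gt0 ltnW.
have kt : (k <= t ^ 2)%N by rewrite /k addnn -mul2n -mulnn leq_mul // (leq_trans _ t4).
pose n := k`!; have n0 : (0 < n)%N by exact: fact_gt0.
have nt : (n <= t ^ 4)%N.
  apply: (@leq_trans (k ^ k)).
    rewrite /n; elim: (k) => // j IH; rewrite factS expnS leq_mul //; apply: leq_trans IH _.
    by case: j => // j; rewrite leq_exp2r.
  apply: (@leq_trans ((m ^ 2) ^ k)%N).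
    by rewrite leq_exp2r // /k addnn -mul2n -mulnn leq_mul.
  by rewrite /t /k -!expnM leq_pexp2l ?(ltnW m1) //; lia.
have HB : (Qsmall k <= 257 * k ^ 4 * n ^ 2 * n`!)%N.
  rewrite /Qsmall /small_bound -/n.
  have f0 := fact_gt0 n; have k4 : (0 < k ^ 4)%N by rewrite expn_gt0 k0.
  have : (n.+1 * (n`! * n).+1 <= 4 * (n ^ 2 * n`!))%N.
    apply: (@leq_trans ((2 * n) * (2 * (n`! * n)))%N); last by apply/eq_leq; ring.
    apply: leq_mul; rewrite mul2n -addnn -addn1 leq_add2l //.
    by rewrite muln_gt0 f0.
  move=> H; rewrite -addn1.
  apply: (@leq_trans (64 * (4 * (n ^ 2 * n`!)) * k ^ 4 + 1 * (k ^ 4 * (n ^ 2 * n`!))))%N.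
    apply: leq_add; first by rewrite leq_mul // leq_mul.
    by rewrite mul1n muln_gt0 k4 muln_gt0 expn_gt0 n0.
  by apply/eq_leq; ring.
have k0R : 0 < (k%:R : R) by rewrite ltr0n.
have n0R : 0 < (n%:R : R) by rewrite ltr0n.
apply: (@le_trans _ _ (257 + 4 * k%:R + 2 * n%:R + n%:R ^+ 2)).
  apply: (@le_trans _ _ (ln ((257 * k ^ 4 * n ^ 2 * n`!)%N%:R : R))).
    by apply: ln_homo; rewrite ?ltr0n // ler_nat.
  rewrite (natrM R (257 * k ^ 4 * n ^ 2)) (natrM R (257 * k ^ 4)) (natrM R 257) !natrX.
  rewrite !lnMp ?mulr_gt0 ?exprn_gt0 ?ltr0n ?fact_gt0 //.
  have := ln_nat_le 257; have := ln_nat_le k; have := ln_nat_le n; have := ln_fact_le R n.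
  by rewrite natrX; lra.
rewrite -natrX -!natrM -!natrD ler_nat.
have t0 : (0 < t)%N by apply: leq_trans t4.
have p2 : (n ^ 2 <= t ^ 8)%N by rewrite (expnM t 4 2) leq_exp2r.
have p4 : (257 <= 2 * t ^ 4)%N by rewrite (@leq_trans (2 * 4 ^ 4)) // leq_mul2l leq_exp2r.
have p3 : (t ^ 4 * 256 <= t ^ 8)%N by rewrite (expnD t 4 4) leq_mul2l orbC -[256%N]/(4 ^ 4)%N leq_exp2r // t4.
have p5 : (16 * t ^ 2 <= t ^ 4)%N by rewrite (expnD t 2 2) leq_mul2r -[16%N]/(4 ^ 2)%N leq_exp2r // t4 orbT.
have p9 : (4 * t ^ 8 <= t ^ 9)%N by rewrite (expnS t 8) leq_mul2r t4 orbT.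
lia.
Qed.

(** Taking logarithms, [ln (2 q + 1) <= (2 q + 1) / s + s]. For [s = 16 (y + 1)] the first term
    times [2 y] is at most [(2 q + 1) / 8], absorbed by [q ln 2 >= q / 2]; the second causes the
    square of [y]. *)
Lemma scales_bound q y (a : nat) (A : nat) : (0 < a)%N -> (0 < A)%N -> (A <= 2 * a)%N ->
    (2 ^ q <= (2 * q).+1 ^ (2 * y) * A ^ 2)%N ->
  ((2 * q).+2)%:R <= 512 * (1 + (y%:R : R) ^+ 2 + ln (a%:R : R)).
Proof.
move=> a0 A0 Aa H.
have a0R : 0 < (a%:R : R) by rewrite ltr0n.
have l2 : 1 / 2 <= ln (2 : R).
  rewrite -[1/2]expRK ler_ln ?posrE ?expR_gt0 //.
  have := @expR_ge1Dx R (- (1 / 2)); rewrite expRN => H2.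
  have e0 := @expR_gt0 R (1 / 2); have : expR (1/2) * (expR (1/2))^-1 = 1 :> R by rewrite divff // gt_eqF.
  by nra.
have l2' : ln (2 : R) <= 1 by apply: (@le_ln1Dx R 1); lra.
have HR : q%:R * ln (2 : R) <= (2 * y%:R) * ln ((2 * q).+1%:R : R) + 2 * (ln 2 + ln a%:R).
  have : ln ((2 ^ q)%N%:R : R) <= ln (((2 * q).+1 ^ (2 * y) * (2 * a) ^ 2)%N%:R : R).
    apply: ln_homo; first by rewrite ltr0n expn_gt0.
    by rewrite ler_nat; apply: leq_trans H _; rewrite leq_mul2l leq_exp2r // Aa orbT.
  move: (2 * q).+1 (ltn0Sn (2 * q)) => u u0.
  have u0R : 0 < (u%:R : R) by rewrite ltr0n.
  rewrite (natrM R (u ^ _)) (natrX R 2 q) (natrX R u) (natrX R (2 * a)) (natrM R 2 a).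
  rewrite lnMp ?exprn_gt0 ?mulr_gt0 // !lnXn ?mulr_gt0 // lnMp //.
  by rewrite -[ln 2 *+ q]mulr_natl -[ln u%:R *+ _]mulr_natl (natrM R 2 y) -[(_ + _) *+ 2]mulr_natl.
have y0 : 0 <= (y%:R : R) by [].
have q0 : 0 <= (q%:R : R) by [].
have qe : (2 * q).+1%:R = 2 * q%:R + 1 :> R by rewrite -addn1 natrD natrM.
have qe2 : (2 * q).+2%:R = 2 * q%:R + 2 :> R by rewrite -addn2 natrD natrM.
have la0 : 0 <= ln (a%:R : R) by rewrite ln_ge0 // ler1n.
pose s : R := 16 * (y%:R + 1).
have s0 : 0 < s by rewrite /s; lra.
have lnq : ln ((2 * q).+1%:R : R) <= (2 * q).+1%:R / s + s.
  have -> : (2 * q).+1%:R = (2 * q).+1%:R / s * s :> R by rewrite mulfVK // gt_eqF.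
  rewrite lnMp ?divr_gt0 // mulfVK ?gt_eqF // lerD //; apply/ltW/ln_sublinear => //; exact: divr_gt0.
have H3 : 2 * y%:R * ((2 * q).+1%:R / s) <= (2 * q%:R + 1) / 8.
  rewrite qe mulrA ler_pdivrMr // /s; nra.
have H4 : 2 * y%:R * ln ((2 * q).+1%:R : R) <= (2 * q%:R + 1) / 8 + 32 * y%:R * (y%:R + 1).
  apply: le_trans (ler_wpM2l _ lnq) _; first lra.
  by rewrite mulrDr lerD // /s; nra.
have q2 : q%:R * (1 / 2) <= q%:R * ln (2 : R) by rewrite ler_wpM2l.
have y2 : 0 <= (y%:R - 1 : R) ^+ 2 by exact: sqr_ge0.
rewrite qe2; rewrite sqrrB1 expr2 in y2 *.
rewrite mulrDr mulr1 in H4; move: H4; rewrite -mulrA => H4; lra.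
Qed.

(** With [l = ln |A|] this bounds a power of the number of scales, [(1 + ln |A|)^D], by [|A|] times
    the constant [exp (D^2)]. It follows from [ln x <= x - 1] at [(1 + l) / D] and at [D]. *)
Lemma ln_trick (D l : R) : 1 <= D -> 0 <= l -> D * ln (1 + l) <= l + D ^+ 2.
Proof.
move=> D1 l0; have D0 : 0 < D by lra.
have E : 1 + l = (1 + l) / D * D by rewrite mulfVK // gt_eqF.
have x0 : 0 < (1 + l) / D by rewrite divr_gt0 //; lra.
have ln1 (x : R) : 0 < x -> ln x <= x - 1.
  by move=> px; rewrite -{1}[x](addrNK 1) addrC; apply: le_ln1Dx; lra.
have H1 := ln1 _ x0; have H2 := ln1 _ D0.
rewrite {1}E lnMp // mulrDr.
have : D * ln ((1 + l) / D) <= 1 + l - D.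
  apply: le_trans (ler_wpM2l (ltW D0) H1) _; rewrite mulrBr mulr1 mulrCA divff ?gt_eqF // mulr1.
  by [].
nra.
Qed.
End Estimates.

Section Growth.
Variables (R : realType) (F : fieldType) (h : seq F -> R) (Hh : is_height h).
Local Open Scope fset_scope.
Local Open Scope ring_scope.

Lemma exponent_sum (D m alpha u v w : R) : D * v <= w + D ^+ 2 ->
  D * (2 * m + (512 + 8 * alpha + v + u)) <= D * (2 * m + 512 + 8 * alpha + D + u) + w.
Proof. lra. Qed.

Lemma exponent_ge0 (t D m alpha : R) : 0 <= t -> 0 <= m -> 0 <= D -> 0 <= alpha ->
  0 <= 2 * m + 512 + 8 * alpha + D + (2 * alpha * (2 * m) + 1) * t ^+ 9.
Proof.
move=> t0 m0 D0 a0; have T := exprn_ge0 9 t0; have am := mulr_ge0 a0 m0.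
apply: addr_ge0; [lra | apply: mulr_ge0 => //; lra].
Qed.

(** The factor multiplying [D] is at most [5 t^10 (1 + alpha)]; with [D <= t^3] and [m <= t] the
    whole is at most [10 t^14 (1 + alpha)], and [10 <= t^3]. *)
Lemma exponent_bound (t D m alpha : R) : 4 <= t -> 1 <= m -> m <= t -> 0 <= D -> D <= t ^+ 3 ->
    0 <= alpha ->
  m * (2 + 4 * m + D * (2 * m + 512 + 8 * alpha + D + (2 * alpha * (2 * m) + 1) * t ^+ 9))
    <= t ^+ 17 * (1 + alpha).
Proof.
move=> t4 m1 mt D0 Dt a0.
have t0 : 0 <= t by lra.
have pw i j : (i <= j)%N -> t ^+ i <= t ^+ j by move=> ij; apply: ler_weXn2l => //; lra.
have T9 : 512 <= t ^+ 9.
  have := @lerXn2r _ 9 (2 : R) t; rewrite !nnegrE => /(_ (ler0n R 2) t0) H; apply: le_trans (H _); last lra.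
  by rewrite -natrX ler_nat.
have T1 := pw 1 9 isT; have T3 := pw 3 9 isT; rewrite expr1 in T1.
have T10 : t ^+ 10 = t * t ^+ 9 by rewrite exprS.
have T10' : 4 * t ^+ 9 <= t ^+ 10 by rewrite T10 ler_wpM2r //; lra.
have in1 : 2 * m + 512 + 8 * alpha + D + (2 * alpha * (2 * m) + 1) * t ^+ 9 <= 5 * t ^+ 10 * (1 + alpha).
  have A1 : 0 <= alpha * (t ^+ 10 - 8) by apply: mulr_ge0 => //; lra.
  have A2 : alpha * (m * t ^+ 9) <= alpha * t ^+ 10.
    by apply: ler_wpM2l => //; rewrite T10; apply: ler_wpM2r => //; lra.
  by move: (t ^+ 9) (t ^+ 10) (t ^+ 3) T9 T1 T3 T10' A1 A2 Dt; move=> x y z *; nra.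
set I := (X in D * X) in in1 *.
have I0 : 0 <= I by apply: exponent_ge0 => //; lra.
have in2 : D * I <= t ^+ 3 * (5 * t ^+ 10 * (1 + alpha)) by apply: ler_pM.
have in3 : 2 + 4 * m + D * I <= 10 * t ^+ 13 * (1 + alpha).
  have E13 : t ^+ 13 = t ^+ 3 * t ^+ 10 by rewrite -exprD.
  have := pw 1 13 isT; rewrite expr1 E13; move: (t ^+ 3) (t ^+ 10) in2 => x y in2 H.
  have : 0 <= (5 * t) * alpha by rewrite mulr_ge0 // mulr_ge0.
  nra.
apply: (@le_trans _ _ (t * (10 * t ^+ 13 * (1 + alpha)))).
  apply: ler_pM => //; try lra; apply: addr_ge0; [lra|exact: mulr_ge0].
rewrite mulrA ler_wpM2r //; first lra.
rewrite mulrCA -exprS (_ : t ^+ 17 = t ^+ 3 * t ^+ 14); last by rewrite -exprD.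
rewrite ler_wpM2r ?exprn_ge0 //; have := @lerXn2r _ 3 (4 : R) t; rewrite !nnegrE => /(_ (ler0n R 4) t0 t4).
by rewrite !exprS expr0; lra.
Qed.

(** [V] is any set containing the sums, not the sumset itself, so that an image of another set can
    be used after transport to the number field. *)
Lemma growth_bound (A V : {fset F}) (alpha : R) m : 0 \notin A -> A != fset0 ->
    #|` pmul A A|%:R <= alpha * #|` A|%:R -> (1 < m)%N ->
    (forall f : 'I_m -> F, (forall i, f i \in A) -> \sum_i f i \in V) ->
  #|` A|%:R ^+ m <= expR (((m ^ m) ^ 17)%:R * (1 + alpha)) * #|` V|%:R :> R.
Proof.
move=> A0 An HA m1 HV.
have [S [q [y [HS Hy Hq Hsc]]]] := scales_exist Hh A0 An HA.
have [A' [r [sA' cA' Hr [g [d [g0 d0 Hrk]]]]]] := small_rank A0 An HA.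
have cA : (0 < #|` A|)%N by rewrite cardfs_gt0.
set a := #|` A'| in cA'; have a0 : (0 < a)%N by move: cA'; case: (a) => //; rewrite muln0 leqNgt cA.
have alpha0 : 0 <= alpha by have := le_trans (ler0n _ _) HA; rewrite pmulr_lge0 // ltr0n.
pose k := (m + m)%N; pose t := (m ^ m)%N.
have k0 : (0 < k)%N by rewrite addn_gt0 ltnW.
pose E := (2 ^ k * ((size S).+2 * Qsmall k ^ (r * k).+1))%N.
have E0 : (0 < E)%N by rewrite !muln_gt0 !expn_gt0.
(* The power of [E] in [HWa]: there are at most [E^(2^k)] lines, and the energy estimate takes the
   square. *)
pose D : R := (2 ^ k * 2)%N%:R.
have D1 : 1 <= D by rewrite ler1n muln_gt0 expn_gt0.
pose X : R := D * (2 * m%:R + 512 + 8 * alpha + D + (2 * alpha * (2 * m%:R) + 1) * t%:R ^+ 9).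
have X0 : 0 <= X.
  by apply: mulr_ge0; rewrite ?ler0n //; apply: exponent_ge0; rewrite ?ler0n.
pose W := (Num.truncn (expR X)).+1.
have a0R : 0 < (a%:R : R) by rewrite ltr0n.
have la0 : 0 <= ln (a%:R : R) by rewrite ln_ge0 // ler1n.
have Q0 : 0 < ((Qsmall k)%:R : R) by rewrite ltr0n.
(* The eighth power arises from [y <= alpha^4] squared; its logarithm is at most [8 alpha], which
   keeps the final exponent linear. *)
have lnp : ln ((size S).+2%:R : R) <= 512 + 8 * alpha + ln (1 + ln (a%:R : R)).
  have H1 : ((size S).+2%:R : R) <= 512 * (1 + alpha) ^+ 8 * (1 + ln a%:R).
    apply: (@le_trans _ _ ((2 * q).+2%:R)); first by rewrite ler_nat !ltnS.
    apply: le_trans (scales_bound R a0 cA cA' Hq) _; rewrite -mulrA ler_pM2l //.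
    have H2 : 1 + (y%:R : R) ^+ 2 <= (1 + alpha) ^+ 8.
      have y2 : (y%:R : R) ^+ 2 <= alpha ^+ 4 ^+ 2 by rewrite lerXn2r ?nnegrE ?exprn_ge0.
      have a4 : 1 + alpha ^+ 4 <= (1 + alpha) ^+ 4.
        have p2 := exprn_ge0 2 alpha0; have p3 := exprn_ge0 3 alpha0.
        rewrite (_ : (1 + alpha) ^+ 4 = 1 + alpha ^+ 4 + (4 * alpha + 6 * alpha ^+ 2 + 4 * alpha ^+ 3)); last ring.
        lra.
      have a8 : (1 + alpha ^+ 4) ^+ 2 <= (1 + alpha) ^+ 8.
        by rewrite (exprM (1 + alpha) 4 2) lerXn2r ?nnegrE ?addr_ge0 ?exprn_ge0 //; lra.
      have := exprn_ge0 4 alpha0; move: y2 a8; rewrite !expr2; nra.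
    have := sqr_ge0 (y%:R : R); move: H2 la0.
    by move: ((1 + alpha) ^+ 8) (y%:R ^+ 2) (ln _) => u v w *; nra.
  apply: le_trans (ln_homo _ H1) _ => //.
  have b0 : 0 < 1 + alpha by lra.
  have b8 : 0 < (1 + alpha) ^+ 8 by rewrite exprn_gt0.
  have bl : 0 < 1 + ln (a%:R : R) by lra.
  rewrite lnMp ?mulr_gt0 // (lnMp _ b8) // lnXn // -[_ *+ 8]mulr_natl.
  have l1 : ln (1 + alpha) <= alpha by apply: le_ln1Dx; lra.
  have := ln_nat_le R 512; lra.
(* In logarithms the only part depending on [a] is [D ln (1 + ln a)]. By [ln_trick] it splits into
   [ln a], paid for by the factor [a], and [D^2], which is part of [X]. *)
have HWa : ((E ^ 2 ^ k) ^ 2 <= W * a)%N.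
  rewrite -expnM -(ler_nat R) natrM natrX.
  apply: (@le_trans _ _ (expR X * a%:R)); last first.
    by rewrite ler_wpM2r // ltW //; have /andP [] := truncn_itv (ltW (expR_gt0 X)).
  have E0R : 0 < (E%:R : R) by rewrite ltr0n.
  have -> : (E%:R : R) ^+ (2 ^ k * 2) = expR (D * ln E%:R) by rewrite expRM_natl lnK.
  have -> : expR X * a%:R = expR (X + ln a%:R) by rewrite expRD lnK.
  rewrite ler_expR.
  have -> : ln (E%:R : R) = ln 2 *+ k + (ln ((size S).+2%:R) + ln (Qsmall k)%:R *+ (r * k).+1).
    rewrite /E (natrM R (2 ^ k)) (natrM R (size S).+2) (natrX R 2) (natrX R (Qsmall k))
      !lnMp ?mulr_gt0 ?exprn_gt0 ?ltr0n //.
    by rewrite !lnXn ?ltr0n.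
  have T1 := ln_trick D1 la0.
  have l2 : ln (2 : R) <= 1 by apply: (@le_ln1Dx R 1); lra.
  have kE : (k%:R : R) = 2 * m%:R by rewrite /k natrD; ring.
  have Q1 := ln_Qsmall R m1; rewrite natrX -/k -/t in Q1.
  have rE : ((r * k).+1%:R : R) <= 2 * alpha * (2 * m%:R) + 1.
    by rewrite -addn1 natrD (natrM R r) -kE lerD2r ler_wpM2r // ler0n.
  have D0 : 0 <= D by lra.
  have B1 : ln (2 : R) *+ k <= 2 * m%:R.
    by rewrite -[_ *+ k]mulr_natl -kE -[X in _ <= X]mulr1 ler_wpM2l.
  have B2 : ln ((Qsmall k)%:R : R) *+ (r * k).+1 <= (2 * alpha * (2 * m%:R) + 1) * t%:R ^+ 9.
    by rewrite -[_ *+ _.+1]mulr_natl ler_pM // ln_ge0 // ler1n.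
  apply: (@le_trans _ _ (D * (2 * m%:R + (512 + 8 * alpha + ln (1 + ln a%:R) +
    (2 * alpha * (2 * m%:R) + 1) * t%:R ^+ 9)))).
    by rewrite ler_wpM2l // lerD // lerD.
  exact: exponent_sum.
have HE : (2 ^ k * \max_(s < k.+1) cover_bound s r (size S) <= E)%N.
  rewrite leq_mul2l; apply/orP; right; apply/bigmax_leqP => s _.
  by apply: cover_bound_le => //; rewrite -ltnS.
have Arank : {in enum_fset A' &, forall x y, rank_in g d (x / y)} by exact: Hrk.
have A'0 : 0 \notin enum_fset A' by apply: contra A0; exact: (fsubsetP sA').
have Hsc' x x' z w : x \in enum_fset A' -> x' \in enum_fset A' -> z \in enum_fset A' ->
    w \in enum_fset A' -> 1 <= hN h ((x / x') / (z / w)) ->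
    exists2 j, j \in S & 2 ^+ j <= hN h ((x / x') / (z / w)) < 2 ^+ j.+1.
  by move=> xA yA zA wA; apply: Hsc; apply: (fsubsetP sA').
have main := sumset_count Hh (fset_uniq A') A'0 g0 d0 Arank Hsc' a0 HE E0 HWa isT (fset_uniq V).
have {}main : (a ^ m <= #|` V| * (16 ^ m * W) ^ m)%N.
  by apply: main => f; apply: HV => i; apply: (fsubsetP sA'); exact: (valP (f i)).
have HAm : (#|` A| ^ m <= #|` V| * (2 * (16 ^ m * W)) ^ m)%N.
  apply: (@leq_trans ((2 * a) ^ m)); first by rewrite leq_exp2r // ltnW.
  by rewrite (expnMn 2 a) (expnMn 2 (16 ^ m * W)) mulnCA leq_mul2l main orbT.
rewrite -natrX mulrC; apply: (@le_trans _ _ (#|` V| * (2 * (16 ^ m * W)) ^ m)%N%:R); first by rewrite ler_nat.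
rewrite natrM ler_wpM2l // natrX.
have eX1 : 1 <= expR X by rewrite -expR0 ler_expR.
have e1 : 2 <= expR 1 :> R by have := @expR_ge1Dx R 1; lra.
have WX : (W%:R : R) <= expR (X + 1).
  have /andP [trX _] := truncn_itv (ltW (expR_gt0 X)).
  rewrite /W -addn1 natrD expRD; move: trX; nra.
have e16 : (16%:R : R) ^+ m <= expR (4 * m%:R).

  rewrite mulrC expRM_natl; apply: lerXn2r; rewrite ?nnegrE ?expR_ge0 //.
  rewrite -[4]mulr1 -[4 * 1]/(4%:R * 1) expRM_natl (_ : 16%:R = 2 ^+ 4); last by rewrite -natrX.
  by apply: lerXn2r; rewrite ?nnegrE ?expR_ge0.
apply: (@le_trans _ _ (expR (1 + (4 * m%:R + (X + 1))) ^+ m)).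
  apply: lerXn2r; rewrite ?nnegrE ?expR_ge0 // !(natrM R) natrX !expRD.
  rewrite ler_pM ?mulr_ge0 ?exprn_ge0 // ler_pM ?exprn_ge0 //.
  by move: WX; rewrite expRD.
rewrite -expRM_natl ler_expR.
have tm : (m <= t)%N by rewrite -{1}[m]expn1 leq_pexp2l // ltnW.
have t4 : (4 <= t)%N.
  by rewrite -[4%N]/(2 ^ 2)%N; apply: (@leq_trans (m ^ 2)); rewrite ?leq_exp2r ?leq_pexp2l // ltnW.
have m2t : (2 ^ m <= t)%N by rewrite leq_exp2r ?(ltnW m1).
have Dt : D <= t%:R ^+ 3.
  rewrite -natrX ler_nat (expnS t 2) mulnC leq_mul ?(ltnW (ltnW t4)) //.
  by rewrite /k expnD -mulnn leq_mul.
have t4R : 4 <= (t%:R : R) by rewrite (ler_nat R 4).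
have m1R : 1 <= (m%:R : R) by rewrite ler1n ltnW.
have tmR : m%:R <= (t%:R : R) by rewrite ler_nat.
have := exponent_bound t4R m1R tmR (le_trans ler01 D1) Dt alpha0.
rewrite -/X -natrX; apply: le_trans; rewrite ler_wpM2l ?ler0n //; lra.
Qed.
End Growth.

(** * Reduction to a number field *)

(** [L] is a splitting field of the product of the minimal polynomials; normality lets automorphisms
    index the absolute values. *)
Lemma galois_number_field (s : seq algC) :
  exists (L : splittingFieldType rat) (iA : {rmorphism L -> algC}),
    {in s, forall a, exists x, iA x = a}.
Proof.
have [P [mP rP]] : exists P : {poly rat}, P \is monic /\ {in s, forall a, root (map_poly ratr P) a}.
  elim: s => [|a s [P [mP rP]]]; first by exists 1; rewrite monic1.
  have [p [Ep mp] Hp] := minCpolyP a; exists (p * P); rewrite rpredM //; split=> // b.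
  rewrite rmorphM /= rootM inE => /orP [/eqP ->|/rP ->]; last by rewrite orbT.
  by rewrite -Ep root_minCpoly.
have [rs Ers] := closed_field_poly_normal (map_poly ratr P : {poly algC}).
rewrite (eqP (_ : map_poly ratr P \is monic)) ?map_monic // scale1r in Ers.
have [Qs [QsC [s1 Es1 gen]]] := num_field_exists rs.
have spl : splitting_field_axiom Qs.
  exists (map_poly (in_alg Qs) P); first exact: alg_polyOver.
  exists s1 => //; suff -> : map_poly (in_alg Qs) P = \prod_(z <- s1) ('X - z%:P) by rewrite eqpxx.
  apply: (map_poly_inj QsC); rewrite -map_poly_comp (@eq_map_poly _ _ _ ratr) ?Ers -?Es1; last first.
    by move=> x /=; rewrite alg_num_field fmorph_rat.
  rewrite rmorph_prod big_map; apply: eq_bigr => z _.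
  by rewrite rmorphB /= map_polyX map_polyC.
pose L : splittingFieldType rat := HB.pack Qs (FieldExt_isSplittingField.Build _ Qs spl).
exists L, QsC => a /rP; rewrite Ers root_prod_XsubC -Es1 => /mapP [x _ ->].
by exists x.
Qed.

(** Specializing a basis of [L] makes [ev] onto; since [phi] kills the kernel of [ev], it descends
    to [L]. Applied to the complex numbers over [R], this gives absolute values in [R]. *)
Lemma ext_embedding (L : fieldExtType rat) (Om : numClosedFieldType) : inhabited {rmorphism L -> Om}.
Proof.
have sp : specializes Om (in_alg L).
  move=> D D0; exists (ratr : {rmorphism rat -> Om}); split=> [P /eqP|].
    by rewrite fmorph_eq0 => /eqP ->; rewrite rmorph0.
  by rewrite fmorph_eq0; rewrite fmorph_eq0 in D0.
have [S [ev [spS im im0]]] := specializes_exists (vbasis {:L}) sp.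
have /choice [pre Hpre] : forall x : L, exists P, ev P = x.
  move=> x; rewrite (coord_vbasis (memvf x)); elim/big_rec: _ => [|i _ _ [P <-]].
    by exists 0; rewrite rmorph0.
  have [Q <-] : exists Q, ev Q = (vbasis {:L})`_i by apply: im; rewrite mem_nth // size_tuple.
  have [c Ec] := im0 (coord (vbasis {:L}) i x).
  by exists (c * Q + P); rewrite rmorphD rmorphM /= Ec mulr_algl.
have [|phi [phi0 _]] := spS 1; first by rewrite rmorph1 oner_neq0.
have phiE P Q : ev P = ev Q -> phi P = phi Q.
  move=> /eqP; rewrite -subr_eq0 -rmorphB => /eqP /phi0 /eqP.
  by rewrite rmorphB subr_eq0 => /eqP.
pose f x := phi (pre x).
have fB : zmod_morphism f by move=> x y; rewrite /f -rmorphB; apply: phiE; rewrite rmorphB !Hpre.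
have fM : monoid_morphism f.
  split=> [|x y]; last by rewrite /f -rmorphM; apply: phiE; rewrite rmorphM !Hpre.
  by rewrite /f -(rmorph1 phi); apply: phiE; rewrite rmorph1 Hpre.
pose m1 := GRing.isZmodMorphism.Build L Om f fB.
pose m2 := GRing.isMonoidMorphism.Build L Om f fM.
constructor; exact: (HB.pack f m1 m2 : {rmorphism L -> Om}).
Qed.

(** Equalities of sums and products persist because [phi] kills the kernel of [ev]. Distinctness is
    what has to be arranged: [D] collects the finitely many nonzero elements and differences. *)
Lemma transfer (K : fieldType) (A : seq K) : [pchar K] =i pred0 ->
  exists (L : splittingFieldType rat) (iA : {rmorphism L -> algC}) (f : K -> L),
  [/\ {in A &, injective f}, {in A, forall a, a != 0 -> f a != 0},
    {in A &, forall a b, {in A &, forall c d, a * b = c * d -> f a * f b = f c * f d}} &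
    forall m (u v : 'I_m -> K), (forall i, u i \in A) -> (forall i, v i \in A) ->
      \sum_i u i = \sum_i v i -> \sum_i f (u i) = \sum_i f (v i)].
Proof.
move=> cK.
have cO : [pchar algC] =i pred0 by exact: pchar_num.
have [S [ev [sp im _]]] := specializes_exists A (specializes_int cK cO).
have /choice [pre Hpre] : forall a, exists P, a \in A -> ev P = a.
  move=> a; case: (boolP (a \in A)) => [/im [P EP]|_]; last by exists 0.
  by exists P.
(* Factors that [ev] kills, such as the difference of an element with itself, are replaced by 1. *)
pose nz P := if ev P == 0 then 1 else P.
have nz0 P : ev (nz P) != 0 by rewrite /nz; case: (eqVneq (ev P) 0) => [_|//]; rewrite rmorph1 oner_neq0.
pose D := (\prod_(a <- A) nz (pre a)) * \prod_(p <- [seq (a, b) | a <- A, b <- A]) nz (pre p.1 - pre p.2).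
have [|phi [phi0 phiD]] := sp D.
  by rewrite rmorphM !rmorph_prod mulf_neq0 // prodf_seq_neq0; apply/allP => p _; rewrite nz0.
have phiE P Q : ev P = ev Q -> phi P = phi Q.
  move=> /eqP; rewrite -subr_eq0 -rmorphB => /eqP /phi0 /eqP.
  by rewrite rmorphB subr_eq0 => /eqP.
move: phiD; rewrite rmorphM !rmorph_prod mulf_eq0 negb_or !prodf_seq_neq0.
move=> /andP [/allP D1 /allP D2].
have [L [iA HL]] := galois_number_field [seq phi (pre a) | a <- A].
have /choice [f Hf] : forall a, exists x, a \in A -> iA x = phi (pre a).
  move=> a; case: (boolP (a \in A)) => [aA|_]; last by exists 0.
  by have [x Ex] := HL _ (map_f (fun a => phi (pre a)) aA); exists x.
exists L, iA, f; split.
- move=> a b aA bA E; have := Hf b bA; rewrite -E Hf // => /eqP.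
  rewrite -subr_eq0 -rmorphB => /eqP E0.
  have := D2 (a, b) (allpairs_f _ aA bA); rewrite /nz rmorphB !Hpre //= subr_eq0.
  by case: (eqVneq a b) => // _; rewrite /= E0 eqxx.
- move=> a aA a0; have := D1 a aA; rewrite /nz Hpre // (negPf a0) -Hf //=.
  by rewrite fmorph_eq0.
- move=> a b aA bA c d cA dA E; apply: (fmorph_inj iA); rewrite !rmorphM !Hf // -!rmorphM.
  by apply: phiE; rewrite !rmorphM !Hpre.
move=> m u v uA vA E; apply: (fmorph_inj iA); rewrite !rmorph_sum.
rewrite (eq_bigr (fun i => phi (pre (u i)))) => [|i _]; last exact: Hf.
rewrite [RHS](eq_bigr (fun i => phi (pre (v i)))) => [|i _]; last exact: Hf.
rewrite -!rmorph_sum; apply: phiE; rewrite !rmorph_sum.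
rewrite (eq_bigr u) => [|i _]; last exact: Hpre.
by rewrite [RHS](eq_bigr v) => [|i _]; last exact: Hpre.
Qed.

Section SumsetGrowth.
Local Open Scope fset_scope.
Local Open Scope ring_scope.

Lemma fset_image_card (T U : choiceType) (X : {fset T}) (Y : {fset U}) (f : T -> U) :
  (forall y, y \in Y -> exists2 x, x \in X & y = f x) -> (#|` Y| <= #|` X|)%N.
Proof.
move=> H; apply: (@leq_trans #|` [fset f x | x in X]|); last exact: leq_imfset_card.
apply: fsubset_leq_card; apply/fsubsetP => y /H [x xX ->]; exact: in_imfset.
Qed.

Lemma mem_sumset (K : closedFieldType) (A : {fset K}) m (u : 'I_m -> K) :
  (forall i, u i \in A) -> \sum_i u i \in sumset m A.
Proof.
elim: m u => [|m IH] u uA /=; first by rewrite big_ord0 inE.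
by rewrite big_ord_recl; apply/imfset2P; exists (u ord0) => //; exists (\sum_i u (lift ord0 i));
  rewrite ?IH.
Qed.

(** [f] is no homomorphism, but [G] and [S] carry products and sums consistently. Their images cover
    the new product set and the new sums, so these sets can only shrink while [|A|] is preserved. *)
Lemma sums_growth (R : realType) (K : fieldType) (A V : {fset K}) (alpha : R) m :
    [pchar K] =i pred0 -> 0 \notin A -> A != fset0 ->
    #|` pmul A A|%:R <= alpha * #|` A|%:R -> (1 < m)%N ->
    (forall u : 'I_m -> K, (forall i, u i \in A) -> \sum_i u i \in V) ->
  #|` A|%:R ^+ m <= expR (((m ^ m) ^ 17)%:R * (1 + alpha)) * #|` V|%:R :> R.
Proof.
move=> cK A0 An HA m1 HV.
have [L [iA [f [f_inj f_nz f_mul f_sum]]]] := transfer (enum_fset A) cK.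
have [iC] := ext_embedding L (complex R).
have fP b : b \in [fset f a | a in A] -> exists2 a, a \in A & b = f a.
  by case/imfsetP => a aA ->; exists a.
have mem_f a : a \in A -> f a \in [fset f a | a in A] by move=> aA; exact: in_imfset.
have card_f : #|` [fset f a | a in A]| = #|` A| by rewrite card_in_imfset.
have /choice [G HG] : forall c, exists z, forall a b, a \in A -> b \in A -> c = a * b -> z = f a * f b.
  move=> c; have [[a [b [aA bA E]]]|none] := pselect (exists a b, [/\ a \in A, b \in A & c = a * b]).
    by exists (f a * f b) => a' b' aA' bA' E'; apply: f_mul => //; rewrite -E.
  by exists 0 => a b aA bA E; case: none; exists a, b.
have /choice [S HS] : forall v, exists z, forall u : 'I_m -> K, (forall i, u i \in A) ->
    v = \sum_i u i -> z = \sum_i f (u i).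
  move=> v; have [[u [uA E]]|none] := pselect (exists u : 'I_m -> K, (forall i, u i \in A) /\ v = \sum_i u i).
    by exists (\sum_i f (u i)) => w wA E'; apply: f_sum => //; rewrite -E.
  by exists 0 => u uA E; case: none; exists u.
have := @growth_bound R L _ (hgt_is_height iA iC) [fset f a | a in A] [fset S v | v in V] alpha m.
rewrite card_f => H; apply: le_trans (H _ _ _ m1 _) _.
- by apply/negP => /fP [a aA E]; have := f_nz a aA (mem_neq0 A0 aA); rewrite -E eqxx.
- by have [a aA] := fset0Pn _ An; apply/fset0Pn; exists (f a); exact: mem_f.
- apply: le_trans HA; rewrite ler_nat; apply: (@fset_image_card _ _ _ _ G).
  move=> _ /pmulP [_ [_ [/fP [a aA ->] /fP [b bA ->] ->]]].
  by exists (a * b); [exact: mem_pmul | rewrite (HG _ a b)].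
- move=> w wf; have /choice [u Hu] : forall i, exists a, a \in A /\ w i = f a.
    by move=> i; have [a] := fP _ (wf i); exists a.
  apply/imfsetP; exists (\sum_i u i); first by apply: HV => i; case: (Hu i).
  rewrite (HS _ u) //; last by move=> i; case: (Hu i).
  by apply: eq_bigr => i _; case: (Hu i).
by rewrite ler_wpM2l ?expR_ge0 // ler_nat; exact: leq_imfset_card.
Qed.

Lemma sumset_growth (R : realType) (K : closedFieldType) (A : {fset K}) (alpha : R) m :
    [pchar K] =i pred0 -> 0 < alpha -> #|` prodset A|%:R <= alpha * #|` A|%:R -> (1 < m)%N ->
  #|` A|%:R ^+ m <= expR (m%:R ^+ (65 * m) * (alpha + 1)) * #|` sumset m A|%:R.
Proof.
move=> cK alpha0 HA m1; pose B := A `\ 0.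
have big0 : 0 <= (m%:R : R) ^+ (65 * m) * (alpha + 1) by rewrite mulr_ge0 ?exprn_ge0 ?ler0n //; lra.
have cA : (#|` A| <= 1 + #|` B|)%N by rewrite /B (cardfsD1 0 A) leq_add // leq_b1.
have [B0|Bn] := eqVneq B fset0.
  rewrite B0 cardfs0 in cA; have [A0|An] := eqVneq A fset0.
    by rewrite A0 cardfs0 expr0n gtn_eqF ?(ltnW m1) // mulr_ge0 ?expR_ge0.
  have [a aA] := fset0Pn _ An.
  apply: (@le_trans _ _ 1).
    by rewrite exprn_ile1 ?ler0n // lern1.
  have e1 : 1 <= expR (m%:R ^+ (65 * m) * (alpha + 1)).
    by apply: le_trans (expR_ge1Dx _); rewrite lerDl.
  have c1 : (1 : R) <= #|` sumset m A|%:R.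
    by rewrite ler1n cardfs_gt0; apply/fset0Pn; exists (\sum_(i < m) a); exact: mem_sumset.
  by rewrite -[X in X <= _]mulr1 ler_pM.
have sB : B `<=` A by apply: fsubsetDl.
have cB : (0 < #|` B|)%N by rewrite cardfs_gt0.
(* Since [|A| <= 1 + |B| <= 2 |B|], removing 0 doubles [alpha] here and costs [2^m] below. *)
have HB : #|` pmul B B|%:R <= 2 * alpha * #|` B|%:R.
  apply: (@le_trans _ _ (#|` prodset A|%:R)).
    rewrite ler_nat fsubset_leq_card //; exact: (pmulS sB sB).
  apply: le_trans HA _; rewrite mulrAC mulrC [2 * _]mulrC ler_wpM2r //; first exact: ltW.
  by rewrite -natrM ler_nat (leq_trans cA) // muln2 -addnn leq_add2r.
have B0 : 0 \notin B by rewrite /B !inE eqxx.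
have main := sums_growth cK B0 Bn HB m1 (fun u uB => mem_sumset (fun i => fsubsetP sB _ (uB i))).
apply: (@le_trans _ _ (2 ^+ m * #|` B|%:R ^+ m)).
  rewrite -exprMn lerXn2r ?nnegrE ?mulr_ge0 ?ler0n // -natrM ler_nat (leq_trans cA) //.
  by rewrite mul2n -addnn leq_add2r.
apply: (@le_trans _ _ (2 ^+ m * (expR (((m ^ m) ^ 17)%:R * (1 + 2 * alpha)) * #|` sumset m A|%:R))).
  by rewrite ler_wpM2l ?exprn_ge0.
rewrite mulrA ler_wpM2r ?ler0n //.
have e2 : (2 : R) <= expR 1 by have := @expR_ge1Dx R 1; lra.
apply: (@le_trans _ _ (expR m%:R * expR (((m ^ m) ^ 17)%:R * (1 + 2 * alpha)))).
  rewrite ler_wpM2r ?expR_ge0 // -[m%:R]mulr1 expRM_natl.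
  by rewrite lerXn2r ?nnegrE ?expR_ge0.
rewrite -expRD ler_expR.
set t := (m ^ m)%N.
have tm : (m <= t)%N by rewrite -{1}[m]expn1 leq_pexp2l // ltnW.
have t2 : (2 <= t)%N by exact: leq_trans tm.
have t17 : (m <= t ^ 17)%N by apply: leq_trans tm _; rewrite -{1}[t]expn1 leq_pexp2l // (ltnW t2).
(* One more factor [t] pays for the doubled [alpha] and for [2^m]: [2 t^17 <= t^18 = m^(18 m)],
   within [m^(65 m)]. *)
have t18 : (2 * t ^ 17 <= m ^ (65 * m))%N.
  apply: (@leq_trans (t ^ 18)); first by rewrite expnS leq_mul2r t2 orbT.
  by rewrite /t -expnM mulnC leq_pexp2l ?(ltnW m1) // leq_mul2r orbT.
have {}t17 : m%:R <= ((t ^ 17)%N%:R : R) by rewrite ler_nat.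
have {}t18 : 2 * (t ^ 17)%N%:R <= ((m ^ (65 * m))%N%:R : R).
  by rewrite -[2]/(2%:R) -(natrM R 2) ler_nat.
rewrite -natrX; move: t17 t18.
move: ((t ^ 17)%N%:R : R) ((m ^ (65 * m))%N%:R : R) => x y H1 H2.
have H3 : 2 * x * (alpha + 1) <= y * (alpha + 1) by rewrite ler_wpM2r //; lra.
have : m%:R + x * (1 + 2 * alpha) <= 2 * x * (alpha + 1) by lra.
lra.
Qed.
End SumsetGrowth.

Local Open Scope fset_scope.
Local Open Scope R_scope.

Theorem theorem2 (K : closedFieldType) (charK0 : ([pchar K] =i pred0)%R)
  (A : {fset K}) (alpha : R) (alpha_pos : 0 < alpha)
  (hAA : INR #|` prodset A| <= alpha * INR #|` A|)
  (h : nat) (h2 : (2 <= h)%N) :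
  exp (- (INR h ^ (65 * h)) * (alpha + 1)) * INR #|` A| ^ h
    <= INR #|` sumset h A|.
Proof.
move/RltP: alpha_pos => alpha_pos; move/RleP: hAA; rewrite !INRE => hAA.
have main := sumset_growth charK0 alpha_pos hAA h2.
apply/RleP; rewrite !RpowE RexpE !RoppE !RmultE !RplusE mulNr exp.expRN.
by rewrite mulrC ler_pdivrMr ?expR_gt0 // mulrC.
Qed.
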